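(* Let $0<\epsilon\leq 1$. In the sequential (RAM) model there is a deterministic incremental $(1+\epsilon)$-approximate single-source shortest paths algorithm for an unweighted undirected graph on $n$ nodes with a fixed source node $s$, under up to $q$ edge insertions, whose total update time is $$O\!\left(\frac{m\, n^{1/4}\sqrt{q}\,\log n}{\sqrt{\epsilon}}\right),$$ where $m$ is the number of edges in the final graph. It answers distance and path queries in optimal worst-case time.
   Context: The graph $G=(V,E)$ is unweighted and undirected with $|V|=n$ fixed; starting from an initial graph, edges are inserted one at a time (at most $q$ insertions in total), and $G$ denotes the current graph. A $(1+\epsilon)$-approximate SSSP algorithm maintains, for every node $v$ connected to $s$, an estimate $\tilde d(v)$ with $d_G(v,s)\leq \tilde d(v)\leq (1+\epsilon)\,d_G(v,s)$, together with a path from $v$ to $s$ in $G$ of length $\tilde d(v)$. The total update time is the total time spent processing all insertions. ''Optimal worst-case query time'' means a distance query is answered in $O(1)$ time and a path query in time proportional to the length of the returned path. *)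

(* Defs.v *)
From mathcomp Require Import all_boot all_order all_algebra.
From mathcomp Require Import all_classical all_reals all_analysis.
Set Implicit Arguments.
Unset Strict Implicit.
Unset Printing Implicit Defensive.
Import Order.TTheory GRing.Theory Num.Theory.
Local Open Scope nat_scope.

(* The machine is a unit-cost word RAM with a fixed number of registers per   *)
(* program, a word-addressed memory, and structured control flow.  Words are  *)
(* the naturals <= W; an instruction whose result exceeds W has no successor  *)
(* state, so the existence of a run certifies that no overflow occurs.        *)

Inductive binop := OAdd | OSub | OMul | ODiv | OMod | OLt | OEq.

(* Subtraction is truncated, x / 0 = 0 and x mod 0 = x. *)
Definition binop_eval (o : binop) (x y : nat) : nat :=
  match o with
  | OAdd => x + y
  | OSub => x - y
  | OMul => x * y
  | ODiv => x %/ y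
  | OMod => x %% y
  | OLt => x < y
  | OEq => x == y
  end.

(* Registers are named by naturals; a program mentions finitely many. *)
Inductive cmd :=
| Const of nat & nat                (* r := k          *)
| Binop of binop & nat & nat & nat  (* r := r1 o r2    *)
| Read of nat & nat                 (* r := mem[r1]    *)
| Write of nat & nat                (* mem[r] := r1    *)
| Emit of nat                       (* append r to the output *)
| Skip
| Seq of cmd & cmd
| If of nat & cmd & cmd             (* tests r <> 0    *)
| While of nat & cmd.               (* while r <> 0    *)

Record state := State {
  regs : nat -> nat;
  memory : nat -> nat;
  output : seq nat }.

Definition upd (f : nat -> nat) (x v : nat) : nat -> nat :=
  fun y => if y == x then v else f y.

(* exec W c st t st' : from st, the program c halts in st' after exactly t    *)
(* steps, all words being <= W. *)
Inductive exec (W : nat) : cmd -> state -> nat -> state -> Prop :=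
| ExConst r k st : k <= W ->
    exec W (Const r k) st 1 (State (upd (regs st) r k) (memory st) (output st))
| ExBinop o r r1 r2 st : binop_eval o (regs st r1) (regs st r2) <= W ->
    exec W (Binop o r r1 r2) st 1
      (State (upd (regs st) r (binop_eval o (regs st r1) (regs st r2)))
             (memory st) (output st))
| ExRead r r1 st :
    exec W (Read r r1) st 1
      (State (upd (regs st) r (memory st (regs st r1))) (memory st) (output st))
| ExWrite r r1 st :
    exec W (Write r r1) st 1
      (State (regs st) (upd (memory st) (regs st r) (regs st r1)) (output st))
| ExEmit r st :
    exec W (Emit r) st 1 (State (regs st) (memory st) (rcons (output st) (regs st r)))
| ExSkip st : exec W Skip st 1 st
| ExSeq c1 c2 st t1 st1 t2 st2 :
    exec W c1 st t1 st1 -> exec W c2 st1 t2 st2 ->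
    exec W (Seq c1 c2) st (t1 + t2) st2
| ExIfT r c1 c2 st t st1 : regs st r != 0 ->
    exec W c1 st t st1 -> exec W (If r c1 c2) st t.+1 st1
| ExIfF r c1 c2 st t st1 : regs st r = 0 ->
    exec W c2 st t st1 -> exec W (If r c1 c2) st t.+1 st1
| ExWhileF r c st : regs st r = 0 -> exec W (While r c) st 1 st
| ExWhileT r c st t1 st1 t2 st2 : regs st r != 0 ->
    exec W c st t1 st1 -> exec W (While r c) st1 t2 st2 ->
    exec W (While r c) st (t1 + t2).+1 st2.

(* The machine is deterministic: run time and result are functions of the     *)
(* program and the starting state. *)
Lemma exec_deterministic W c st t1 st1 t2 st2 :
  exec W c st t1 st1 -> exec W c st t2 st2 -> t1 = t2 /\ st1 = st2.
Proof.
move=> H; elim: H t2 st2 => {c st t1 st1};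
  intros; match goal with H : exec _ _ _ _ _ |- _ => inversion H; subst end;
  repeat match goal with
  | IH : forall t st, exec _ ?c ?s t st -> _, H : exec _ ?c ?s _ _ |- _ =>
      case: (IH _ _ H) => ? ?; clear H; subst
  | z : regs ?s ?r = 0, nz : is_true (regs ?s ?r != 0) |- _ =>
      by rewrite z in nz
  end; by [].
Qed.

(* Only memory persists between calls: each call starts with its arguments in *)
(* registers 0, 1, ..., all other registers 0, and an empty output. *)
Definition call_state (args : seq nat) (M : nat -> nat) : state :=
  State (nth 0 args) M [::].

Section Graph.
Variable n : nat.

(* A graph on 'I_n is given by the list of its edges; in a simple one no edge *)
(* is a loop or is listed twice (in either orientation), so that its number   *)
(* of edges is the length of the list. *)
Definition edges (E : seq ('I_n * 'I_n)) : seq {set 'I_n} :=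
  [seq [set e.1; e.2] | e <- E].

Definition simple_graph (E : seq ('I_n * 'I_n)) : bool :=
  all (fun e => e.1 != e.2) E && uniq (edges E).

Definition adj (E : seq ('I_n * 'I_n)) : rel 'I_n :=
  fun x y => [set x; y] \in edges E.

(* d_G(x, y) = d *)
Definition is_dist (E : seq ('I_n * 'I_n)) (x y : 'I_n) (d : nat) : Prop :=
  (exists p : seq 'I_n, [/\ path (adj E) x p, last x p = y & size p = d]) /\
  (forall p : seq 'I_n, path (adj E) x p -> last x p = y -> d <= size p).

(* p lists the nodes after x of a path from x to y; its length is size p. *)
Definition is_path (E : seq ('I_n * 'I_n)) (x y : 'I_n) (p : seq 'I_n) : Prop :=
  [/\ path (adj E) x p, last x p = y & uniq (x :: p)].

Inductive op :=
| Insert of 'I_n & 'I_n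
| DistQuery of 'I_n
| PathQuery of 'I_n.

Definition inserted (ops : seq op) : seq ('I_n * 'I_n) :=
  pmap (fun o => if o is Insert u v then Some (u, v) else None) ops.

(* Initial memory: n, s, the insertion budget q, the numerator and            *)
(* denominator of the accuracy, the number of initial edges, their endpoints. *)
Definition input (s : 'I_n) (q a b : nat) (E : seq ('I_n * 'I_n)) :
    nat -> nat :=
  nth 0 ([:: n; nat_of_ord s; q; a; b; size E] ++
         flatten [seq [:: nat_of_ord e.1; nat_of_ord e.2] | e <- E]).

Record event := Event { ev_op : op; ev_time : nat; ev_out : seq nat }.

Definition update_time (evs : seq event) : nat :=
  \sum_(e <- evs | if ev_op e is Insert _ _ then true else false) ev_time e.

End Graph.

Record algorithm := Algorithm {
  preprocess : cmd;
  insert_edge : cmd;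
  distance_query : cmd;
  path_query : cmd }.

Definition op_code (A : algorithm) n (o : op n) : cmd :=
  match o with
  | Insert _ _ => insert_edge A
  | DistQuery _ => distance_query A
  | PathQuery _ => path_query A
  end.

Definition op_args n (o : op n) : seq nat :=
  match o with
  | Insert u v => [:: nat_of_ord u; nat_of_ord v]
  | DistQuery v => [:: nat_of_ord v]
  | PathQuery v => [:: nat_of_ord v]
  end.

(* session W A M ops evs : starting with memory M, the online sequence of     *)
(* operations ops is processed by A, with run times and outputs evs. *)
Inductive session (W : nat) (A : algorithm) (n : nat) :
    (nat -> nat) -> seq (op n) -> seq (event n) -> Prop :=
| SessionNil M : session W A M [::] [::]
| SessionCons M o ops t st evs :
    exec W (op_code A o) (call_state (op_args o) M) t st ->
    session W A (memory st) ops evs ->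
    session W A M (o :: ops) (Event o t (output st) :: evs).

Local Open Scope ring_scope.

(* est is a (1 + eps)-approximation of the distances to s of the nodes        *)
(* connected to s. *)
Definition approximates (R : realType) (eps : R) n (E : seq ('I_n * 'I_n))
    (s : 'I_n) (est : 'I_n -> nat) : Prop :=
  forall (v : 'I_n) (d : nat), is_dist E v s d ->
    (d <= est v)%N /\ (est v)%:R <= (1 + eps) * d%:R.

(* The event e, occurring while the graph is E, is (if it is a query)         *)
(* answered according to est in optimal time, with constant C.  The empty     *)
(* output reports that the queried node is not connected to s; the factor     *)
(* size p + 1 is needed because the path from s to s has length 0. *)
Definition answered (R : realType) (C : R) n (E : seq ('I_n * 'I_n))
    (s : 'I_n) (est : 'I_n -> nat) (e : event n) : Prop :=
  match ev_op e with
  | Insert _ _ => True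
  | DistQuery v =>
      ev_out e = (if connect (adj E) v s then [:: est v] else [::]) /\
      (ev_time e)%:R <= C
  | PathQuery v =>
      if connect (adj E) v s then
        exists p : seq 'I_n,
          [/\ is_path E v s p, size p = est v,
              ev_out e = map (@nat_of_ord n) (v :: p) &
              (ev_time e)%:R <= C * (size p).+1%:R]
      else ev_out e = [::] /\ (ev_time e)%:R <= C
  end.

(* Main.v *)
(* Let X0 be about (q^2 n / eps^2)^(1/4).  For every X among X0, 2 X0, 4 X0, ...
   a level structure with levels capped at 2 X serves the nodes at distance
   between X/2 and X from s.  The first one is an exact Even-Shiloach tree, of
   total cost O(m X0).  Each other one holds the levels l of an outdated graph:
   inserting an edge uv adds its excess |l u - l v| - 1 to a debt D, and a
   breadth-first search rebuilds the levels as soon as D > eps X / 2.  Since a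
   simple path uses every pending edge at most once, the levels exceed the
   distances by at most D.  If D was accumulated by k insertions, one of them
   has an excess x >= D / k, and the rebuild lowers the i-th node of a path
   from its far end to s by at least x - 2 i, so that the sum of the levels, at most
   2 n X initially, drops by x^2 / 4.  Hence every rebuild consumes q / (8 X0)
   insertions or n X / (8 X0) of the level sum, and there are O(X0) of them.
   An edge that joins a new component to s has no path along which levels drop;
   it is handled as in the Even-Shiloach tree, which scans every node once per
   structure.  With O(log n) structures the total is O(m X0 log n).  The
   smallest level of a node over all structures answers its queries. *)

Require Import Defs.
From mathcomp Require Import all_boot all_order all_algebra.
From mathcomp Require Import all_classical all_reals all_analysis.
From mathcomp Require Import zify ring lra.
Set Implicit Arguments.
Unset Strict Implicit.
Unset Printing Implicit Defensive.
Import Order.TTheory GRing.Theory Num.Theory.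
Local Open Scope nat_scope.


(** * A small imperative language over the word RAM *)

(** The value of X0 is dictated by the smallest scale. If fewer than q / (8 X0) insertions made up
    the debt of a scale X, some excess x exceeds 4 eps X X0 / q, and x^2 / 4 reaches n X / (8 X0) as
    soon as 32 eps^2 X X0^3 >= q^2 n. The choice X0^4 >= q^2 n / eps^2 ensures this for every X >=
    X0. The smallest scale must be exact because the nodes it serves have no lower bound on their
    distance against which a debt could be measured. A level below the cap is always the length of a
    path of parents in the current graph. Hence estimates never fall below distances and path
    queries only follow parents; the debt enters the upper bound alone. A run of the machine also
    certifies the absence of overflow, so that word sizes have to be controlled together with time.
    The programs are therefore written in an intermediate language in which only assigned and stored
    values need a bound, and whose clock is the exact machine time. *)

Inductive expr :=
| EConst of nat
| EVar of nat
| EBin of binop & expr & expr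
| ERaw of expr
| EArr of nat & expr.

Inductive prog :=
| PAsgn of nat & expr
| PStore of nat & expr & expr
| PEmit of expr
| PSkip
| PSeq of prog & prog
| PIf of expr & prog & prog
| PWhile of expr & prog.

(* Memory is viewed as ten interleaved arrays. *)
Definition aget (M : nat -> nat) (a i : nat) : nat := M (10 * i + a).
Definition aset (M : nat -> nat) (a i v : nat) : nat -> nat :=
  upd M (10 * i + a) v.
Arguments aget : simpl never.
Arguments aset : simpl never.
Arguments upd _ _ _ _ /.

Lemma aget_set M a i v b j : a < 10 -> b < 10 ->
  aget (aset M a i v) b j = if (b == a) && (j == i) then v else aget M b j.
Proof.
rewrite /aget /aset /upd => ha hb.
case: ifP => [|/negP h]; last by case: ifP => // /andP[/eqP ? /eqP ?]; subst; case: h.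
by move=> /eqP h; have [-> ->] : b = a /\ j = i; [lia | rewrite !eqxx].
Qed.

Lemma aget_set_other M a i v b : a < 10 -> b < 10 -> b != a ->
  aget (aset M a i v) b = aget M b.
Proof.
move=> ha hb /negbTE ne; apply: funext => j.
by rewrite aget_set // ne.
Qed.

Lemma aget_set_same M a i v : a < 10 ->
  aget (aset M a i v) a = upd (aget M a) i v.
Proof. by move=> ha; apply: funext => j; rewrite aget_set // eqxx. Qed.

Fixpoint ev (x M : nat -> nat) (e : expr) : nat :=
  match e with
  | EConst k => k
  | EVar y => x y
  | EBin o e1 e2 => binop_eval o (ev x M e1) (ev x M e2)
  | ERaw e => M (ev x M e)
  | EArr a e => aget M a (ev x M e)
  end.

(** These are the instruction counts of [cexp]: a register copy is a zero followed by an addition,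
    and an array access forms 10 times the index plus the array number before reading. *)
Fixpoint cost (e : expr) : nat :=
  match e with
  | EConst _ => 1
  | EVar _ => 2
  | EBin _ e1 e2 => cost e1 + cost e2 + 1
  | ERaw e => cost e + 1
  | EArr _ e => cost e + 5
  end.

(* All stored words are kept at most V; an expression e then evaluates to at
   most V ^ deg e, so that no intermediate result exceeds V ^ 40. *)
Fixpoint deg (e : expr) : nat :=
  match e with
  | EConst _ => 1
  | EVar _ => 1
  | EBin _ e1 e2 => deg e1 + deg e2
  | ERaw e => deg e
  | EArr _ e => deg e + 2
  end.

Record hst := Hst {
  var : nat -> nat; mem : nat -> nat; out : seq nat; clk : nat }.

Definition tick k s := Hst (var s) (mem s) (out s) (clk s + k).

(* Registers from ntemp on hold intermediate results of expressions. *)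
Definition ntemp := 32.

(** Constants up to 256 count as stored words, because [V] is taken to be at least 256. *)
Fixpoint wfe (e : expr) : bool :=
  match e with
  | EConst k => k <= 256
  | EVar x => x < ntemp
  | EBin _ e1 e2 => wfe e1 && wfe e2
  | ERaw e => wfe e
  | EArr a e => (a < 10) && wfe e
  end.

Definition ok_expr e := wfe e && (deg e <= 40).

(** Turning the index of a store into an address costs two more degrees, whence 38 instead of 40. *)
Fixpoint ok_prog (c : prog) : bool :=
  match c with
  | PAsgn x e => (x < ntemp) && ok_expr e
  | PStore a e1 e2 => [&& a < 10, ok_expr e1, deg e1 <= 38 & ok_expr e2]
  | PEmit e => ok_expr e
  | PSkip => true
  | PSeq c1 c2 => ok_prog c1 && ok_prog c2
  | PIf e c1 c2 => [&& ok_expr e, ok_prog c1 & ok_prog c2]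
  | PWhile e c => ok_expr e && ok_prog c
  end.

(** Only assigned and stored values are required to be at most [V]; intermediate results and emitted
    words are controlled by their degree. *)
Inductive hexec (V : nat) : prog -> hst -> hst -> Prop :=
| HAsgn x e s : ev (var s) (mem s) e <= V ->
    hexec V (PAsgn x e) s
      (Hst (upd (var s) x (ev (var s) (mem s) e)) (mem s) (out s)
           (clk s + (cost e + 2)))
| HStore a e1 e2 s : ev (var s) (mem s) e2 <= V ->
    hexec V (PStore a e1 e2) s
      (Hst (var s)
           (aset (mem s) a (ev (var s) (mem s) e1) (ev (var s) (mem s) e2))
           (out s) (clk s + (cost e1 + cost e2 + 5)))
| HEmit e s :
    hexec V (PEmit e) s
      (Hst (var s) (mem s) (rcons (out s) (ev (var s) (mem s) e))
           (clk s + (cost e + 1)))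
| HSkip s : hexec V PSkip s (tick 1 s)
| HSeq c1 c2 s1 s2 s3 : hexec V c1 s1 s2 -> hexec V c2 s2 s3 ->
    hexec V (PSeq c1 c2) s1 s3
| HIfT e c1 c2 s s' : ev (var s) (mem s) e != 0 ->
    hexec V c1 (tick (cost e + 1) s) s' -> hexec V (PIf e c1 c2) s s'
| HIfF e c1 c2 s s' : ev (var s) (mem s) e = 0 ->
    hexec V c2 (tick (cost e + 1) s) s' -> hexec V (PIf e c1 c2) s s'
| HWhileF e c s : ev (var s) (mem s) e = 0 ->
    hexec V (PWhile e c) s (tick (cost e + 1) s)
| HWhileT e c s s1 s2 : ev (var s) (mem s) e != 0 ->
    hexec V c (tick (cost e + 1) s) s1 -> hexec V (PWhile e c) s1 s2 ->
    hexec V (PWhile e c) s s2.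

(** * Compilation to the machine, exact in time and free of overflow *)

Fixpoint cexp (d : nat) (e : expr) : cmd :=
  match e with
  | EConst k => Const d k
  | EVar x => Seq (Const d 0) (Binop OAdd d x d)
  | EBin o e1 e2 => Seq (cexp d e1) (Seq (cexp d.+1 e2) (Binop o d d d.+1))
  | ERaw e => Seq (cexp d e) (Read d d)
  | EArr a e =>
      Seq (cexp d e)
        (Seq (Const d.+1 10) (Seq (Binop OMul d d.+1 d)
        (Seq (Const d.+1 a) (Seq (Binop OAdd d d d.+1) (Read d d)))))
  end.

Fixpoint cprog (c : prog) : cmd :=
  match c with
  | PAsgn x e =>
      Seq (cexp ntemp e) (Seq (Const x 0) (Binop OAdd x ntemp x))
  | PStore a e1 e2 =>
      Seq (cexp ntemp e1)
        (Seq (Const ntemp.+1 10) (Seq (Binop OMul ntemp ntemp.+1 ntemp)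
        (Seq (Const ntemp.+1 a) (Seq (Binop OAdd ntemp ntemp ntemp.+1)
        (Seq (cexp ntemp.+1 e2) (Write ntemp ntemp.+1))))))
  | PEmit e => Seq (cexp ntemp e) (Emit ntemp)
  | PSkip => Skip
  | PSeq c1 c2 => Seq (cprog c1) (cprog c2)
  | PIf e c1 c2 => Seq (cexp ntemp e) (If ntemp (cprog c1) (cprog c2))
  | PWhile e c =>
      Seq (cexp ntemp e) (While ntemp (Seq (cprog c) (cexp ntemp e)))
  end.

Section Compile.
Variables (V W : nat).
Hypotheses (V_ge : 256 <= V) (W_ge : V ^ 40 <= W).

Lemma W_pow d x : d <= 40 -> x <= V ^ d -> x <= W.
Proof.
move=> hd /leq_trans; apply; apply: leq_trans W_ge.
by rewrite leq_exp2l //; lia.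
Qed.

Lemma deg_gt0 e : 0 < deg e.
Proof. by elim: e => //= *; lia. Qed.

Lemma V_pow_gt1 d : 0 < d -> 1 < V ^ d.
Proof. by move=> hd; rewrite -(exp1n d) ltn_exp2r //; lia. Qed.

(** Both powers are at least 2, so their sum is at most their product. This lets degrees add up
    under every operation, as they do under multiplication. *)
Lemma pow_add_le d1 d2 x y : 0 < d1 -> 0 < d2 ->
  x <= V ^ d1 -> y <= V ^ d2 -> x + y <= V ^ (d1 + d2).
Proof.
move=> h1 h2 hx hy; rewrite expnD.
have := V_pow_gt1 h1; have := V_pow_gt1 h2.
move: hx hy; set a := V ^ d1; set b := V ^ d2; nia.
Qed.

Lemma pow_bin_le o d1 d2 x y : 0 < d1 -> 0 < d2 ->
  x <= V ^ d1 -> y <= V ^ d2 -> binop_eval o x y <= V ^ (d1 + d2).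
Proof.
move=> h1 h2 hx hy; have h := pow_add_le h1 h2 hx hy.
have := V_pow_gt1 (ltn_addr d2 h1) => h'.
case: o => /=; try lia; first by rewrite expnD leq_mul.
by apply: leq_trans (leq_trans (leq_div x y) (leq_addr y x)) h.
Qed.

Definition bnd (x M : nat -> nat) :=
  (forall y, y < ntemp -> x y <= V) /\ forall j, M j <= V.

Lemma addr_le d x a : 0 < d -> a < 10 -> x <= V ^ d ->
  10 * x <= V ^ (d + 2) /\ 10 * x + a <= V ^ (d + 2).
Proof.
move=> hd ha hx; rewrite expnD; have h := V_pow_gt1 hd.
move: hx h; set b := V ^ d => hx h.
have : 65536 <= V ^ 2 by rewrite (@leq_exp2r 256 V 2).
by set c := V ^ 2; nia.
Qed.

Lemma ev_bound x M e : bnd x M -> wfe e -> ev x M e <= V ^ deg e.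
Proof.
move=> [hx hM]; have V1 d : 0 < d -> V <= V ^ d.
  by move=> hd; rewrite -{1}(expn1 V) leq_exp2l //; lia.
elim: e => [k|y|o e1 IH1 e2 IH2|e IH|a e IH] /=.
- by move=> hk; rewrite expn1; apply: leq_trans hk V_ge.
- by move=> /hx; rewrite expn1.
- move=> /andP[/IH1 h1 /IH2 h2].
  by apply: pow_bin_le => //; exact: deg_gt0.
- by move=> _; apply: leq_trans (hM _) (V1 _ (deg_gt0 _)).
- by move=> _; apply: leq_trans (hM _) (V1 _ _); lia.
Qed.

(** The target register is arbitrary because the second operand of an operation is evaluated one
    register above the first, whose value has to survive. *)
Lemma exec_exp x e d st : ntemp <= d -> bnd x (memory st) ->
  (forall y, y < ntemp -> regs st y = x y) -> ok_expr e ->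
  exists st', [/\ exec W (cexp d e) st (cost e) st',
    regs st' d = ev x (memory st) e,
    forall y, y < d -> regs st' y = regs st y,
    memory st' = memory st & output st' = output st].
Proof.
move=> + hb; rewrite /ok_expr.
elim: e d st hb => [k|y|o e1 IH1 e2 IH2|e IH|a e IH] d st hb hd hr /= /andP[hwf hdeg].
- eexists; split; first by apply: ExConst; apply: (@W_pow 1) => //; rewrite expn1; lia.
  + by rewrite /= eqxx.
  + by move=> y hy /=; case: eqP => //; lia.
  + by [].
  + by [].
- have hy : regs st y <= W.
    by rewrite hr //; apply: (@W_pow 1) => //; rewrite expn1; apply: hb.1.
  have yd : (y == d) = false by apply/eqP; lia.
  eexists; split.
  + apply: (ExSeq (t1 := 1) (t2 := 1)); first exact: ExConst.
    by apply: ExBinop; rewrite /= eqxx yd; lia.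
  + by rewrite /= !eqxx yd hr //; lia.
  + by move=> z hz /=; case: eqP => //; lia.
  + by [].
  + by [].
- case/andP: hwf => wf1 wf2.
  have p1 := deg_gt0 e1; have p2 := deg_gt0 e2.
  have [|st1 [ex1 r1 f1 m1 o1]] := IH1 d st hb hd hr; first by rewrite wf1; lia.
  have hb1 : bnd x (memory st1) by rewrite m1.
  have [||st2 [ex2 r2 f2 m2 o2]] := IH2 d.+1 st1 hb1 (leqW hd).
  + by move=> y hy; rewrite f1 ?hr //; lia.
  + by rewrite wf2; lia.
  have rd : regs st2 d = ev x (memory st) e1 by rewrite f2 // r1.
  rewrite m1 in r2; eexists; split.
  + rewrite -addnA; apply: ExSeq ex1 _; apply: ExSeq ex2 _; apply: ExBinop.
    rewrite rd r2; apply: (@W_pow (deg e1 + deg e2)) => //.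
    by apply: pow_bin_le => //; apply: ev_bound.
  + by rewrite /= eqxx rd r2.
  + move=> y hy /=; have -> : (y == d) = false by apply/eqP; lia.
    by rewrite f2 ?f1 //; lia.
  + by rewrite /= m2.
  + by rewrite /= o2.
- have [|st1 [ex1 r1 f1 m1 o1]] := IH d st hb hd hr; first by rewrite hwf.
  eexists; split; first by apply: ExSeq ex1 _; exact: ExRead.
  + by rewrite /= eqxx r1 m1.
  + by move=> y hy /=; have -> : (y == d) = false by [apply/eqP; lia]; rewrite f1.
  + by rewrite /= m1.
  + by rewrite /= o1.
- case/andP: hwf => ha hwf; have p := deg_gt0 e.
  have [|st1 [ex1 r1 f1 m1 o1]] := IH d st hb hd hr; first by rewrite hwf; lia.
  have [A1 A2] := addr_le p ha (ev_bound hb hwf).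
  have B1 := W_pow hdeg A1; have B2 := W_pow hdeg A2.
  have dd : (d == d.+1) = false by apply/eqP; lia.
  have d' : (d.+1 == d) = false by apply/eqP; lia.
  eexists; split.
  + apply: ExSeq ex1 _; apply: (ExSeq (t1 := 1) (t2 := 4)).
      by apply: ExConst; apply: (@W_pow 1) => //; rewrite expn1; lia.
    apply: (ExSeq (t1 := 1) (t2 := 3)); first by apply: ExBinop; rewrite /= eqxx dd r1.
    apply: (ExSeq (t1 := 1) (t2 := 2)).
      by apply: ExConst; apply: (@W_pow 1) => //; rewrite expn1; lia.
    apply: (ExSeq (t1 := 1) (t2 := 1)); last exact: ExRead.
    by apply: ExBinop; rewrite /= !eqxx dd r1.
  + by rewrite /= !eqxx dd /= r1 m1.
  + move=> y hy /=; have -> : (y == d) = false by apply/eqP; lia.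
    by have -> : (y == d.+1) = false by [apply/eqP; lia]; rewrite f1.
  + by rewrite /= m1.
  + by rewrite /= o1.
Qed.

Definition sim (s : hst) (st : state) :=
  [/\ forall y, y < ntemp -> regs st y = var s y, memory st = mem s,
      output st = out s & bnd (var s) (mem s)].

Lemma sim_exp s st e d : ntemp <= d -> sim s st -> ok_expr e ->
  exists st', [/\ exec W (cexp d e) st (cost e) st', sim s st',
    regs st' d = ev (var s) (mem s) e & forall y, y < d -> regs st' y = regs st y].
Proof.
move=> hd [hr hm ho hb] he; rewrite -hm in hb.
have [st' [h1 h2 h3 h4 h5]] := exec_exp hd hb hr he.
exists st'; split => //; last by rewrite h2 hm.
by split; [move=> y hy; rewrite h3 ?hr //; lia | rewrite h4 | rewrite h5 | rewrite -hm].
Qed.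

Theorem compile_correct c s s' st : hexec V c s s' -> ok_prog c -> sim s st ->
  exists t st', [/\ exec W (cprog c) st t st', sim s' st' & clk s' = clk s + t].
Proof.
have le1 k : k <= V -> k <= W by move=> h; apply: (@W_pow 1) => //; rewrite expn1.
move=> H; elim: H st => {c s s'}.
- move=> x e s hv st /= /andP[hx he] hs.
  have [st1 [ex1 [r1 m1 o1 b1] v1 f1]] := sim_exp (leqnn _) hs he.
  have nx : (ntemp == x) = false by apply/eqP; lia.
  exists (cost e + (1 + 1)); eexists; split.
  + apply: ExSeq ex1 _; apply: ExSeq; first exact: ExConst.
    by apply: ExBinop; rewrite /= nx eqxx v1 addn0; exact: le1.
  + split => //=.
    * by move=> y hy; case: eqP => // _; [rewrite nx eqxx v1 addn0 | exact: r1].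
    * split; last exact: b1.2.
      by move=> y hy /=; case: eqP => // _; exact: b1.1.
  + by rewrite /=; lia.
- move=> a e1 e2 s hv st /= /and4P[ha he1 hd1 he2] hs.
  have [st1 [ex1 hs1 v1 f1]] := sim_exp (leqnn _) hs he1.
  have [r1 m1 o1 b1] := hs1.
  have wf1 : wfe e1 by case/andP: he1.
  have [A1 A2] := addr_le (deg_gt0 e1) ha (ev_bound b1 wf1).
  have hd2 : deg e1 + 2 <= 40 by lia.
  have B1 := W_pow hd2 A1; have B2 := W_pow hd2 A2.
  have k10 : 10 <= W by apply: le1; lia.
  have ka : a <= W by apply: le1; lia.
  set v := ev (var s) (mem s) e1 in v1 B1 B2.
  set st2 := State (upd (upd (upd (upd (regs st1) ntemp.+1 10) ntemp (10 * v)) ntemp.+1 a) ntemp (10 * v + a)) (memory st1) (output st1).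
  have ex2 tl c st' : exec W c st2 tl st' -> exec W (Seq (Const ntemp.+1 10) (Seq (Binop OMul ntemp ntemp.+1 ntemp)
        (Seq (Const ntemp.+1 a) (Seq (Binop OAdd ntemp ntemp ntemp.+1) c)))) st1 (1 + (1 + (1 + (1 + tl)))) st'.
    move=> ex.
    apply: ExSeq; first exact: ExConst.
    apply: ExSeq; first by apply: ExBinop => /=; rewrite v1.
    apply: ExSeq; first exact: ExConst.
    apply: ExSeq; first by apply: ExBinop => /=; rewrite v1.
    by move: ex; rewrite /st2 /= v1.
  have hs2 : sim s st2.
    split=> //= y hy; have -> : (y == ntemp) = false by apply/eqP; lia.
    by have -> : (y == ntemp.+1) = false by [apply/eqP; lia]; rewrite r1.
  have [st3 [ex3 [r3 m3 o3 b3] v3 f3]] := sim_exp (leqnSn ntemp) hs2 he2.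
  exists (cost e1 + (1 + (1 + (1 + (1 + (cost e2 + 1)))))); eexists; split.
  + by apply: ExSeq ex1 _; apply: ex2; apply: ExSeq ex3 _; apply: ExWrite.
  + split => //=.
    * by rewrite v3 f3 //= m3.
    * split; first exact: b3.1.
      by move=> j; rewrite /aset /=; case: eqP => // _; exact: b3.2.
  + by rewrite /=; lia.
- move=> e s st he hs.
  have [st1 [ex1 [r1 m1 o1 b1] v1 f1]] := sim_exp (leqnn _) hs he.
  exists (cost e + 1); eexists; split.
  + by apply: ExSeq ex1 _; apply: ExEmit.
  + by split => //=; rewrite v1 o1.
  + by [].
- by move=> s st _ hs; exists 1, st; split => //; apply: ExSkip.
- move=> c1 c2 s1 s2 s3 _ IH1 _ IH2 st /= /andP[/IH1 {}IH1 /IH2 {}IH2] /IH1.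
  move=> [t1 [st1 [ex1 /IH2[t2 [st2 [ex2 hs2 c2']]] c1']]].
  by exists (t1 + t2), st2; split => //; [apply: ExSeq ex1 ex2 | lia].
- move=> e c1 c2 s s' h _ IH st /= /and3P[he hc1 hc2] hs.
  have [st1 [ex1 hs1 v1 f1]] := sim_exp (leqnn _) hs he.
  have [t [st2 [ex2 hs2 /= c']]] := IH st1 hc1 hs1.
  exists (cost e + t.+1), st2; split => //; last by lia.
  by apply: ExSeq ex1 _; apply: ExIfT => //; rewrite v1.
- move=> e c1 c2 s s' h _ IH st /= /and3P[he hc1 hc2] hs.
  have [st1 [ex1 hs1 v1 f1]] := sim_exp (leqnn _) hs he.
  have [t [st2 [ex2 hs2 /= c']]] := IH st1 hc2 hs1.
  exists (cost e + t.+1), st2; split => //; last by lia.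
  by apply: ExSeq ex1 _; apply: ExIfF => //; rewrite v1.
- move=> e c s h st /= /andP[he hc] hs.
  have [st1 [ex1 hs1 v1 f1]] := sim_exp (leqnn _) hs he.
  exists (cost e + 1), st1; split => //.
  by apply: ExSeq ex1 _; apply: ExWhileF; rewrite v1.
- move=> e c s s1 s2 h _ IH1 _ IH2 st /= /andP[he hc] hs.
  have [st1 [ex1 hs1 v1 f1]] := sim_exp (leqnn _) hs he.
  have [t1 [st2 [ex2 hs2 /= c1]]] := IH1 st1 hc hs1.
  have [|t2 [st3 [ex3 hs3 c2]]] := IH2 st2 _ hs2; first by rewrite /= he.
  (* The compiled loop begins by evaluating its test. Inversion splits this evaluation from the bare
     [While], so that it can be regrouped with the end of the body just executed. *)
  inversion ex3; subst.
  exists (cost e + ((t1 + t0) + t3).+1), st3; split => //; last by lia.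
  apply: ExSeq ex1 _; apply: ExWhileT; first by rewrite v1.
    by apply: ExSeq ex2 _; eassumption.
  by [].
Qed.

End Compile.

(** * Weakest preconditions for total correctness *)

Section WP.
Variable V : nat.

(** Being existential, it exhibits a terminating run that respects the word bound; a bound on [clk]
    in the postcondition thus bounds the running time. *)
Definition wp (c : prog) (Q : hst -> Prop) (s : hst) : Prop :=
  exists s', hexec V c s s' /\ Q s'.

Lemma wp_mono c (Q Q' : hst -> Prop) s :
  wp c Q s -> (forall s', Q s' -> Q' s') -> wp c Q' s.
Proof. by move=> [s' [h1 h2]] h; exists s'; split => //; exact: h. Qed.

Lemma wp_asgn x e (Q : hst -> Prop) s : ev (var s) (mem s) e <= V ->
  Q (Hst (upd (var s) x (ev (var s) (mem s) e)) (mem s) (out s)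
         (clk s + (cost e + 2))) -> wp (PAsgn x e) Q s.
Proof. by move=> h q; eexists; split; first exact: HAsgn. Qed.

Lemma wp_store a e1 e2 (Q : hst -> Prop) s : ev (var s) (mem s) e2 <= V ->
  Q (Hst (var s) (aset (mem s) a (ev (var s) (mem s) e1) (ev (var s) (mem s) e2))
         (out s) (clk s + (cost e1 + cost e2 + 5))) -> wp (PStore a e1 e2) Q s.
Proof. by move=> h q; eexists; split; first exact: HStore. Qed.

Lemma wp_emit e (Q : hst -> Prop) s :
  Q (Hst (var s) (mem s) (rcons (out s) (ev (var s) (mem s) e))
         (clk s + (cost e + 1))) -> wp (PEmit e) Q s.
Proof. by move=> q; eexists; split; first exact: HEmit. Qed.

Lemma wp_skip (Q : hst -> Prop) s : Q (tick 1 s) -> wp PSkip Q s.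
Proof. by move=> q; eexists; split; first exact: HSkip. Qed.

Lemma wp_seq c1 c2 (Q : hst -> Prop) s : wp c1 (wp c2 Q) s -> wp (PSeq c1 c2) Q s.
Proof.
by move=> [s1 [h1 [s2 [h2 q]]]]; exists s2; split => //; apply: HSeq h1 h2.
Qed.

Lemma wp_if e c1 c2 (Q : hst -> Prop) s :
  (ev (var s) (mem s) e != 0 -> wp c1 Q (tick (cost e + 1) s)) ->
  (ev (var s) (mem s) e = 0 -> wp c2 Q (tick (cost e + 1) s)) ->
  wp (PIf e c1 c2) Q s.
Proof.
move=> h1 h2; have [z|nz] := eqVneq (ev (var s) (mem s) e) 0.
  by have [s' [ex q]] := h2 z; exists s'; split => //; apply: HIfF.
by have [s' [ex q]] := h1 nz; exists s'; split => //; apply: HIfT.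
Qed.

Lemma wp_while e c (Q : hst -> Prop) s :
  (ev (var s) (mem s) e = 0 -> Q (tick (cost e + 1) s)) ->
  (ev (var s) (mem s) e != 0 ->
     wp c (wp (PWhile e c) Q) (tick (cost e + 1) s)) ->
  wp (PWhile e c) Q s.
Proof.
move=> hF hT; have [z|nz] := eqVneq (ev (var s) (mem s) e) 0.
  by exists (tick (cost e + 1) s); split; [exact: HWhileF | exact: hF].
have [s1 [ex1 [s2 [ex2 q]]]] := hT nz.
by exists s2; split => //; apply: HWhileT ex1 ex2.
Qed.

(** For loops whose number m of iterations is known in advance: the first hypothesis makes the test
    fail exactly at k = m, and termination is an induction on m - k. *)
Lemma wp_for (I : nat -> hst -> Prop) m e c (Q : hst -> Prop) :
  (forall k s, k <= m -> I k s -> (ev (var s) (mem s) e == 0) = (k == m)) ->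
  (forall k s, k < m -> I k s -> wp c (I k.+1) (tick (cost e + 1) s)) ->
  (forall s, I m s -> Q (tick (cost e + 1) s)) ->
  forall k s, k <= m -> I k s -> wp (PWhile e c) Q s.
Proof.
move=> he hI hQ k; have [d dE] : exists d, m - k = d by eexists.
elim: d k dE => [|d IH] k dk s km i; apply: wp_while.
- by move=> /eqP; rewrite (he k s km i) => /eqP ?; subst k; apply: hQ.
- by rewrite (he k s km i); have -> : k = m by [lia]; rewrite eqxx.
- by move=> /eqP; rewrite (he k s km i) => /eqP; lia.
- move=> _; have lt : k < m by lia.
  by apply: wp_mono (hI k s lt i) _ => s'; apply: IH; lia.
Qed.

End WP.

(** * Breadth-first search steps *)

Definition nb (E : seq (nat * nat)) : rel nat :=
  fun x y => ((x, y) \in E) || ((y, x) \in E).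

Definition conn (E : seq (nat * nat)) (s x : nat) : Prop :=
  exists2 p, path (nb E) x p & last x p = s.

Definition dg (E : seq (nat * nat)) (x : nat) : nat :=
  \sum_(e <- E) ((e.1 == x) + (e.2 == x)).

Lemma nbC E x y : nb E x y = nb E y x.
Proof. by rewrite /nb orbC. Qed.

Lemma nb_sub E E' : {subset E <= E'} -> subrel (nb E) (nb E').
Proof. by move=> h x y /orP[/h|/h] h'; apply/orP; [left|right]. Qed.

Lemma nb_rcons E u v x y :
  nb (rcons E (u, v)) x y =
  [|| nb E x y, (x == u) && (y == v) | (x == v) && (y == u)].
Proof.
rewrite /nb !mem_rcons !inE !xpair_eqE [(y == u) && _]andbC.
by case: (_ && _); case: (_ && _); rewrite ?orbT ?orbF.
Qed.

Lemma conn_sub E E' s x : {subset E <= E'} -> conn E s x -> conn E' s x.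
Proof.
by move=> h [p hp hl]; exists p => //; apply: sub_path hp; apply: nb_sub.
Qed.

Lemma conn_step E s x y : nb E x y -> conn E s y -> conn E s x.
Proof. by move=> h [p hp hl]; exists (y :: p) => //=; rewrite h. Qed.

Lemma conn_refl E s : conn E s s.
Proof. by exists [::]. Qed.

Lemma dg_gt0 E x y : nb E x y -> 0 < dg E x.
Proof.
rewrite /dg; elim: E => [|e E IH]; first by rewrite /nb !in_nil.
rewrite big_cons /nb !inE => /orP[/orP[/eqP <-|h]|/orP[/eqP <-|h]].
- by rewrite eqxx.
- by rewrite addn_gt0 IH ?orbT // /nb h.
- by rewrite eqxx addn_gt0 addnC.
- by rewrite addn_gt0 IH ?orbT // /nb h orbT.
Qed.

(* [bsc v] is the scale attaining the estimate [bst v]; the queue keeps the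
   nodes already scanned. *)
Record bfs := Bfs {
  lev : nat -> nat; par : nat -> nat; bst : nat -> nat; bsc : nat -> nat;
  que : seq nat }.

Definition push (i x k y : nat) (b : bfs) : bfs :=
  Bfs (upd (lev b) y k) (upd (par b) y x)
      (if k < bst b y then upd (bst b) y k else bst b)
      (if k < bst b y then upd (bsc b) y i else bsc b)
      (rcons (que b) y).

Definition try_push (i x k y : nat) (b : bfs) : bfs :=
  if k < lev b y then push i x k y b else b.

(* The condition on the levels in the queue holds because it is processed in
   FIFO order; it implies that no node is queued twice. *)
Inductive steps (E : seq (nat * nat)) (i : nat) (b : bfs) : bfs -> Prop :=
| Steps0 : steps E i b b
| StepsS b' x y : steps E i b b' -> x \in que b' ->
    (forall z, z \in que b' -> lev b' z <= lev b' x + 1) -> nb E x y ->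
    lev b' x + 1 < lev b' y -> steps E i b (push i x (lev b' x + 1) y b').

(** With truncated subtraction at most one summand is nonzero; the value is the level difference
    minus 1, cut off at 0. *)
Definition exc (l : nat -> nat) (e : nat * nat) : nat :=
  (l e.1 - l e.2 - 1) + (l e.2 - l e.1 - 1).

Lemma step_fresh (b : bfs) x y :
  (forall z, z \in que b -> lev b z <= lev b x + 1) ->
  lev b x + 1 < lev b y -> y \notin que b.
Proof. by move=> h lt; apply/negP => /h; rewrite leqNgt lt. Qed.


Section Steps.
Variables (E : seq (nat * nat)) (i : nat).

Lemma steps_mono b b' v : steps E i b b' -> lev b' v <= lev b v.
Proof.
elim=> // c x y _ IH _ _ _ lt /=; case: eqP => // vy.
by subst; apply: leq_trans IH; apply: ltnW.
Qed.

Lemma steps_que b b' : steps E i b b' -> {subset que b <= que b'}.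
Proof.
by elim=> // c x y _ IH _ _ _ lt z /IH; rewrite /= mem_rcons inE orbC => ->.
Qed.

Lemma steps_trans b1 b2 b3 : steps E i b1 b2 -> steps E i b2 b3 -> steps E i b1 b3.
Proof. by move=> S; elim=> // c x y _ IH *; apply: StepsS. Qed.

Lemma steps_prefix b b' : steps E i b b' -> exists t, que b' = que b ++ t.
Proof.
elim=> [|c x y _ [t ht] _ _ _ _]; first by exists [::]; rewrite cats0.
by exists (rcons t y); rewrite /= ht rcons_cat.
Qed.

(** The fields of a node change only at the moment it enters the queue, and by [step_fresh] it
    enters at most once. *)
Lemma steps_same b b' v : steps E i b b' -> (v \in que b) || (v \notin que b') ->
  [/\ lev b' v = lev b v, par b' v = par b v, bst b' v = bst b v &
      bsc b' v = bsc b v].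
Proof.
elim=> // c x y S IH _ hz _ lt h /=.
have yc := step_fresh hz lt.
have nvy : (v == y) = false.
  apply/eqP => vy; subst; move: h; rewrite /= mem_rcons inE eqxx orbF => h.
  by move: (steps_que S h); rewrite (negbTE yc).
have [|h1 h2 h3 h4] := IH.
  by move: h; rewrite /= mem_rcons inE nvy.
by rewrite nvy; split => //; case: ifP => _ //=; rewrite nvy.
Qed.

Lemma steps_new b b' v : steps E i b b' -> v \in que b' -> v \notin que b ->
  [/\ lev b' v < lev b v,
      nb E (par b' v) v, par b' v \in que b',
      lev b' v = lev b' (par b' v) + 1 &
      bst b' v = minn (bst b v) (lev b' v) /\
      bsc b' v = if lev b' v < bst b v then i else bsc b v].
Proof.
elim=> [->|c x y S IH xc hz nxy lt] //= + h.
have yc := step_fresh hz lt.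
have nxy' : (x == y) = false by apply/eqP => xy; subst; rewrite xc in yc.
rewrite mem_rcons inE; case: eqP => [-> _|vy] /=.
  have hy : (y \in que b) || (y \notin que c) by rewrite yc orbT.
  have [_ _ e3 e4] := steps_same S hy.
  rewrite nxy'; split => //.
  - by apply: leq_trans lt (steps_mono _ S).
  - by rewrite mem_rcons inE xc orbT.
  - rewrite minnC /minn -e3 -e4; split; case: ifP => _ //=; by rewrite ?eqxx.
move=> vc; have [h1 h2 h3 h4 [h5 h6]] := IH vc h; split => //.
- by rewrite mem_rcons inE h3 orbT.
- have -> : (par c v == y) = false by apply/eqP => e; rewrite e (negbTE yc) in h3.
  by [].
- by move/eqP/negbTE: vy => vy; split; case: ifP => _ //=; rewrite vy.
Qed.

End Steps.

(** * Levels with pending edges *)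

Definition bounded (n : nat) (E : seq (nat * nat)) : Prop :=
  forall x y, nb E x y -> x < n /\ y < n.

Fixpoint walk_uses (x : nat) (p : seq nat) (e : nat * nat) : bool :=
  if p is y :: p' then
    (e == (x, y)) || (e == (y, x)) || walk_uses y p' e
  else false.

Lemma walk_uses_mem x p e : walk_uses x p e -> e.1 \in x :: p /\ e.2 \in x :: p.
Proof.
elim: p x => //= y p IH x /orP[/orP[/eqP->|/eqP->]|/IH[h1 h2]];
  by rewrite ?[_ \in x :: _]inE /= ?h1 ?h2 ?inE ?eqxx ?orbT.
Qed.

(** An inequality, because [e0] may occur in [F] several times and every occurrence is gained. *)
Lemma sum_cond_add (F : seq (nat * nat)) (P P' : pred (nat * nat)) w e0 :
  e0 \in F -> ~~ P e0 -> P' e0 -> subpred P P' ->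
  w e0 + \sum_(e <- F | P e) w e <= \sum_(e <- F | P' e) w e.
Proof.
move=> + nP P0 sub.
have le G : \sum_(e <- G | P e) w e <= \sum_(e <- G | P' e) w e.
  elim: G => [|e G IH]; first by rewrite !big_nil.
  by rewrite !big_cons; case: ifP => [/sub ->|_]; [rewrite leq_add2l | case: ifP => _; lia].
elim: F => // e F IH; rewrite inE => /orP[/eqP <-|/IH {}IH].
  by rewrite !big_cons (negbTE nP) P0 leq_add2l.
by rewrite !big_cons; case: ifP => [/sub ->|_]; [lia | case: ifP => _; lia].
Qed.

Lemma exc_ge l x y : l x <= l y + 1 + exc l (x, y) /\ l x <= l y + 1 + exc l (y, x).
Proof. by rewrite /exc /=; lia. Qed.

(* F lists the pending edges, which the levels lv, capped at L, do not take
   into account; G lists the other edges of E.  The debt D bounds by how much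
   the levels overestimate the distances to s. *)
Record scale (n s L : nat) (E : seq (nat * nat)) (lv pr : nat -> nat) (D : nat)
    (G F : seq (nat * nat)) : Prop := Scale {
  sc_mem : E =i G ++ F;
  sc_src : lv s = 0;
  sc_cap : forall v, v < n -> lv v <= L;
  sc_closed : forall x y, nb G x y -> lv y <= lv x + 1;
  sc_tree : forall v, v < n -> v != s -> lv v < L ->
    nb E v (pr v) /\ lv v = lv (pr v) + 1;
  sc_debt : D = \sum_(e <- F) exc lv e;
  sc_conn : forall e, e \in F -> conn G s e.1 /\ conn G s e.2 }.

Section Scale.
Variables (n s L : nat).

Section Fixed.
Variables (E : seq (nat * nat)) (lv pr : nat -> nat) (D : nat)
          (G F : seq (nat * nat)).
Hypotheses (Eb : bounded n E) (sc : scale n s L E lv pr D G F).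

(** Along the walk an edge of [G] accounts for a level difference of at most 1, and a pending edge
    for at most 1 plus its excess. *)
Lemma scale_walk x p : path (nb E) x p -> uniq (x :: p) ->
  lv x <= lv (last x p) + size p + \sum_(e <- F | walk_uses x p e) exc lv e.
Proof.
elim: p x => [|y p IH] x /=; first by move=> _ _; rewrite addn0 leq_addr.
move=> /andP[xy hp] /andP[xp u]; have {IH} := IH y hp u.
set A := lv (last y p) => IH.
have sub : subpred (walk_uses y p)
    (fun e => (e == (x, y)) || (e == (y, x)) || walk_uses y p e).
  by move=> e /= ->; rewrite orbT.
(* Distinctness of the nodes enters here: the rest of the walk avoids x, so this edge has not been
   charged yet in either orientation. *)
have n1 : ~~ walk_uses y p (x, y).
  by apply/negP => /walk_uses_mem[/= h _]; rewrite h in xp.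
have n2 : ~~ walk_uses y p (y, x).
  by apply/negP => /walk_uses_mem[/= _ h]; rewrite h in xp.
have [Gxy|nGxy] := boolP (nb G x y).
  have c : lv x <= lv y + 1 by apply: (sc_closed sc); rewrite nbC.
  have le : \sum_(e <- F | walk_uses y p e) exc lv e <=
    \sum_(e <- F | (e == (x, y)) || (e == (y, x)) || walk_uses y p e) exc lv e.
    rewrite big_mkcond [X in _ <= X]big_mkcond; apply: leq_sum => e _.
    by case: (walk_uses y p e); rewrite ?orbT.
  lia.
have [e0 eF [e0E ce]] : exists2 e, e \in F & ((e == (x, y)) || (e == (y, x))) /\ ~~ walk_uses y p e.
  move: xy nGxy; rewrite /nb !(sc_mem sc) !mem_cat negb_or.
  case: ((x, y) \in G) => //=; case: ((y, x) \in G); rewrite ?orbT ?andbF //=.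
  by move=> /orP[h|h] _; [exists (x, y) | exists (y, x)]; rewrite // eqxx ?orbT.
have P0 : (fun e => (e == (x, y)) || (e == (y, x)) || walk_uses y p e) e0 by rewrite e0E.
have := sum_cond_add (exc lv) eF ce P0 sub.
have : lv x <= lv y + 1 + exc lv e0.
  by case/orP: e0E => /eqP ->; have [] := exc_ge lv x y.
move: IH; clear; lia.
Qed.

Lemma scale_path x p : path (nb E) x p -> last x p = s -> lv x <= size p + D.
Proof.
move=> hp; have [p' hp' u sub] := shortenP hp => hl.
have := scale_walk hp' u; rewrite hl (sc_src sc).
have h1 : size p' <= size p by apply: uniq_leq_size => //; case/andP: u.
have h2 : \sum_(e <- F | walk_uses x p' e) exc lv e <= D.
  by rewrite (sc_debt sc) big_mkcond /=; apply: leq_sum => e _; case: ifP.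
by rewrite add0n => /leq_trans; apply; apply: leq_add.
Qed.

Lemma scale_par_lt v : v < n -> v != s -> lv v < L ->
  [/\ nb E v (pr v), pr v < n & lv v = lv (pr v) + 1].
Proof.
by move=> hv hs hL; have [h1 h2] := sc_tree sc hv hs hL; have [_ h3] := Eb h1.
Qed.

(** Each parent lies exactly one level lower, so after k of them level 0 is reached. There only s
    can be, since any other node would have a parent below level 0. Strictly decreasing levels make
    the path simple. *)
Lemma scale_traject k v : v < n -> lv v = k -> k < L ->
  let p := traject pr (pr v) k in
  [/\ path (nb E) v p, last v p = s, uniq (v :: p) &
      forall z, z \in p -> z < n /\ lv z < k].
Proof.
elim: k v => [|k IH] v hv hk hL.
  split => //=; apply/eqP/negPn/negP => vs.
  by have [|_ _] := scale_par_lt hv vs; lia.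
have vs : v != s by apply/eqP => e; rewrite e (sc_src sc) in hk.
have [|h1 h2 h3] := scale_par_lt hv vs; first by rewrite hk.
have [||I1 I2 I3 I4] := IH (pr v) h2; [lia | lia |].
have I5 z : z \in pr v :: traject pr (pr (pr v)) k -> z < n /\ lv z < k.+1.
  rewrite inE => /orP[/eqP ->|/I4[? ?]]; split => //; lia.
rewrite trajectS; split => //; first by rewrite /= h1.
by rewrite cons_uniq I3 andbT; apply/negP => /I5; lia.
Qed.

(** Both ends of a pending edge reach s within [G], so leaving out the pending edges does not shrink
    the component of s. *)
Lemma scale_conn_sub x : conn E s x -> conn G s x.
Proof.
move=> [p]; elim: p x => [|y p IH] x /=; first by move=> _ <-; exact: conn_refl.
move=> /andP[xy hp] hl; have c := IH y hp hl.
move: xy; rewrite /nb !(sc_mem sc) !mem_cat => /orP[/orP[h|h]|/orP[h|h]].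
- by apply: conn_step c; rewrite /nb h.
- by case: (sc_conn sc h).
- by apply: conn_step c; rewrite /nb h orbT.
- by case: (sc_conn sc h).
Qed.

Lemma scale_reached v : v < n -> lv v < L -> conn E s v.
Proof.
by move=> hv hL; have [h1 h2 _ _] := scale_traject hv erefl hL; exists (traject pr (pr v) (lv v)).
Qed.

End Fixed.

Section Local.
Variables (E E' : seq (nat * nat)) (lv pr bs bc : nat -> nat) (D : nat)
          (G F : seq (nat * nat)) (i a c : nat).
Hypotheses (Eb : bounded n E) (sc : scale n s L E lv pr D G F).
Hypotheses (an : a < n) (cn : c < n) (ac : a != c).
Let b0 := Bfs lv pr bs bc [::].
Variables (e : nat * nat).
Hypotheses (e_ac : (e == (a, c)) || (e == (c, a))).

Lemma nb_new x y : nb (rcons E e) x y =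
  [|| nb E x y, (x == a) && (y == c) | (x == c) && (y == a)].
Proof.
by case/orP: e_ac => /eqP ->; rewrite nb_rcons //; case: (nb E x y) => //=; rewrite orbC.
Qed.

Lemma nb_newG x y : nb (rcons G e) x y =
  [|| nb G x y, (x == a) && (y == c) | (x == c) && (y == a)].
Proof.
by case/orP: e_ac => /eqP ->; rewrite nb_rcons //; case: (nb G x y) => //=; rewrite orbC.
Qed.

Lemma sc_mem_rcons : rcons E e =i rcons G e ++ F.
Proof.
move=> z; rewrite mem_cat !mem_rcons !inE (sc_mem sc) mem_cat.
by rewrite orbA.
Qed.

Lemma rcons_sub (H : seq (nat * nat)) : {subset H <= rcons H e}.
Proof. by move=> z h; rewrite mem_rcons inE h orbT. Qed.

Lemma local_noop : lv c <= lv a + 1 -> lv a <= lv c + 1 ->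
  scale n s L (rcons E e) lv pr D (rcons G e) F.
Proof.
move=> h1 h2; case: (sc) => S1 S2 S3 S4 S5 S6 S7; split => //.
- exact: sc_mem_rcons.
- by move=> x y; rewrite nb_newG => /or3P[/S4|/andP[/eqP-> /eqP->]|/andP[/eqP-> /eqP->]].
- move=> v hv vs hL; have [t1 t2] := S5 v hv vs hL; split => //.
  by apply: nb_sub t1; exact: rcons_sub.
- by move=> f /S7[h3 h4]; split; [apply: conn_sub h3 | apply: conn_sub h4]; apply: rcons_sub.
Qed.

Lemma pending_edge : conn G s a -> conn G s c ->
  scale n s L (rcons E e) lv pr (D + exc lv e) G (rcons F e).
Proof.
move=> h1 h2; case: (sc) => S1 S2 S3 S4 S5 S6 S7; split => //.
- by move=> z; rewrite mem_cat !mem_rcons !inE S1 mem_cat orbCA.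
- move=> v hv vs hL; have [t1 t2] := S5 v hv vs hL; split => //.
  by apply: nb_sub t1; exact: rcons_sub.
- by rewrite S6 -cats1 big_cat big_seq1.
- move=> f; rewrite mem_rcons inE => /orP[/eqP ->|/S7 //].
  by case/orP: e_ac => /eqP ->.
Qed.

(* The second case is that of an edge joining the component of the source to
   another one. *)
Hypothesis quiet : F = [::] \/ ~ (conn G s a <-> conn G s c).
Hypothesis lt_ac : lv a + 1 < lv c.
Let b1 := push i a (lv a + 1) c b0.

(** The lower end [a] has a level below the cap, so its path of parents connects it to s; it is [c]
    that lies outside. *)
Lemma attach_sides : ~ (conn G s a <-> conn G s c) ->
  conn G s a /\ ~ conn G s c.
Proof.
move=> h; have [ca|nca] := EM (conn G s a).
  by split => // cc; apply: h.
exfalso; have la : lv a < L by have := sc_cap sc cn; lia.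
by apply: nca; apply: (scale_conn_sub sc); apply: (scale_reached Eb sc).
Qed.

(** The search starts at [c], outside the component of s, and could enter that component only
    through the new edge, at [a]. But every queued node has a level above that of [a], so [a] is
    never pushed. *)
Lemma attach_steps b' : steps (rcons E e) i b1 b' ->
  ~ (conn G s a <-> conn G s c) ->
  forall y, y \in que b' -> ~ conn G s y /\ lv a < lev b' y.
Proof.
move=> S /attach_sides[ca nc]; elim: S => {b'} [|b' x y S IH xb hz nxy lt] z.
  by rewrite /= inE => /eqP ->; rewrite eqxx; split => //; lia.
have [ncx lax] := IH x xb.
have aq : a \notin que b' by apply/negP => /IH[].
rewrite /= mem_rcons inE => /orP[/eqP ->|zb]; last first.
  case: eqP => [zy|_]; last exact: IH.
  by exfalso; rewrite zy in zb; rewrite (negbTE (step_fresh hz lt)) in zb.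
rewrite eqxx; split; last by lia.
move=> cy; move: nxy; rewrite nb_new => /or3P[nxy|/andP[/eqP ? _]|/andP[/eqP ? /eqP ?]].
- apply: ncx; apply: (scale_conn_sub sc); apply: (conn_step nxy).
  by apply: conn_sub cy => q h; rewrite (sc_mem sc) mem_cat h.
- by subst x.
- subst x y.
  have hh : (a \in que b1) || (a \notin que b') by rewrite aq orbT.
  have [ea _ _ _] := steps_same S hh.
  by move: lt; rewrite ea /= (negbTE ac); lia.
Qed.

Variable b' : bfs.
Hypotheses (S : steps (rcons E e) i b1 b')
  (done : forall x y, x \in que b' -> nb (rcons E e) x y -> lev b' y <= lev b' x + 1).

Lemma local_drop x : x \in que b' -> lev b' x < lv x.
Proof.
have [->|xc] := eqVneq x c; move=> xq.
  by apply: leq_ltn_trans (steps_mono _ S) _; rewrite /= eqxx.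
have [|h _ _ _ _] := steps_new S xq; first by rewrite /= inE.
by move: h; rewrite /= (negbTE xc).
Qed.

Lemma local_same x : x \notin que b' -> lev b' x = lv x /\ par b' x = pr x.
Proof.
move=> xq; have hh : (x \in que b1) || (x \notin que b') by rewrite xq orbT.
have [h1 h2 _ _] := steps_same S hh.
have xc : (x == c) = false.
  by apply/eqP => xc; subst; move: xq; rewrite (steps_que S) //= inE.
by move: h1 h2; rewrite /= xc.
Qed.

Lemma local_le x : lev b' x <= lv x.
Proof.
have [/local_drop/ltnW //|/local_same[-> _] //] := boolP (x \in que b').
Qed.

Lemma local_pushed : [/\ c \in que b', lev b' c = lv a + 1 & par b' c = a].
Proof.
have c1 : c \in que b1 by rewrite /= inE.
have hh : (c \in que b1) || (c \notin que b') by rewrite c1.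
have [h1 h2 _ _] := steps_same S hh; split; first exact: (steps_que S).
  by rewrite h1 /= eqxx.
by rewrite h2 /= eqxx.
Qed.

(** Closedness holds at queued nodes because the search has finished with them, and at the others
    because their level stays while those of their neighbours can only fall. *)
Lemma local_scale : scale n s L (rcons E e) (lev b') (par b') D (rcons G e) F.
Proof.
case: (sc) => S1 S2 S3 S4 S5 S6 S7.
have [cq lc pc] := local_pushed.
have nbca : nb (rcons E e) c a by rewrite nb_new !eqxx !orbT.
(* Were [a] lowered, closedness along the new edge would force [c] below [lv a + 1], the level at
   which it was queued. *)
have aq : a \notin que b'.
  apply/negP => aq; have := local_drop aq; have := done aq (y := c).
  by rewrite nbC nbca lc => /(_ isT); lia.
split.
- exact: sc_mem_rcons.
- by have := local_le s; rewrite S2; lia.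
- by move=> v /S3; apply: leq_trans (local_le v).
- move=> x y nxy; have [xq|xq] := boolP (x \in que b').
    apply: done => //; move: nxy; rewrite nb_newG nb_new => /orP[h|->]; last by rewrite orbT.
    by rewrite (nb_sub _ h) // => z hz; rewrite S1 mem_cat hz.
  have [-> _] := local_same xq; move: nxy; rewrite nb_newG => /or3P[/S4 h|/andP[/eqP-> /eqP->]|/andP[/eqP ? /eqP ?]].
  + exact: leq_trans (local_le y) h.
  + by rewrite lc.
  + by subst x; rewrite cq in xq.
- move=> v hv vs hL; have [vq|vq] := boolP (v \in que b').
    have [->|vc] := eqVneq v c.
      by rewrite pc lc; have [-> _] := local_same aq.
    have [|_ h2 h3 h4 _] := steps_new S vq; first by rewrite /= inE.
    by rewrite nbC.
  have [l1 p1] := local_same vq.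
  rewrite l1 in hL *; rewrite p1; have [t1 t2] := S5 v hv vs hL; split.
    by apply: nb_sub t1; exact: rcons_sub.
  (* A parent that drops takes its child along: closedness at the lowered parent would put the child
     below its unchanged level. *)
  have [pq|pq] := boolP (pr v \in que b'); last by have [-> _] := local_same pq.
  have := local_drop pq; have := done pq (y := v).
  rewrite l1 => /(_ _); have -> : nb (rcons E e) (pr v) v.
    by rewrite nbC; apply: nb_sub t1; exact: rcons_sub.
  by move=> /(_ isT); lia.
(* Either there are no pending edges, or both ends of each lie in the component of s, which the
   search does not enter; the excesses stay the same. *)
- rewrite S6; case: quiet => [-> |att]; first by rewrite !big_nil.
  apply: eq_big_seq => f /S7[c1 c2]; rewrite /exc.
  have h1 : f.1 \notin que b' by apply/negP => /(attach_steps S att)[].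
  have h2 : f.2 \notin que b' by apply/negP => /(attach_steps S att)[].
  by have [-> _] := local_same h1; have [-> _] := local_same h2.
- by move=> f /S7[h3 h4]; split; [apply: conn_sub h3 | apply: conn_sub h4]; apply: rcons_sub.
Qed.

(** A node outside the component of s sits at the cap, and a push takes it below. As levels never
    rise again, each node pays for at most one such search per scale. *)
Lemma attach_fresh : ~ (conn G s a <-> conn G s c) ->
  (forall x, x \in que b' -> x < n) -> forall x, x \in que b' -> lv x = L.
Proof.
move=> att hn x xq; have [nx _] := attach_steps S att xq.
apply/eqP; rewrite eqn_leq (sc_cap sc (hn _ xq)) leqNgt.
apply/negP => /(scale_reached Eb sc (hn _ xq)) h.
exact: nx (scale_conn_sub sc h).
Qed.

End Local.
End Scale.

(** * Rebuilding a scale and the fall of the level sum *)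

Section Rebuild.
Variables (n s L : nat).

(** Apart from s all levels start at the cap, so a level below it comes from a push, which also set
    a valid parent. *)
Lemma rebuild_scale E i pr bs bc b' : bounded n E ->
  steps E i (Bfs (fun v => if v == s then 0 else L) pr bs bc [:: s]) b' ->
  (forall x y, x \in que b' -> nb E x y -> lev b' y <= lev b' x + 1) ->
  scale n s L E (lev b') (par b') 0 E [::].
Proof.
set b0 := Bfs _ _ _ _ _ => Eb S done.
have sq : s \in que b0 by rewrite inE.
have le v : lev b' v <= L.
  by apply: leq_trans (steps_mono v S) _; rewrite /=; case: ifP.
split => //.
- by move=> e; rewrite cats0.
- by have := steps_mono s S; rewrite /= eqxx; lia.
- move=> x y nxy; have [xq|xq] := boolP (x \in que b'); first exact: done.
  have hh : (x \in que b0) || (x \notin que b') by rewrite xq orbT.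
  have [-> _ _ _] := steps_same S hh; rewrite /=; case: eqP => [xs|_].
    by subst x; rewrite (steps_que S) in xq.
  by apply: leq_trans (le y) _; lia.
- move=> v hv vs hL; have [vq|vq] := boolP (v \in que b').
    have [|_ h2 _ h4 _] := steps_new S vq; first by rewrite /= inE.
    by rewrite nbC.
  have hh : (v \in que b0) || (v \notin que b') by rewrite vq orbT.
  have [h _ _ _] := steps_same S hh.
  by move: hL; rewrite h /= (negbTE vs) ltnn.
- by rewrite big_nil.
Qed.

(** The old path of parents is still a path of the larger graph, and without debt a level is at most
    the length of any path to s. *)
Lemma rebuilt_le E E' lv pr D G F lv' pr' : bounded n E -> bounded n E' ->
  {subset E <= E'} -> scale n s L E lv pr D G F ->
  scale n s L E' lv' pr' 0 E' [::] -> forall v, v < n -> lv' v <= lv v.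
Proof.
move=> Eb Eb' sub sc sc' v hv; have [hL|hL] := ltnP (lv v) L; last first.
  exact: leq_trans (sc_cap sc' hv) hL.
have [h1 h2 h3 h4] := scale_traject Eb sc hv erefl hL.
have := scale_path sc' (sub_path (nb_sub sub) h1) h2.
by rewrite size_traject addn0.
Qed.

(* The i-th node of the walk loses at least x - 2 i levels. *)
Lemma drop_along lv lv' G p v x : (forall x y, nb G x y -> lv y <= lv x + 1) ->
  (forall x y, nb G x y -> lv' y <= lv' x + 1) -> lv s = 0 ->
  path (nb G) v p -> last v p = s -> lv' v + x <= lv v ->
  x * x <= 4 * \sum_(w <- v :: p) (lv w - lv' w).
Proof.
move=> c c' ls; elim: p v x => [|w p IH] v x /=.
  by move=> _ -> ; rewrite ls big_seq1; nia.
move=> /andP[vw hp] hl hx; rewrite big_cons.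
have c1 := c w v; rewrite nbC in c1; have {}c1 := c1 vw; have c2 := c' _ _ vw.
(* The factor 4 stems from x^2 - (x - 2)^2 = 4 (x - 1), which four times the drop x at [v] covers;
   for x < 2 the term of [v] alone suffices. *)
have [x2|x2] := leqP 2 x.
  have h : lv' w + (x - 2) <= lv w by lia.
  have := IH w (x - 2) hp hl h.
  set T := \sum_(_ <- _) _; nia.
set T := \sum_(_ <- _) _; nia.
Qed.

(** After the rebuild the higher end of the pending edge is at most one level above the lower end,
    so it falls by at least the excess. It also reaches s by a simple path within [G], where old and
    new levels are both closed, and [drop_along] spreads the fall over the distinct nodes of that
    path. *)
Lemma rebuild_drop E lv pr D G F lv' pr' e : bounded n E ->
  scale n s L E lv pr D G F -> scale n s L E lv' pr' 0 E [::] -> e \in F ->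
  exc lv e * exc lv e + 4 * (\sum_(v < n) lv' v) <= 4 * (\sum_(v < n) lv v).
Proof.
move=> Eb sc sc' eF.
have GE : {subset G <= E} by move=> z h; rewrite (sc_mem sc) mem_cat h.
have le := rebuilt_le Eb Eb (fun z h => h) sc sc'.
have c' x y : nb E x y -> lv' y <= lv' x + 1 := @sc_closed _ _ _ _ _ _ _ _ _ sc' x y.
have key u v x : conn G s v -> nb E u v -> u < n -> lv u + 1 + x <= lv v ->
    x * x + 4 * (\sum_(v < n) lv' v) <= 4 * (\sum_(v < n) lv v).
  move=> [p hp hl] uv un hx; move: hl; have [p' hp' up sub] := shortenP hp => hl.
  have hx' : lv' v + x <= lv v.
    by have := c' _ _ uv; have := le u un; lia.
  have [x0|x0] := posnP x.
    rewrite x0 leq_mul2l /=; apply: leq_sum => w _; exact: le.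
  have := drop_along (sc_closed sc) _ (sc_src sc) hp' hl hx'.
  move=> /(_ (fun x y h => c' _ _ (nb_sub GE h))) h.
  have inn w : w \in v :: p' -> w < n.
    have vn : v < n by case: (Eb _ _ uv).
    rewrite inE => /orP[/eqP -> //|].
    elim: (p') (v) hp' => //= y q IHq z /andP[zy hq]; rewrite inE => /orP[/eqP ->|].
      by case: (Eb _ _ (nb_sub GE zy)).
    exact: IHq hq.
  have T1 : \sum_(w <- v :: p') (lv w - lv' w) <= \sum_(w < n) (lv w - lv' w).
    rewrite -(big_mkord xpredT (fun w => lv w - lv' w)) /index_iota subn0.
    apply: uniq_sub_le_big => //; first by move=> ? ?; rewrite leq_addr.
      exact: iota_uniq.
    by move=> w /inn; rewrite mem_iota.
  have T2 : \sum_(w < n) (lv w - lv' w) + \sum_(w < n) lv' w = \sum_(w < n) lv w.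
    by rewrite -big_split /=; apply: eq_bigr => w _; rewrite subnK // le.
  lia.
case: e eF => u v eF; have [c1 c2] := sc_conn sc eF.
have uv : nb E u v by rewrite /nb (sc_mem sc) mem_cat eF orbT.
have [un vn] := Eb _ _ uv; rewrite /exc /=.
have [h|h] := leqP (lv u) (lv v).
  have [h0|h0] := posnP (lv v - lv u - 1).
    have -> : lv u - lv v - 1 + (lv v - lv u - 1) = 0 by lia.
    rewrite leq_mul2l /=; apply: leq_sum => w _; exact: le.
  have -> : lv u - lv v - 1 + (lv v - lv u - 1) = lv v - lv u - 1 by lia.
  apply: (key u v) => //; lia.
have [h0|h0] := posnP (lv u - lv v - 1).
  have -> : lv u - lv v - 1 + (lv v - lv u - 1) = 0 by lia.
  rewrite leq_mul2l /=; apply: leq_sum => w _; exact: le.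
have -> : lv u - lv v - 1 + (lv v - lv u - 1) = lv u - lv v - 1 by lia.
apply: (key v u) => //; first by rewrite nbC.
lia.
Qed.

Lemma max_exc (F : seq (nat * nat)) w :
  0 < \sum_(e <- F) w e -> exists2 e, e \in F & \sum_(e <- F) w e <= w e * size F.
Proof.
move=> h; have [e eF he] : exists2 e, e \in F & forall f, f \in F -> w f <= w e.
  have : F != [::] by apply: contraTneq h => ->; rewrite big_nil.
  elim: F {h} => // e [|f F] IH _.
    by exists e; rewrite ?inE // => g; rewrite inE => /eqP ->.
  have [g gF hg] := IH isT; have [le|lt] := leqP (w e) (w g).
    exists g; first by rewrite inE gF orbT.
    by move=> h; rewrite inE => /orP[/eqP ->|/hg].
  exists e; first by rewrite inE eqxx.
  by move=> h; rewrite inE => /orP[/eqP -> //|/hg]; lia.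
exists e => //; rewrite mulnC -sum1_size big_distrl /= big_seq [X in _ <= X]big_seq.
by apply: leq_sum => f /he; rewrite mul1n.
Qed.

(* Either k is at least q / (8 X0), or some excess x is so large that the level
   sum drops by at least n X / (8 X0). *)
Lemma rebuild_amortized q a b X0 X k D x Phi Phi' :
  0 < X0 -> X0 <= X -> q * q * n * (b * b) <= X0 * X0 * X0 * X0 * (a * a) ->
  0 < b -> a * X < 2 * b * D -> D <= x * k -> x * x + 4 * Phi' <= 4 * Phi ->
  q * n * X + 8 * X0 * (q * Phi') <= 8 * X0 * (n * X * k + q * Phi).
Proof.
move=> X0p XX hX bp hD hk hPhi.
have h2 : 8 * X0 * (q * Phi') <= 8 * X0 * (q * Phi).
  by rewrite !leq_mul2l; apply/orP; right; apply/orP; right; nia.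
have [h|h] := leqP q (8 * X0 * k).
  have h1 : q * n * X <= 8 * X0 * k * (n * X) by rewrite -mulnA leq_mul2r h orbT.
  by clear -h1 h2; nia.
have [z|np] := posnP (n * X); first by rewrite -mulnA z; clear -h2; lia.
have [q0|qp] := posnP q; first by rewrite q0 !mul0n muln0.
have s1 : a * X < 2 * b * x * k.
  by apply: leq_trans hD _; rewrite -(mulnA _ x) leq_mul2l hk orbT.
have s3 : 16 * (X0 * X0) * (a * a * (X * X)) <= b * b * (x * x) * (q * q).
  have t1 : 8 * X0 * (a * X) <= 2 * b * x * q by nia.
  have t2 : (8 * X0 * (a * X)) * (8 * X0 * (a * X)) <= (2 * b * x * q) * (2 * b * x * q) by apply: leq_mul.
  by clear -t2; nia.
(* Multiplying by X0^2 produces X0^4 a^2, which by the choice of X0 is at least q^2 n b^2; then q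
   and b cancel. *)
have s4 : 16 * (X0 * X0 * X0 * X0 * (a * a)) * (X * X) <= b * b * (x * x) * (q * q) * (X0 * X0).
  by rewrite -(leq_pmul2r (_ : 0 < X0 * X0)) ?muln_gt0 ?X0p // in s3; clear -s3; nia.
have s5 : 16 * (q * q * n * (b * b)) * (X * X) <= b * b * (x * x) * (q * q) * (X0 * X0).
  by apply: leq_trans s4; rewrite leq_mul2r leq_mul2l hX /= orbT.
have s6 : 16 * n * (X * X) <= x * x * (X0 * X0).
  rewrite -(leq_pmul2r (_ : 0 < q * q * (b * b))); last by rewrite !muln_gt0 qp bp.
  by clear -s5; nia.
(* One factor X0 on the right is enlarged to X and cancelled. This is the only use of the scale
   being at least the smallest one. *)
have s7 : 16 * n * X <= x * x * X0.
  have Xp : 0 < X by lia.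
  rewrite -(leq_pmul2r Xp); apply: leq_trans (_ : x * x * (X0 * X0) <= _); last by nia.
  by clear -s6; nia.
have s8 : n * X + 8 * X0 * Phi' <= 8 * X0 * Phi by clear -s7 hPhi; nia.
have s9 : q * (n * X + 8 * X0 * Phi') <= q * (8 * X0 * Phi) by rewrite leq_mul2l s8 orbT.
clear -s9; nia.
Qed.

End Rebuild.

(** * The data structure in memory *)

Local Notation "a '$+' b" := (EBin OAdd a b) (at level 50, left associativity).
Local Notation "a '$-' b" := (EBin OSub a b) (at level 50, left associativity).
Local Notation "a '$*' b" := (EBin OMul a b) (at level 40, left associativity).
Local Notation "a '$<' b" := (EBin OLt a b) (at level 70).
Local Notation "c1 ;; c2" := (PSeq c1 c2) (at level 90, right associativity).

(* Arrays: 0 = n, s, q, a, b, number of edges, endpoints of the edges;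
   1 = number of scales, X0, estimate of the nodes not connected to s;
   2 = head and 3 = successor of the adjacency lists, whose cells are the
   indices of array 0 holding the neighbours; 4 = level and 5 = parent of node
   v at scale i, at index i * n + v; 6 = estimate and 7 = its scale; 8 = debt
   of a scale; 9 = queue. *)
Definition vu := 0.
Definition vv := 1.
Definition vn := 2.
Definition vi := 3.
Definition vo := 4.
Definition vqh := 5.
Definition vqt := 6.
Definition vx := 7.
Definition vl := 8.
Definition ve := 9.
Definition vy := 10.
Definition vX := 11.
Definition vsame := 12.
Definition vm := 13.
Definition vd := 14.

(** * Search from a queue in memory *)

Definition relax_c : prog :=
  PIf (EVar vl $< EArr 4 (EVar vo $+ EVar vy))
    (PStore 4 (EVar vo $+ EVar vy) (EVar vl) ;;
     PStore 5 (EVar vo $+ EVar vy) (EVar vx) ;;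
     PStore 9 (EVar vqt) (EVar vy) ;;
     PAsgn vqt (EVar vqt $+ EConst 1) ;;
     PIf (EVar vl $< EArr 6 (EVar vy))
       (PStore 6 (EVar vy) (EVar vl) ;; PStore 7 (EVar vy) (EVar vi))
       PSkip)
    PSkip.

Definition scan_c : prog :=
  PWhile (EVar ve)
    (PAsgn vy (EArr 0 (EVar ve)) ;; relax_c ;; PAsgn ve (EArr 3 (EVar ve))).

Definition propagate_c : prog :=
  PWhile (EVar vqh $< EVar vqt)
    (PAsgn vx (EArr 9 (EVar vqh)) ;;
     PAsgn vqh (EVar vqh $+ EConst 1) ;;
     PAsgn vl (EArr 4 (EVar vo $+ EVar vx) $+ EConst 1) ;;
     PAsgn ve (EArr 2 (EVar vx)) ;;
     scan_c).

(** The cell index 0 can serve as the end of a list, since endpoints are stored from index 6 on. *)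
Fixpoint chain (f : nat -> nat) (h : nat) (ls : seq nat) : Prop :=
  if ls is e :: ls' then [/\ h = e, e != 0 & chain f (f e) ls'] else h = 0.

Definition adj_ok (n : nat) (M : nat -> nat) (E : seq (nat * nat)) : Prop :=
  forall x, x < n -> exists ls, [/\ chain (aget M 3) (aget M 2 x) ls,
    size ls = dg E x,
    forall e, e \in ls -> 6 <= e < 6 + 2 * size E /\ nb E x (aget M 0 e) &
    forall y, nb E x y -> exists2 e, e \in ls & aget M 0 e = y].

Definition rep (n o : nat) (M : nat -> nat) (b : bfs) : Prop :=
  (forall v, v < n -> [/\ aget M 4 (o + v) = lev b v, aget M 5 (o + v) = par b v,
                         aget M 6 v = bst b v & aget M 7 v = bsc b v]) /\
  forall j, j < size (que b) -> aget M 9 j = nth 0 (que b) j.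

(** Arrays 6, 7 and 9 are exempt: the estimates are shared by all scales, and the queue is scratch
    space. *)
Definition same_but (n o : nat) (M M' : nat -> nat) : Prop :=
  (forall a, a \in [:: 0; 1; 2; 3; 8] -> aget M' a = aget M a) /\
  (forall a j, a \in [:: 4; 5] -> ~~ (o <= j < o + n) -> aget M' a j = aget M a j).

Lemma same_but_trans n o M1 M2 M3 :
  same_but n o M1 M2 -> same_but n o M2 M3 -> same_but n o M1 M3.
Proof.
move=> [h1 h2] [h3 h4]; split => [a ha|a j ha hj].
  by rewrite h3 ?h1.
by rewrite h4 ?h2.
Qed.

Lemma adj_ok_same n o M M' E : same_but n o M M' -> adj_ok n M E -> adj_ok n M' E.
Proof.
move=> [h _] ad x hx; have [ls] := ad x hx.
by exists ls; rewrite !h.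
Qed.

(** Levels are nondecreasing along the queue. Together with the bound by the level of the scanned
    node plus 1, this is the FIFO invariant from which the side condition of [StepsS] is
    maintained. *)
Definition good (n : nat) (b : bfs) : Prop :=
  [/\ uniq (que b), forall z, z \in que b -> z < n &
      forall j1 j2, j1 <= j2 -> j2 < size (que b) ->
        lev b (nth 0 (que b) j1) <= lev b (nth 0 (que b) j2)].

Lemma good_push n i x y b : good n b -> x \in que b -> y < n ->
  (forall z, z \in que b -> lev b z <= lev b x + 1) -> lev b x + 1 < lev b y ->
  let b' := push i x (lev b x + 1) y b in
  good n b' /\ forall z, z \in que b' -> lev b' z <= lev b' x + 1.
Proof.
move=> [g1 g2 g3] xq yn hz lt; have yq := step_fresh hz lt.
have xy : (x == y) = false by apply/eqP => e; rewrite -e xq in yq.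
split; last first.
  move=> z /=; rewrite xy; case: eqP => [_|zy]; first by rewrite leqnn.
  by rewrite mem_rcons inE => /orP[/eqP // | /hz].
split => /=; first by rewrite rcons_uniq yq g1.
  by move=> z; rewrite mem_rcons inE => /orP[/eqP -> | /g2].
move=> j1 j2 le; rewrite size_rcons ltnS => hj2; rewrite !nth_rcons.
have inq j : j < size (que b) -> (nth 0 (que b) j == y) = false.
  by move=> hj; apply/eqP => e; rewrite -e mem_nth in yq.
have [lt2|] := ltnP j2 (size (que b)).
  by have lt1 := leq_ltn_trans le lt2; rewrite lt1 !inq // g3.
move=> ge; have -> : j2 = size (que b) by lia.
rewrite eqxx eqxx; have [lt1|ge1] := ltnP j1 (size (que b)).
  by rewrite inq // hz // mem_nth.
have -> : j1 = size (que b) by lia.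
by rewrite eqxx eqxx.
Qed.

Lemma good_size n b : good n b -> size (que b) <= n.
Proof.
move=> [g1 g2 _]; rewrite -(size_iota 0 n); apply: uniq_leq_size => // z /g2.
by rewrite mem_iota.
Qed.

Ltac wseq := apply: wp_seq.
Ltac wasgn := apply: wp_asgn => /=.
Ltac wstore := apply: wp_store => /=.

Section Propagate.
Variables (V n o i : nat).
Hypotheses (nV : n < V) (iV : i <= V).

(** Like the later specifications, it is stated for an arbitrary postcondition that follows from the
    listed facts, so that it chains under [wp_seq]. *)
Lemma relax_wp b x k y s (Q : hst -> Prop) :
  var s vl = k -> var s vx = x -> var s vy = y -> var s vo = o -> var s vi = i ->
  var s vqt = size (que b) -> rep n o (mem s) b ->
  k <= V -> x <= V -> y < n -> size (que b) < V ->
  (forall s', (forall z, z != vqt -> var s' z = var s z) -> out s' = out s ->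
     clk s' <= clk s + 100 -> var s' vqt = size (que (try_push i x k y b)) ->
     rep n o (mem s') (try_push i x k y b) -> same_but n o (mem s) (mem s') ->
     Q s') ->
  wp V relax_c Q s.
Proof.
case: s => w M ou ck /= hl hx hy ho hi hq hr kV xV yn qV H.
have [r4 r5 r6 r7] := hr.1 _ yn.
apply: wp_if => /=; rewrite hl ho hy r4 => hlt; last first.
  apply: wp_skip; have nlt : (k < lev b y) = false by apply/negbTE; rewrite -leqNgt; move: hlt; case: ltnP.
  by apply: H; rewrite /try_push ?nlt //=; lia.
have lt : k < lev b y by move: hlt; case: ltnP.
move: H; rewrite /try_push lt => H.
wseq; wstore; first by rewrite hl.
wseq; wstore; first by rewrite hx.
wseq; wstore; first by rewrite hy; lia.
wseq; wasgn; first by rewrite hq; lia.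
rewrite hl ho hy hx hq.
set M1 := aset _ 9 _ _.
have M1E : [/\ forall a, a \in [:: 0; 1; 2; 3; 6; 7; 8] -> aget M1 a = aget M a,
   aget M1 4 = upd (aget M 4) (o + y) k, aget M1 5 = upd (aget M 5) (o + y) x
   & aget M1 9 = upd (aget M 9) (size (que b)) y].
  split.
  - move=> a ha; rewrite /M1 !aget_set_other //; move: ha; rewrite !inE;
      by do ?[case/orP]; move=> /eqP ->.
  - by rewrite /M1 2?aget_set_other // aget_set_same.
  - by rewrite /M1 aget_set_other // aget_set_same // aget_set_other.
  - by rewrite /M1 aget_set_same // !aget_set_other.
case: M1E; move: M1 => M1 e0 e4 e5 e9.
apply: wp_if => /=; rewrite hl hy e0 ?inE // r6 => hlt2.
- have lt2 : k < bst b y by move: hlt2; case: ltnP.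
  wseq; wstore; first by rewrite hl.
  wstore; first by rewrite hi.
  rewrite hl hy hi; apply: H => //=.
  + by move=> z /negbTE ->.
  + lia.
  + by rewrite size_rcons; lia.
  + split => /= [v hv|j]; last first.
      rewrite !aget_set_other // e9 size_rcons nth_rcons /= => hj.
      case: eqP => [->|ne]; first by rewrite ltnn.
      have hj' : j < size (que b) by lia.
      by rewrite hj' (hr.2 _ hj').
    have [q4 q5 q6 q7] := hr.1 _ hv.
    rewrite !aget_set //= e4 e5 !e0 ?inE //= lt2 /=.
    by rewrite eqn_add2l; case: eqP.
  + split => [a ha|a j ha hj].
      have [na6 na7] : a != 6 /\ a != 7 by move: ha; rewrite !inE; do ?[case/orP]; move=> /eqP ->.
      have a10 : a < 10 by move: ha; rewrite !inE; do ?[case/orP]; move=> /eqP ->.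
      rewrite !aget_set_other // e0 //; move: ha; rewrite !inE; by do ?[case/orP]; move=> /eqP ->.
    move: ha; rewrite !inE => /orP[/eqP ->|/eqP ->]; rewrite !aget_set_other // ?e4 ?e5 /=;
      case: eqP => // jj; by move: hj; rewrite jj; lia.
- have lt2 : (k < bst b y) = false by move: hlt2; case: ltnP.
  apply: wp_skip; apply: H => //=.
  + by move=> z /negbTE ->.
  + lia.
  + by rewrite size_rcons; lia.
  + split => /= [v hv|j]; last first.
      rewrite e9 size_rcons nth_rcons /= => hj.
      case: eqP => [->|ne]; first by rewrite ltnn.
      have hj' : j < size (que b) by lia.
      by rewrite hj' (hr.2 _ hj').
    have [q4 q5 q6 q7] := hr.1 _ hv.
    rewrite e4 e5 !e0 ?inE //= lt2 /=.
    by rewrite eqn_add2l; case: eqP.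
  + split => [a ha|a j ha hj].
      rewrite e0 //; move: ha; rewrite !inE; by do ?[case/orP]; move=> /eqP ->.
    move: ha; rewrite !inE => /orP[/eqP ->|/eqP ->]; rewrite ?e4 ?e5 /=;
      case: eqP => // jj; by move: hj; rewrite jj; lia.
Qed.


Section Scan.
Variable E : seq (nat * nat).
Hypotheses (Eb : bounded n E) (slotV : 6 + 2 * size E <= V).

Lemma scan_wp b x ls s (Q : hst -> Prop) :
  var s vx = x -> var s vl = lev b x + 1 -> var s vo = o -> var s vi = i ->
  var s vqt = size (que b) -> rep n o (mem s) b ->
  lev b x < V -> x \in que b -> good n b ->
  (forall z, z \in que b -> lev b z <= lev b x + 1) ->
  chain (aget (mem s) 3) (var s ve) ls ->
  (forall e, e \in ls -> 6 <= e < 6 + 2 * size E /\ nb E x (aget (mem s) 0 e)) ->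
  (forall s' b', (forall z, z \notin [:: vqt; ve; vy] -> var s' z = var s z) ->
     out s' = out s -> clk s' <= clk s + 200 * size ls + 4 ->
     var s' vqt = size (que b') -> rep n o (mem s') b' ->
     same_but n o (mem s) (mem s') -> good n b' -> steps E i b b' ->
     (forall z, z \in que b' -> lev b' z <= lev b' x + 1) ->
     (forall e, e \in ls -> lev b' (aget (mem s) 0 e) <= lev b' x + 1) ->
     Q s') ->
  wp V scan_c Q s.
Proof.
elim: ls b s Q => [|e ls IH] b s Q hx hl ho hi hq hr lV xq gd hz hch hls H;
  apply: wp_while => //=.
- move=> _; apply: (H _ b) => //=; [lia | exact: Steps0].
- by move=> h; move: hch h => /= ->.
- by move: hch => [-> /negbTE h _] /eqP; rewrite h.
move=> _; move: hch => [he0 he hch].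
have [hbe hnb] := hls e (mem_head _ _).
have [xn yn] := Eb hnb.
case: s hx hl ho hi hq hr he0 hch hls hnb yn H => w M ou ck /= hx hl ho hi hq hr he0 hch hls hnb yn H.
wseq; wasgn; first by rewrite he0; lia.
rewrite he0; set y := aget M 0 e in hnb yn *.
wseq; apply: (@relax_wp b x (lev b x + 1) y) => //=; try lia.
  by have := good_size gd; lia.
move=> s1 fr1 o1 c1 q1 r1 sb1.
have [gd1 hz1 st1 ly1] : [/\ good n (try_push i x (lev b x + 1) y b),
    forall z, z \in que (try_push i x (lev b x + 1) y b) ->
      lev (try_push i x (lev b x + 1) y b) z <= lev (try_push i x (lev b x + 1) y b) x + 1,
    steps E i b (try_push i x (lev b x + 1) y b) &
    lev (try_push i x (lev b x + 1) y b) y <= lev (try_push i x (lev b x + 1) y b) x + 1].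
  rewrite /try_push; case: ltnP => lt; last by split => //; exact: Steps0.
  have [? h] := good_push i gd xq yn hz lt.
  split => //; first by apply: StepsS => //; exact: Steps0.
  by apply: h; rewrite /= mem_rcons inE eqxx.
move: (try_push _ _ _ _ _) q1 r1 gd1 hz1 st1 ly1 => b1 q1 r1 gd1 hz1 st1 ly1.
have xq1 := steps_que st1 xq.
have lx1 : lev b1 x = lev b x.
  by have [|-> _ _ _] := steps_same (v := x) st1; rewrite ?xq.
have v1 z : z \notin [:: vqt; vy] -> var s1 z = w z.
  by rewrite !inE negb_or => /andP[h1 h2]; rewrite fr1 // /= (negbTE h2).
case: s1 fr1 o1 c1 q1 r1 sb1 v1 => w1 M1 ou1 ck1 /= fr1 o1 c1 q1 r1 sb1 v1.
have [sb10 sb11] := sb1.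
apply: wp_asgn => /=.
  rewrite v1 // he0 sb10 //.
  case: (ls) hch hls => [|e' ls'] /=; first by move=> ->.
  by move=> [-> _ _] /(_ e'); rewrite !inE eqxx orbT => /(_ isT) [? _]; lia.
apply: (IH b1) => //=; rewrite ?v1 //; try lia.
- by rewrite he0 sb10.
- by move=> e' e'l; rewrite sb10 //; apply: hls; rewrite inE e'l orbT.
move=> s2 b2 fr2 o2 c2 q2 r2 sb2 gd2 st2 hz2 dn2.
apply: (H s2 b2) => //.
- move=> z; rewrite !inE !negb_or => /and3P[h1 h2 h3].
  by rewrite fr2 ?inE ?negb_or ?h1 ?h2 //= (negbTE h2) v1 ?inE ?negb_or ?h1 ?h3.
- by rewrite o2 o1.
- lia.
- exact: same_but_trans sb1 sb2.
- exact: steps_trans st1 st2.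
- move=> e'; rewrite inE => /orP[/eqP ->|h]; last first.
    by have := dn2 e' h; rewrite sb10.
  have xq1' : (x \in que b1) || (x \notin que b2) by rewrite xq1.
  have [ex _ _ _] := steps_same st2 xq1'.
  rewrite ex; apply: leq_trans ly1; exact: steps_mono st2.
Qed.

(** Queued nodes are distinct, so at most n are ever scanned and k bounds the scans that are left.
    The cost ranges over the final queue from position h on, because nodes queued later are scanned
    as well. *)
Lemma propagate_from k b h s (Q : hst -> Prop) : n <= h + k ->
  var s vo = o -> var s vi = i -> var s vqh = h -> var s vqt = size (que b) ->
  rep n o (mem s) b -> adj_ok n (mem s) E -> (forall v, v < n -> lev b v < V) ->
  good n b -> h <= size (que b) ->
  (h < size (que b) ->
     forall z, z \in que b -> lev b z <= lev b (nth 0 (que b) h) + 1) ->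
  (forall s' b', (forall z, z \notin [:: vqh; vqt; vx; vl; ve; vy] -> var s' z = var s z) ->
     out s' = out s ->
     clk s' <= clk s + 300 * (\sum_(x <- drop h (que b')) (dg E x + 1)) + 10 ->
     rep n o (mem s') b' -> same_but n o (mem s) (mem s') -> good n b' ->
     steps E i b b' ->
     (forall x y, x \in drop h (que b') -> nb E x y -> lev b' y <= lev b' x + 1) ->
     Q s') ->
  wp V propagate_c Q s.
Proof.
elim: k b h s Q => [|k IH] b h s Q hk ho hi hh hq hr had hV gd hs hz H;
  apply: wp_while => /=; rewrite hh hq => hlt.
- apply: (H _ b) => //=; [lia | exact: Steps0|].
  by rewrite drop_oversize //; have := good_size gd; lia.
- by exfalso; have := good_size gd; move: hlt; case: ltnP => //; lia.
- have ge : size (que b) <= h by move: hlt; case: ltnP.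
  apply: (H _ b) => //=; [lia | exact: Steps0|].
  by rewrite drop_oversize.
have lt : h < size (que b) by move: hlt; case: ltnP.
case: s ho hi hh hq hr had H => w M ou ck /= ho hi hh hq hr had H.
set x := nth 0 (que b) h in hz *.
have xq : x \in que b by rewrite mem_nth.
have [gd1 gd2 gd3] := gd.
have xn := gd2 _ xq.
have [r4 _ _ _] := hr.1 x xn.
have lxV := hV x xn.
have [ls [ch szls hls hls']] := had x xn.
have r9 : aget M 9 h = x by rewrite hr.2.
wseq; wasgn; first by rewrite hh r9; lia.
wseq; wasgn; first by rewrite hh; have := good_size gd; lia.
wseq; wasgn; first by rewrite hh r9 ho r4; lia.
rewrite hh r9 ho r4.
wseq; wasgn.
  case: (ls) ch hls => [|e ls'] /=; first by move=> ->.
  by move=> [-> _ _] /(_ e (mem_head _ _)) [? _]; lia.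
apply: (@scan_wp b x ls) => //=; first exact: hz.
move=> s1 b1 fr1 o1 c1 q1 r1 sb1 gb1 st1 hz1 dn1.
have lx1 : lev b1 x = lev b x.
  by have [|-> _ _ _] := steps_same (v := x) st1; rewrite ?xq.
have [t1 ht1] := steps_prefix st1.
have hx1 : nth 0 (que b1) h = x by rewrite ht1 nth_cat lt.
apply: (IH b1 h.+1) => //.
- by lia.
- by rewrite fr1.
- by rewrite fr1.
- by rewrite fr1 //= addn1.
- exact: adj_ok_same sb1 had.
- by move=> v hv; apply: leq_ltn_trans (steps_mono v st1) (hV v hv).
- by rewrite ht1 size_cat; lia.
- move=> lt1 z zq; apply: leq_trans (hz1 z zq) _; rewrite leq_add2r -hx1.
  by have [_ _ g3] := gb1; apply: g3.
move=> s2 b2 fr2 o2 c2 r2 sb2 gb2 st2 dn2.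
have st12 := steps_trans st1 st2.
have [t2 ht2] := steps_prefix st2.
have drE : drop h (que b2) = x :: drop h.+1 (que b2).
  rewrite (drop_nth 0); last by rewrite ht2 size_cat ht1 size_cat; lia.
  by congr (_ :: _); rewrite ht2 nth_cat ht1 size_cat ltn_addr // nth_cat lt.
apply: (H s2 b2) => //.
- move=> z; rewrite !inE !negb_or => /and5P[h1 h2 h3 h4 /andP[h5 h6]].
  rewrite fr2 ?inE ?negb_or ?h1 ?h2 ?h3 ?h4 ?h5 ?h6 //.
  rewrite fr1 ?inE ?negb_or ?h2 ?h5 ?h6 //=.
  by rewrite (negbTE h1) (negbTE h3) (negbTE h4) (negbTE h5).
- by rewrite o2 o1.
- by rewrite drE big_cons; move: c1 c2; rewrite szls /=; lia.
- exact: same_but_trans sb1 sb2.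
- move=> z y; rewrite drE inE => /orP[/eqP ->|hzd]; last exact: dn2.
  move=> nxy; have [e els <-] := hls' y nxy.
  have xq1 : (x \in que b1) || (x \notin que b2) by rewrite (steps_que st1).
  have [-> _ _ _] := steps_same st2 xq1.
  exact: leq_trans (steps_mono _ st2) (dn1 e els).
Qed.

Lemma propagate_wp b s (Q : hst -> Prop) :
  var s vo = o -> var s vi = i -> var s vqh = 0 -> var s vqt = size (que b) ->
  rep n o (mem s) b -> adj_ok n (mem s) E -> (forall v, v < n -> lev b v < V) ->
  size (que b) <= 1 -> (forall x, x \in que b -> x < n) ->
  (forall s' b', (forall z, z \notin [:: vqh; vqt; vx; vl; ve; vy] -> var s' z = var s z) ->
     out s' = out s ->
     clk s' <= clk s + 300 * (\sum_(x <- que b') (dg E x + 1)) + 10 ->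
     rep n o (mem s') b' -> same_but n o (mem s) (mem s') -> good n b' ->
     steps E i b b' ->
     (forall x y, x \in que b' -> nb E x y -> lev b' y <= lev b' x + 1) ->
     Q s') ->
  wp V propagate_c Q s.
Proof.
move=> ho hi hh hq hr had hV h1 hn H.
apply: (@propagate_from n b 0) => //.
- split => //; first by case: (que b) h1 => [|z [|]].
  move=> j1 j2 le lt2; have -> : j1 = j2 by lia.
  exact: leqnn.
- by case: (que b) h1 => [|z [|]] //= _ _ y; rewrite inE => /eqP ->; rewrite leq_addr.
by move=> s' b'; rewrite drop0; exact: H.
Qed.

End Scan.
End Propagate.

(** * Appending an edge and resetting levels in memory *)

Definition slots (E : seq (nat * nat)) : seq nat :=
  flatten [seq [:: e.1; e.2] | e <- E].

Lemma slots_rcons E u v : slots (rcons E (u, v)) = slots E ++ [:: u; v].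
Proof. by rewrite /slots map_rcons flatten_rcons. Qed.

Lemma size_slots E : size (slots E) = 2 * size E.
Proof. by elim: E => //= e E IH; rewrite /slots /= in IH *; rewrite IH; lia. Qed.

Lemma mem_slots E x : (x \in slots E) = (0 < dg E x).
Proof.
rewrite /slots /dg; elim: E => [|e E IH]; first by rewrite big_nil.
rewrite big_cons /= !inE IH addn_gt0 addn_gt0 !(eq_sym x).
by rewrite !lt0b orbA.
Qed.

Lemma dg_rcons E u v x : dg (rcons E (u, v)) x = dg E x + ((u == x) + (v == x)).
Proof. by rewrite /dg -cats1 big_cat big_seq1. Qed.

Lemma dg_nb E x : 0 < dg E x -> exists y, nb E x y.
Proof.
rewrite /dg; elim: E => [|[u v] E IH]; first by rewrite big_nil.
rewrite big_cons /= => h.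
have [ux|ux] := eqVneq u x; first by exists v; rewrite ux /nb inE eqxx.
have [vx|vx] := eqVneq v x; first by exists u; rewrite vx /nb !inE eqxx !orbT.
move: h; rewrite (negbTE ux) (negbTE vx) /= => /IH[y hy].
by exists y; case/orP: hy => hy; rewrite /nb !inE hy ?orbT.
Qed.

Lemma sum_dg_le E r : uniq r -> \sum_(x <- r) dg E x <= 2 * size E.
Proof.
move=> ur; rewrite exchange_big /= mulnC -sum1_size big_distrl /=.
apply: leq_sum => e _; rewrite big_split mul1n /=.
have one z : \sum_(x <- r) (z == x :> nat) <= 1.
  rewrite (eq_bigr (fun x => if x == z then 1 else 0)) => [|x _].
    by rewrite -big_mkcond sum1_count count_uniq_mem // leq_b1.
  by rewrite eq_sym; case: eqP.
exact: (leq_add (one e.1) (one e.2)).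
Qed.

Lemma slots_bounded n E x : bounded n E -> x \in slots E -> x < n.
Proof. by move=> Eb; rewrite mem_slots => /dg_nb[y /Eb[]]. Qed.

Definition edges_ok (M : nat -> nat) (E : seq (nat * nat)) : Prop :=
  aget M 0 5 = size E /\
  forall j, j < 2 * size E -> aget M 0 (6 + j) = nth 0 (slots E) j.

(** The two slots of the new edge double as list cells: the slot holding v is linked into the list
    of u, and conversely. *)
Definition add_edge_c : prog :=
  PAsgn vm (EArr 0 (EConst 5)) ;;
  PStore 0 (EConst 6 $+ EConst 2 $* EVar vm) (EVar vu) ;;
  PStore 0 (EConst 7 $+ EConst 2 $* EVar vm) (EVar vv) ;;
  PStore 3 (EConst 7 $+ EConst 2 $* EVar vm) (EArr 2 (EVar vu)) ;;
  PStore 2 (EVar vu) (EConst 7 $+ EConst 2 $* EVar vm) ;;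
  PStore 3 (EConst 6 $+ EConst 2 $* EVar vm) (EArr 2 (EVar vv)) ;;
  PStore 2 (EVar vv) (EConst 6 $+ EConst 2 $* EVar vm) ;;
  PStore 0 (EConst 5) (EVar vm $+ EConst 1).

(** The levels are reset by running over the endpoints of edges instead of the nodes, so that a
    rebuild costs O(m + 1) whatever n is. A node without edges other than s stays at the cap
    anyway. *)
Definition rebuild_c : prog :=
  PAsgn ve (EConst 6) ;;
  PWhile (EVar ve $< EConst 6 $+ EConst 2 $* EArr 0 (EConst 5))
    (PStore 4 (EVar vo $+ EArr 0 (EVar ve)) (EVar vX $+ EVar vX) ;;
     PAsgn ve (EVar ve $+ EConst 1)) ;;
  PStore 4 (EVar vo $+ EArr 0 (EConst 1)) (EConst 0) ;;
  PStore 6 (EArr 0 (EConst 1)) (EConst 0) ;;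
  PStore 7 (EArr 0 (EConst 1)) (EVar vi) ;;
  PStore 9 (EConst 0) (EArr 0 (EConst 1)) ;;
  PAsgn vqh (EConst 0) ;;
  PAsgn vqt (EConst 1) ;;
  propagate_c.

Lemma chain_ext f g h ls : (forall e, e \in ls -> f e = g e) ->
  chain f h ls -> chain g h ls.
Proof.
elim: ls h => //= e ls IH h fg [-> e0 c]; split => //.
rewrite -fg ?mem_head //; apply: IH => // e' e'l.
by apply: fg; rewrite inE e'l orbT.
Qed.

Section AddEdge.
Variables (V n : nat) (E : seq (nat * nat)) (u v : nat).
Hypotheses (Eb : bounded n E) (un : u < n) (vn_ : v < n) (uv : u != v).
Hypotheses (slotV : 8 + 2 * size E <= V) (nV : n < V).

Lemma adj_head_le M x : adj_ok n M E -> x < n -> aget M 2 x < 6 + 2 * size E.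
Proof.
move=> ad hx; have [[|e ls] [ch _ hls _]] := ad x hx; first by rewrite ch.
by case: ch => -> _ _; case: (hls e (mem_head _ _)) => /andP[].
Qed.

Lemma add_edge_wp s (Q : hst -> Prop) :
  var s vu = u -> var s vv = v -> edges_ok (mem s) E -> adj_ok n (mem s) E ->
  (forall s', (forall z, z != vm -> var s' z = var s z) -> out s' = out s ->
     clk s' <= clk s + 200 ->
     edges_ok (mem s') (rcons E (u, v)) -> adj_ok n (mem s') (rcons E (u, v)) ->
     (forall a, a \in [:: 1; 4; 5; 6; 7; 8; 9] -> aget (mem s') a = aget (mem s) a) ->
     (forall j, j \notin [:: 5; 6 + 2 * size E; 7 + 2 * size E] ->
        aget (mem s') 0 j = aget (mem s) 0 j) ->
     Q s') ->
  wp V add_edge_c Q s.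
Proof.
case: s => w M ou ck /= hu hv ed ad H; have [e5 e6] := ed.
have hdu := adj_head_le ad un; have hdv := adj_head_le ad vn_.
wseq; wasgn; first by rewrite e5; lia.
wseq; wstore; first by rewrite hu; lia.
wseq; wstore; first by rewrite hv; lia.
rewrite hu hv e5.
wseq; wstore; first by rewrite !aget_set //= hu; lia.
rewrite !aget_set //=.
wseq; wstore; first by rewrite ?e5; lia.
wseq; wstore; first by rewrite !aget_set //= hu hv eq_sym (negbTE uv); lia.
wseq; wstore; first by rewrite ?e5; lia.
wstore; first by rewrite ?e5; lia.
rewrite !aget_set //= !hu hv [v == u]eq_sym (negbTE uv).
set M1 := aset _ 0 5 _.
have M10 j : aget M1 0 j = if j == 5 then size E + 1 else if j == 7 + 2 * size E then v
    else if j == 6 + 2 * size E then u else aget M 0 j by rewrite /M1 !aget_set.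
have M12 x : aget M1 2 x = if x == v then 6 + 2 * size E else if x == u then 7 + 2 * size E else aget M 2 x.
  by rewrite /M1 !aget_set.
have M13 j : aget M1 3 j = if j == 6 + 2 * size E then aget M 2 v else
    if j == 7 + 2 * size E then aget M 2 u else aget M 3 j by rewrite /M1 !aget_set.
have M1a a : a \in [:: 1; 4; 5; 6; 7; 8; 9] -> aget M1 a = aget M a.
  by move=> ha; rewrite /M1 !aget_set_other //; move: ha; rewrite !inE; do ?[case/orP]; move=> /eqP ->.
move: M1 M10 M12 M13 M1a => M1 M10 M12 M13 M1a.
apply: H => //=.
- by move=> z /negbTE ->.
- lia.
- split; first by rewrite M10 size_rcons addn1.
  move=> j; rewrite size_rcons slots_rcons nth_cat size_slots M10 => hj.
  have -> : (6 + j == 5) = false by lia.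
  case: ltnP => h.
    have -> : (6 + j == 7 + 2 * size E) = false by lia.
    have -> : (6 + j == 6 + 2 * size E) = false by lia.
    exact: e6.
  have [->|h2] := eqVneq j (2 * size E).
    have -> : (6 + 2 * size E == 7 + 2 * size E) = false by lia.
    by rewrite eqxx subnn.
  have -> : j = 2 * size E + 1 by lia.
  have -> : (6 + (2 * size E + 1) == 7 + 2 * size E) = true by lia.
  by rewrite addKn.
- move=> x hx; have [ls [ch sz hls hls']] := ad x hx.
  have ch1 : chain (aget M1 3) (aget M 2 x) ls.
    apply: chain_ext ch => e /hls[lt _]; rewrite M13.
    have -> : (e == 6 + 2 * size E) = false by lia.
    by have -> : (e == 7 + 2 * size E) = false by lia.
  have tgt e : e \in ls -> aget M1 0 e = aget M 0 e.
    move=> /hls[lt _]; rewrite M10.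
    have -> : (e == 5) = false by lia.
    have -> : (e == 7 + 2 * size E) = false by lia.
    by have -> : (e == 6 + 2 * size E) = false by lia.
  have old e : e \in ls ->
      6 <= e < 6 + 2 * size (rcons E (u, v)) /\ nb (rcons E (u, v)) x (aget M1 0 e).
    move=> el; have [lt nxe] := hls e el; rewrite size_rcons tgt //; split; first by lia.
    by rewrite nb_rcons nxe.
  have T6 : aget M1 0 (6 + 2 * size E) = u.
    rewrite M10; have -> : (6 + 2 * size E == 5) = false by lia.
    by have -> : (6 + 2 * size E == 7 + 2 * size E) = false by [lia]; rewrite eqxx.
  have T7 : aget M1 0 (7 + 2 * size E) = v.
    by rewrite M10; have -> : (7 + 2 * size E == 5) = false by [lia]; rewrite eqxx.
  have [xv|xv] := eqVneq x v; last have [xu|xu] := eqVneq x u.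
  + exists (6 + 2 * size E :: ls); split.
    * rewrite M12 xv eqxx; split => //.
      by rewrite M13 eqxx -xv.
    * by rewrite /= dg_rcons sz xv eqxx (negbTE uv); lia.
    * move=> e; rewrite inE => /orP[/eqP ->|/old //]; rewrite T6; split; first by rewrite size_rcons; lia.
      by rewrite xv nb_rcons !eqxx !orbT.
    * move=> y; rewrite nb_rcons => /or3P[/hls'[e el <-]|/andP[/eqP xu _]|/andP[_ /eqP ->]].
      - by exists e; [rewrite inE el orbT | exact: tgt].
      - by move: uv; rewrite -xv -xu eqxx.
      - by exists (6 + 2 * size E); [exact: mem_head | exact: T6].
  + exists (7 + 2 * size E :: ls); split.
    * rewrite M12 (negbTE xv) xu eqxx; split => //.
      have -> : aget M1 3 (7 + 2 * size E) = aget M 2 u.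
        by rewrite M13; have -> : (7 + 2 * size E == 6 + 2 * size E) = false by [lia]; rewrite eqxx.
      by rewrite -xu.
    * by rewrite /= dg_rcons sz xu eqxx eq_sym (negbTE uv); lia.
    * move=> e; rewrite inE => /orP[/eqP ->|/old //]; rewrite T7; split; first by rewrite size_rcons; lia.
      by rewrite xu nb_rcons !eqxx !orbT.
    * move=> y; rewrite nb_rcons => /or3P[/hls'[e el <-]|/andP[_ /eqP ->]|/andP[/eqP h _]].
      - by exists e; [rewrite inE el orbT | exact: tgt].
      - by exists (7 + 2 * size E); [exact: mem_head | exact: T7].
      - by rewrite h eqxx in xv.
  + exists ls; split.
    * by rewrite M12 (negbTE xv) (negbTE xu).
    * by rewrite dg_rcons sz ![_ == x]eq_sym (negbTE xv) (negbTE xu) addn0.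
    * exact: old.
    * move=> y; rewrite nb_rcons (negbTE xv) (negbTE xu) !orbF => /hls'[e el <-].
      by exists e => //; exact: tgt.
- by move=> j; rewrite !inE !negb_or M10 => /and3P[/negbTE-> /negbTE-> /negbTE->].
Qed.
End AddEdge.

Section Rebuild.
Variables (V n o i s X : nat) (E : seq (nat * nat)).
Hypotheses (Eb : bounded n E) (sn : s < n) (nV : n < V) (iV : i <= V).
Hypotheses (slotV : 6 + 2 * size E < V) (XV : X + X < V).

Definition fresh_bfs (pr bs bc : nat -> nat) : bfs :=
  Bfs (fun v => if v == s then 0 else X + X) pr (upd bs s 0) (upd bc s i) [:: s].

Lemma reset_wp k st (Q : hst -> Prop) :
  k <= 2 * size E ->
  var st ve = 6 + (2 * size E - k) -> var st vo = o -> var st vX = X ->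
  edges_ok (mem st) E ->
  (forall st', (forall z, z != ve -> var st' z = var st z) -> out st' = out st ->
     clk st' <= clk st + 60 * k + 60 ->
     (forall v, v < n -> aget (mem st') 4 (o + v) =
        if v \in drop (2 * size E - k) (slots E) then X + X else aget (mem st) 4 (o + v)) ->
     (forall a, a < 10 -> a != 4 -> aget (mem st') a = aget (mem st) a) ->
     (forall j, ~~ (o <= j < o + n) -> aget (mem st') 4 j = aget (mem st) 4 j) ->
     Q st') ->
  wp V (PWhile (EVar ve $< EConst 6 $+ EConst 2 $* EArr 0 (EConst 5))
    (PStore 4 (EVar vo $+ EArr 0 (EVar ve)) (EVar vX $+ EVar vX) ;;
     PAsgn ve (EVar ve $+ EConst 1))) Q st.
Proof.
elim: k st Q => [|k IH] st Q hk he ho hX ed H; apply: wp_while => /=; rewrite he ed.1.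
- move=> _; apply: H => //=; first by lia.
  by move=> v hv; rewrite subn0 drop_oversize // size_slots.
- by rewrite subn0 ltnn.
- by move=> h; exfalso; move: h; case: ltnP => //; lia.
move=> _; set j := 2 * size E - k.+1.
case: st he ho hX ed H => w M ou ck /= he ho hX ed H.
have hj : aget M 0 (6 + j) = nth 0 (slots E) j by apply: ed.2; rewrite /j; lia.
have js : j < size (slots E) by rewrite size_slots /j; lia.
have yn : nth 0 (slots E) j < n by apply: slots_bounded Eb _; exact: mem_nth.
wseq; wstore; first by rewrite hX; lia.
rewrite hX ho he -/j hj; wasgn; first by rewrite he; lia.
apply: IH => //=; first by lia.
- by rewrite he /j; lia.
- by case: ed => e5 e6; split => [|z hz]; rewrite aget_set //= ?e6.
move=> s1 fr1 o1 c1 l1 a1 f1; apply: H => //.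
- by move=> z hz; rewrite fr1 //= (negbTE hz).
- by lia.
- move=> v hv; rewrite l1 // aget_set //= eqn_add2l (drop_nth 0 js) inE.
  have -> : 2 * size E - k = j.+1 by rewrite /j; lia.
  by case: (v \in drop j.+1 _); case: eqP.
- by move=> a ha h4; rewrite a1 // aget_set_other.
- move=> z hz; rewrite f1 // aget_set //=; case: eqP => // zz.
  by move: hz; rewrite zz; lia.
Qed.

Lemma rebuild_wp st (Q : hst -> Prop) :
  var st vo = o -> var st vi = i -> var st vX = X ->
  edges_ok (mem st) E -> adj_ok n (mem st) E -> aget (mem st) 0 1 = s ->
  (forall v, v < n -> v != s -> 0 < dg E v \/ aget (mem st) 4 (o + v) = X + X) ->
  (forall st' b',
     (forall z, z \notin [:: vqh; vqt; vx; vl; ve; vy] -> var st' z = var st z) ->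
     out st' = out st -> clk st' <= clk st + 2000 * (size E + 1) ->
     rep n o (mem st') b' -> same_but n o (mem st) (mem st') -> good n b' ->
     steps E i (fresh_bfs (fun v => aget (mem st) 5 (o + v)) (aget (mem st) 6) (aget (mem st) 7)) b' ->
     (forall x y, x \in que b' -> nb E x y -> lev b' y <= lev b' x + 1) ->
     Q st') ->
  wp V rebuild_c Q st.
Proof.
case: st => w M ou ck /= ho hi hX ed ad hs hcap H.
wseq; wasgn; first by lia.
wseq; apply: (@reset_wp (2 * size E)) => //=; first by rewrite subnn.
move=> s1 fr1 o1 c1 l1 a1 f1; rewrite subnn drop0 in l1.
have [e1a e1b] : edges_ok (mem s1) E by rewrite /edges_ok a1.
have hs1 : aget (mem s1) 0 1 = s by rewrite a1.
case: s1 fr1 o1 c1 l1 a1 f1 e1a e1b hs1 => w1 M1 ou1 ck1 /= fr1 o1 c1 l1 a1 f1 e1a e1b hs1.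
wseq; wstore; first by [].
rewrite hs1 fr1 //= ho.
wseq; wstore; first by []. rewrite aget_set //= hs1.
wseq; wstore; first by rewrite fr1 //= hi.
rewrite !aget_set //= hs1 fr1 //= hi.
wseq; wstore; first by rewrite !aget_set //= hs1; lia.
rewrite !aget_set //= hs1.
wseq; wasgn; first by [].
wseq; wasgn; first by lia.
set M2 := aset _ 9 0 _.
have M2a a : a \in [:: 0; 1; 2; 3; 5; 8] -> aget M2 a = aget M a.
  move=> ha; rewrite -a1; try (move: ha; rewrite !inE; by do ?[case/orP]; move=> /eqP ->).
  by rewrite /M2 !aget_set_other //; move: ha; rewrite !inE; do ?[case/orP]; move=> /eqP ->.
have M24 j : aget M2 4 j = if j == o + s then 0 else aget M1 4 j by rewrite /M2 !aget_set.
have M26 j : aget M2 6 j = if j == s then 0 else aget M 6 j by rewrite /M2 !aget_set //= a1.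
have M27 j : aget M2 7 j = if j == s then i else aget M 7 j by rewrite /M2 !aget_set //= a1.
have M29 : aget M2 9 0 = s by rewrite /M2 !aget_set.
move: M2 M2a M24 M26 M27 M29 => M2 M2a M24 M26 M27 M29.
set b0 := fresh_bfs (fun v => aget M 5 (o + v)) (aget M 6) (aget M 7).
apply: (@propagate_wp V n o i nV iV E Eb (ltnW slotV) b0) => //=.
- by rewrite fr1.
- by rewrite fr1.
- split => /= [v hv|[|j] //].
  rewrite M24 M2a // M26 M27 /= eqn_add2l; split => //.
  case: eqP => // /eqP vs; rewrite l1 //; case: ifP => // hm.
  by case: (hcap v hv vs) => //; rewrite -mem_slots hm.
- move=> x hx; have [ls] := ad x hx; exists ls; by rewrite !M2a.
- by move=> v _; case: eqP => _; lia.
- by move=> x; rewrite inE => /eqP ->.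
move=> s2 b' fr2 o2 c2 r2 sb2 g2 st2 dn2; apply: (H s2 b') => //.
- move=> z; rewrite !inE !negb_or => /and5P[h1 h2 h3 h4 /andP[h5 h6]].
  rewrite fr2 ?inE ?negb_or ?h1 ?h2 ?h3 ?h4 ?h5 ?h6 //= (negbTE h1) (negbTE h2).
  by rewrite fr1 //= (negbTE h5).
- by rewrite o2 o1.
(* Every queued node except s has an edge to its parent, so its degree absorbs the unit charged per
   node; s accounts for the final 1. *)
- have sum : \sum_(x <- que b') (dg E x + 1) <= 4 * size E + 1.
    have [u2 n2 _] := g2.
    have [t ht] := steps_prefix st2; rewrite ht big_cat /= big_cons big_nil.
    have us : uniq t by move: u2; rewrite ht cat_uniq => /and3P[].
    have h1 : \sum_(x <- t) (dg E x + 1) <= \sum_(x <- t) 2 * dg E x.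
      rewrite big_seq [X in _ <= X]big_seq; apply: leq_sum => x xt.
      have xq : x \in que b' by rewrite ht mem_cat xt orbT.
      have xs : x \notin que b0.
        by move: u2; rewrite ht cat_uniq => /and3P[_ /hasPn/(_ x xt)].
      have [_ h _ _ _] := steps_new st2 xq xs.
      by have := dg_gt0 (_ : nb E x (par b' x)); rewrite nbC => /(_ h); lia.
    have h2 : dg E s + \sum_(x <- t) dg E x <= 2 * size E.
      by have := sum_dg_le E u2; rewrite ht big_cat /= big_cons big_nil; lia.
    move: h1; rewrite -big_distrr /=; lia.
  move: c1 c2; lia.
- case: sb2 => q1 q2; split => [a ha|a j ha hj].
    by rewrite q1 // M2a //; move: ha; rewrite !inE; do ?[case/orP]; move=> /eqP ->.
  rewrite q2 //; move: ha; rewrite !inE => /orP[/eqP ->|/eqP ->]; last by rewrite M2a.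
  rewrite M24 f1 //; case: eqP => // jj; by move: hj; rewrite jj; lia.
Qed.

End Rebuild.

(** * Exact local updates and the stored estimates *)

Lemma steps_nil E i b b' : que b = [::] -> steps E i b b' -> b' = b.
Proof. by move=> q S; elim: S => // c x y _ ->; rewrite q. Qed.

(** Memory blocks represent levels and parents for nodes below n only, and the edges never leave
    that range. *)
Lemma scale_ext n s L E lv pr lv' pr' D G F : bounded n E -> s < n ->
  (forall v, v < n -> lv' v = lv v /\ pr' v = pr v) ->
  scale n s L E lv pr D G F -> scale n s L E lv' pr' D G F.
Proof.
move=> Eb sn eqv sc; case: (sc) => S1 S2 S3 S4 S5 S6 S7.
have GE x y : nb G x y -> nb E x y by apply: nb_sub => z h; rewrite S1 mem_cat h.
have eq1 v : v < n -> lv' v = lv v by case/eqv.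
split => //.
- by rewrite eq1.
- by move=> v hv; rewrite eq1 // S3.
- by move=> x y xy; have [xn yn] := Eb _ _ (GE _ _ xy); rewrite !eq1 // S4.
- move=> v hv vs; have [-> ->] := eqv v hv => hL; have [h1 h2] := S5 v hv vs hL.
  by have [_ pn] := Eb _ _ h1; rewrite eq1.
- rewrite S6; apply: eq_big_seq => -[x y] h.
  have [xn yn] : x < n /\ y < n.
    by apply: (Eb x y); rewrite /nb S1 mem_cat h orbT.
  by rewrite /exc /= !eq1.
Qed.

Section LocalUpdate.
Variables (n s L i : nat) (E : seq (nat * nat)) (lv pr bs bc : nat -> nat).
Variables (D : nat) (G F : seq (nat * nat)) (u v : nat) (b' : bfs).
Let E' := rcons E (u, v).
Let b0 := Bfs lv pr bs bc [::].
Let b1 := try_push i u (lev b0 u + 1) v b0.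
Let b2 := try_push i v (lev b1 v + 1) u b1.
Hypotheses (Eb : bounded n E) (un : u < n) (vn_ : v < n) (uv : u != v).
Hypothesis sc : scale n s L E lv pr D G F.
Hypothesis quiet : F = [::] \/ ~ (conn G s u <-> conn G s v).
Hypotheses (S : steps E' i b2 b') (gb : good n b').
Hypothesis done : forall x y, x \in que b' -> nb E' x y -> lev b' y <= lev b' x + 1.

Lemma local_update :
  [/\ scale n s L E' (lev b') (par b') D (rcons G (u, v)) F,
      forall x, x \in que b' -> lev b' x < lv x /\ 0 < dg E' x,
      forall x, x \notin que b' ->
        [/\ lev b' x = lv x, bst b' x = bs x & bsc b' x = bc x],
      forall x, x \in que b' -> bst b' x = minn (bs x) (lev b' x) /\
        bsc b' x = if lev b' x < bs x then i else bc x &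
      ~ (conn G s u <-> conn G s v) -> forall x, x \in que b' -> lv x = L].
Proof.
have pushed a c : a < n -> c < n -> a != c ->
    ((u, v) == (a, c)) || ((u, v) == (c, a)) ->
    F = [::] \/ ~ (conn G s a <-> conn G s c) ->
    lv a + 1 < lv c -> b2 = push i a (lv a + 1) c b0 ->
  [/\ scale n s L E' (lev b') (par b') D (rcons G (u, v)) F,
      forall x, x \in que b' -> lev b' x < lv x /\ 0 < dg E' x,
      forall x, x \notin que b' ->
        [/\ lev b' x = lv x, bst b' x = bs x & bsc b' x = bc x],
      forall x, x \in que b' -> bst b' x = minn (bs x) (lev b' x) /\
        bsc b' x = if lev b' x < bs x then i else bc x &
      ~ (conn G s a <-> conn G s c) -> forall x, x \in que b' -> lv x = L].
  move=> an cn ac eac qt lt b2E; move: S; rewrite b2E => S'.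
  have cq : c \in que (push i a (lv a + 1) c b0) by rewrite mem_head.
  split.
  - exact: (local_scale Eb sc an cn ac eac qt lt S' done).
  - move=> x xq; split; first exact: (local_drop lt S' xq).
    have [->|xc] := eqVneq x c.
      apply: (@dg_gt0 _ _ a); rewrite /E' nb_rcons.
      by case/orP: eac => /eqP[-> ->]; rewrite !eqxx !orbT.
    have xq1 : x \notin que (push i a (lv a + 1) c b0) by rewrite /= inE.
    by have [_ h _ _ _] := steps_new S' xq xq1; apply: (@dg_gt0 _ _ (par b' x)); rewrite nbC.
  - move=> x xq; have [h1 _] := local_same S' xq; split => //.
      have hx : (x \in que (push i a (lv a + 1) c b0)) || (x \notin que b') by rewrite xq orbT.
      have xc : (x == c) = false by apply/eqP => xc; rewrite xc (steps_que S') in xq.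
      by have [_ _ -> _] := steps_same S' hx; rewrite /=; case: ifP => //= _; rewrite xc.
    have hx : (x \in que (push i a (lv a + 1) c b0)) || (x \notin que b') by rewrite xq orbT.
    have xc : (x == c) = false by apply/eqP => xc; rewrite xc (steps_que S') in xq.
    by have [_ _ _ ->] := steps_same S' hx; rewrite /=; case: ifP => //= _; rewrite xc.
  - move=> x xq; have [->|xc] := eqVneq x c.
      have hx : (c \in que (push i a (lv a + 1) c b0)) || (c \notin que b') by rewrite cq.
      have [-> _ -> ->] := steps_same S' hx; rewrite /= eqxx minnC /minn.
      by split; case: ifP => //= _; rewrite ?eqxx.
    have xq1 : x \notin que (push i a (lv a + 1) c b0) by rewrite /= inE.
    have [_ _ _ _ [h1 h2]] := steps_new S' xq xq1.
    move: h1 h2; rewrite /=.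
    have -> : (if lv a + 1 < bs c then upd bs c (lv a + 1) else bs) x = bs x.
      by case: ifP => //= _; rewrite (negbTE xc).
    have -> // : (if lv a + 1 < bs c then upd bc c i else bc) x = bc x.
    by case: ifP => //= _; rewrite (negbTE xc).
  - move=> att; have [_ hn _] := gb.
    exact: (attach_fresh Eb sc an cn ac eac lt S' att hn).
have [lt|ge] := ltnP (lv u + 1) (lv v).
  have b1E : b1 = push i u (lv u + 1) v b0 by rewrite /b1 /try_push /= lt.
  have b2E : b2 = push i u (lv u + 1) v b0.
    rewrite /b2 b1E /try_push /= eqxx (negbTE uv).
    by have -> : (lv u + 1 + 1 < lv u) = false by lia.
  by apply: pushed => //; rewrite eqxx.
have b1E : b1 = b0 by rewrite /b1 /try_push /= ltnNge ge.
have [lt|ge'] := ltnP (lv v + 1) (lv u).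
  have b2E : b2 = push i v (lv v + 1) u b0 by rewrite /b2 b1E /try_push /= lt.
  have [|||||h1 h2 h3 h4 h5] := pushed v u _ _ _ _ _ lt b2E => //; try by rewrite // eq_sym.
  - by rewrite eqxx orbT.
  - by case: quiet => [->|h]; [left | right => h'; apply: h; split; apply h'].
  split => // att; apply: h5 => h'; apply: att; split; apply h'.
have b2E : b2 = b0 by rewrite /b2 b1E /try_push /= ltnNge ge'.
have b'E : b' = b0 by move: S; rewrite b2E; apply: steps_nil.
rewrite b'E; split => //.
by apply: (local_noop sc (a := u) (c := v)); rewrite ?eqxx.
Qed.

End LocalUpdate.

Section Structure.
Variables (n s a b q X0 S : nat).

Definition scale_width (i : nat) := X0 * 2 ^ i.
Definition scale_cap (i : nat) := scale_width i + scale_width i.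
(** The cap of the widest scale, hence above every level that is below the cap of its own scale. *)
Definition no_estimate := scale_cap S.-1.

Definition level_at (M : nat -> nat) (i v : nat) := aget M 4 (i * n + v).
Definition parent_at (M : nat -> nat) (i v : nat) := aget M 5 (i * n + v).

Record core_ok (M : nat -> nat) (E : seq (nat * nat)) : Prop := Core {
  co_n : aget M 0 0 = n;
  co_s : aget M 0 1 = s;
  co_a : aget M 0 3 = a;
  co_b : aget M 0 4 = b;
  co_S : aget M 1 0 = S;
  co_X : aget M 1 1 = X0;
  co_inf : aget M 1 2 = no_estimate;
  co_edges : edges_ok M E;
  co_adj : adj_ok n M E }.

(** The debt bound is D <= (a / b) X / 2 cleared of denominators; the last clause makes scale 0
    exact. *)
Definition scale_state (E : seq (nat * nat)) (M : nat -> nat) (i : nat)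
    (G F : seq (nat * nat)) : Prop :=
  [/\ scale n s (scale_cap i) E (level_at M i) (parent_at M i) (aget M 8 i) G F,
      2 * b * aget M 8 i <= a * scale_width i & i = 0 -> F = [::]].

(** Only the first k scales are taken into account, so that the same predicate serves while the
    scales are being built. *)
Definition estimates_ok (k : nat) (M : nat -> nat) : Prop :=
  forall v, v < n ->
    (forall i, i < k -> level_at M i v < scale_cap i -> aget M 6 v <= level_at M i v) /\
    (aget M 6 v = no_estimate \/
     [/\ aget M 7 v < k, aget M 6 v = level_at M (aget M 7 v) v &
         level_at M (aget M 7 v) v < scale_cap (aget M 7 v)]).

(** The cases are a node not queued by the search, a node pushed by it, and the source of a rebuild.
    In the first the level may also become the cap, since a rebuild resets levels without touching
    the estimates. *)
Definition estimate_step (i : nat) (M M' : nat -> nat) (v : nat) : Prop :=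
  [\/ [/\ aget M' 6 v = aget M 6 v, aget M' 7 v = aget M 7 v &
         level_at M' i v = level_at M i v \/ level_at M' i v = scale_cap i],
      [/\ aget M' 6 v = minn (aget M 6 v) (level_at M' i v),
         aget M' 7 v = (if level_at M' i v < aget M 6 v then i else aget M 7 v) &
         level_at M' i v < scale_cap i] |
      [/\ aget M' 6 v = level_at M' i v, aget M' 7 v = i, level_at M' i v <= aget M 6 v &
         level_at M' i v < scale_cap i]].

Definition scale_frame_rel (i : nat) (M M' : nat -> nat) : Prop :=
  [/\ forall c, c < 4 -> aget M' c = aget M c,
      forall j, j != i -> aget M' 8 j = aget M 8 j &
      forall c j, c \in [:: 4; 5] -> ~~ (i * n <= j < i * n + n) ->
        aget M' c j = aget M c j].

Lemma frame_lvl i j M M' v : scale_frame_rel i M M' -> j != i -> v < n ->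
  level_at M' j v = level_at M j v /\ parent_at M' j v = parent_at M j v.
Proof.
move=> [_ _ h] ne hv; rewrite /level_at /parent_at !h //; apply/negP; move=> /andP[h1 h2];
  by move/eqP: ne; apply; nia.
Qed.

(** Levels never rise, so an estimate attained at scale i either keeps its level or is replaced by
    the smaller one. A scale under construction starts with all levels at the cap, where it
    contributes no estimate. *)
Lemma best_update k k' i M M' :
  estimates_ok k M -> (i < k /\ k' = k) \/ [/\ i = k, k' = k.+1 & forall v, v < n -> level_at M i v = scale_cap i] ->
  scale_frame_rel i M M' -> (forall v, v < n -> level_at M' i v <= level_at M i v) ->
  (forall v, v < n -> estimate_step i M M' v) -> estimates_ok k' M'.
Proof.
move=> ok hk fr le st v hv; have [b1 b2] := ok v hv.
have oth j : j != i -> level_at M' j v = level_at M j v by move=> ne; have [] := frame_lvl fr ne hv.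
have kk : k <= k' by case: hk => [[_ ->]|[_ -> _]].
have ik' : i < k' by case: hk => [[? ->]|[-> -> _]].
have new j : j < k' -> j != i -> j < k.
  by case: hk => [[_ ->] //|[-> -> _]]; rewrite ltnS leq_eqVlt => /orP[->|].
have lei := le v hv; split.
- move=> j jk'; have [->|ji] := eqVneq j i; last first.
    rewrite oth // => lt; apply: leq_trans (b1 j (new j jk' ji) lt).
    case: (st v hv) => [[-> _ _]|[-> _ _]|[-> _ h _]] //; exact: geq_minl.
  case: (st v hv) => [[-> _ h]|[-> _ _] _|[-> _ _ _] //]; last exact: geq_minr.
  move=> lt; have hl : level_at M' i v = level_at M i v by case: h => // h; rewrite h ltnn in lt.
  rewrite hl in lt *; case: hk => [[ik _]|[ik _ h']]; first exact: b1.
  by rewrite h' // ltnn in lt.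
- have keep : aget M' 6 v = aget M 6 v -> aget M' 7 v = aget M 7 v ->
      (aget M 7 v = i -> i < k -> aget M 6 v = level_at M i v -> level_at M i v < scale_cap i -> level_at M' i v = level_at M i v) ->
      aget M' 6 v = no_estimate \/ [/\ aget M' 7 v < k', aget M' 6 v = level_at M' (aget M' 7 v) v &
         level_at M' (aget M' 7 v) v < scale_cap (aget M' 7 v)].
    move=> -> -> h; case: b2 => [->|[c1 c2 c3]]; [by left | right].
    have [e|ne] := eqVneq (aget M 7 v) i; last by rewrite oth //; split => //; lia.
    by rewrite e in c1 c2 c3 *; rewrite h //; split => //; lia.
  case: (st v hv) => [[e1 e2 h]|[e1 e2 h]|[e1 e2 h1 h2]].
  + apply: keep => // _ _ _ lt; case: h => // h; move: lei; rewrite h; lia.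
  + move: e1 e2; rewrite /minn; case: ltnP => h' e1 e2.
      apply: keep => //; first by rewrite e2; case: ltnP => //; lia.
      by move=> _ _ e3 _; lia.
    have [lt|ge] := ltnP (level_at M' i v) (aget M 6 v).
      by right; rewrite e2 lt e1.
    apply: keep; [lia | by rewrite e2 ltnNge ge | by move=> _ _ e3 _; lia].
  + by right; rewrite e1 e2.
Qed.

End Structure.

(** * Insertions *)

Definition local_c : prog :=
  PAsgn vqh (EConst 0) ;;
  PAsgn vqt (EConst 0) ;;
  PAsgn vx (EVar vu) ;;
  PAsgn vl (EArr 4 (EVar vo $+ EVar vu) $+ EConst 1) ;;
  PAsgn vy (EVar vv) ;;
  relax_c ;;
  PAsgn vx (EVar vv) ;;
  PAsgn vl (EArr 4 (EVar vo $+ EVar vv) $+ EConst 1) ;;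
  PAsgn vy (EVar vu) ;;
  relax_c ;;
  propagate_c.

Definition lazy_c : prog :=
  PAsgn vd (EArr 8 (EVar vi) $+
    ((EArr 4 (EVar vo $+ EVar vu) $- EArr 4 (EVar vo $+ EVar vv) $- EConst 1) $+
     (EArr 4 (EVar vo $+ EVar vv) $- EArr 4 (EVar vo $+ EVar vu) $- EConst 1))) ;;
  PIf (EArr 0 (EConst 3) $* EVar vX $< EConst 2 $* EArr 0 (EConst 4) $* EVar vd)
    (PStore 8 (EVar vi) (EConst 0) ;; rebuild_c)
    (PStore 8 (EVar vi) (EVar vd)).

(** The product is 0 for scale 0 and for an edge that attaches a component to s; both take the exact
    update. *)
Definition update_c : prog :=
  PAsgn vo (EVar vi $* EVar vn) ;;
  PIf (EVar vi $* EVar vsame $< EConst 1) local_c lazy_c.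

Section RebuildOk.
Variables (n s a b X0 i : nat) (E : seq (nat * nat)).
Hypotheses (Eb : bounded n E) (sn : s < n) (X0_gt0 : 0 < X0).
Local Notation width := (scale_width X0).
Local Notation cap := (scale_cap X0).
Local Notation lvl := (level_at n).
Local Notation prn := (parent_at n).
Local Notation scale_ok := (scale_state n s a b X0).
Local Notation scale_frame := (scale_frame_rel n).
Local Notation best_step := (estimate_step n X0).

(** The monotonicity of levels is a hypothesis because it has two origins: [rebuilt_le] during
    insertions, and the caps during preprocessing. *)
Lemma rebuild_ok M M' b' : (forall x, x < n -> lev b' x <= lvl M i x) ->
  rep n (i * n) M' b' -> same_but n (i * n) (aset M 8 i 0) M' -> good n b' ->
  steps E i (fresh_bfs i s (width i) (prn M i) (aget M 6) (aget M 7)) b' ->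
  (forall x y, x \in que b' -> nb E x y -> lev b' y <= lev b' x + 1) ->
  [/\ scale_ok E M' i E [::], scale_frame i M M',
      forall x, x < n -> lvl M' i x <= lvl M i x &
      forall x, x < n -> best_step i M M' x].
Proof.
move=> le rp [sb1 sb2] gb st dn.
have sc1 := rebuild_scale Eb st dn.
have d8 : aget M' 8 = upd (aget M 8) i 0 by rewrite sb1 // aget_set_same.
have lE x : x < n -> lvl M' i x = lev b' x.
  by move=> xn; have [e4 _ _ _] := rp.1 x xn.
have capp : 0 < cap i by rewrite addn_gt0 muln_gt0 X0_gt0 expn_gt0.
have sc2 : scale n s (cap i) E (lvl M' i) (prn M' i) (aget M' 8 i) E [::].
  rewrite d8 /= eqxx; apply: scale_ext Eb sn _ sc1 => x xn.
  by have [e4 e5 _ _] := rp.1 x xn.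
split.
- by split; rewrite // d8 /= eqxx muln0.
- split => [c hc|j /negbTE ne|c j hc hj].
  + rewrite sb1; last by move: hc; do 4?[case: c => [|c] //].
    by rewrite aget_set_other //; move: hc; do 4?[case: c => [|c] //].
  + by rewrite d8 /= ne.
  + rewrite sb2 // aget_set_other //; move: hc; rewrite !inE; by move=> /orP[] /eqP ->.
- by move=> x xn; rewrite lE //; exact: le.
- move=> x xn; have [e4 e5 e6 e7] := rp.1 x xn.
  set b0 := fresh_bfs _ _ _ _ _ _ in st.
  have sq : s \in que b0 by rewrite /= inE.
  have [xq|xq] := boolP (x \in que b'); last first.
    have hx : (x \in que b0) || (x \notin que b') by rewrite xq orbT.
    have xs : (x == s) = false by apply/eqP => xs; rewrite xs (steps_que st sq) in xq.
    have [h1 h2 h3 h4] := steps_same st hx.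
    apply: Or31; rewrite /lvl e4 e6 e7 h1 h3 h4 /= xs; split => //; by right.
  have [xs|xs] := eqVneq x s.
    have hx : (s \in que b0) || (s \notin que b') by rewrite sq.
    have [h1 h2 h3 h4] := steps_same st hx.
    by apply: Or33; rewrite /lvl e4 e6 e7 xs h1 h3 h4 /= !eqxx.
  have xq0 : x \notin que b0 by rewrite /= inE.
  have [h1 _ _ _ [h2 h3]] := steps_new st xq xq0.
  apply: Or32; rewrite /lvl e4 e6 e7 h2 h3 /= (negbTE xs); split => //.
  by move: h1; rewrite /= (negbTE xs).
Qed.

End RebuildOk.

Section Update.
Variables (V n s a b q X0 S : nat) (E : seq (nat * nat)) (u v : nat).
Let E' := rcons E (u, v).
Local Notation width := (scale_width X0).
Local Notation cap := (scale_cap X0).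
Local Notation lvl := (level_at n).
Local Notation prn := (parent_at n).
Local Notation core := (core_ok n s a b X0 S).
Local Notation scale_ok := (scale_state n s a b X0).
Local Notation scale_frame := (scale_frame_rel n).
Local Notation best_step := (estimate_step n X0).

Hypotheses (Eb : bounded n E) (sn : s < n) (un : u < n) (vn_ : v < n) (uv : u != v).
Hypotheses (nV : n < V) (slotV : 8 + 2 * size E < V).
Hypotheses (a_gt0 : 0 < a) (ab : a <= b) (X0_gt0 : 0 < X0).
Hypothesis X0_ge : q * q * n * (b * b) <= X0 * X0 * X0 * X0 * (a * a).

Lemma bounded_rcons : bounded n E'.
Proof.
move=> x y; rewrite nb_rcons => /or3P[/Eb //|/andP[/eqP-> /eqP->]|/andP[/eqP-> /eqP->]] //.
Qed.

Section Scale.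
Variables (i : nat) (iV : i <= V) (inV : i * n <= V) (capV : cap i + cap i < V).

Lemma same_but_frame M M' : same_but n (i * n) M M' -> scale_frame i M M'.
Proof.
move=> [h1 h2]; split => [c hc|j _|c j hc hj]; last exact: h2.
- by apply: h1; move: hc; do 4?[case: c => [|c] //].
- by rewrite h1.
Qed.

Lemma local_wp st G F (Q : hst -> Prop) :
  var st vu = u -> var st vv = v -> var st vo = i * n -> var st vi = i ->
  core (mem st) E' -> scale_ok E (mem st) i G F ->
  F = [::] \/ ~ (conn G s u <-> conn G s v) ->
  (forall st' r, (forall z, z \notin [:: vqh; vqt; vx; vl; ve; vy] -> var st' z = var st z) ->
     out st' = out st ->
     clk st' <= clk st + 300 * (\sum_(x <- r) (dg E' x + 1)) + 400 ->
     uniq r -> (forall x, x \in r -> x < n) ->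
     scale_ok E' (mem st') i (rcons G (u, v)) F -> scale_frame i (mem st) (mem st') ->
     (forall x, x \in r -> lvl (mem st') i x < lvl (mem st) i x /\ 0 < dg E' x) ->
     (forall x, x < n -> x \notin r -> lvl (mem st') i x = lvl (mem st) i x) ->
     (~ (conn G s u <-> conn G s v) -> forall x, x \in r -> lvl (mem st) i x = cap i) ->
     (forall x, x < n -> best_step i (mem st) (mem st') x) ->
     Q st') ->
  wp V local_c Q st.
Proof.
case: st => w M ou ck /= hu hv ho hi co [sc debt zF] quiet H.
have lV x : x < n -> lvl M i x < V - 1.
  by move=> xn; have := sc_cap sc xn; move: capV; rewrite /cap; lia.
set b0 := Bfs (lvl M i) (prn M i) (aget M 6) (aget M 7) [::].
have rep0 : rep n (i * n) M b0 by split.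
wseq; wasgn; first by []. wseq; wasgn; first by [].
wseq; wasgn; first by rewrite hu; lia.
wseq; wasgn; first by rewrite ho hu; have := lV u un; rewrite /lvl; lia.
wseq; wasgn; first by rewrite hv; lia.
rewrite ho hu hv.
set b1 := try_push i u (lvl M i u + 1) v b0.
wseq; apply: (@relax_wp V n (i * n) i nV iV b0 u (lvl M i u + 1) v) => //=.
- by have := lV u un; lia.
- by lia.
- by lia.
move=> s1 fr1 o1 c1 q1 r1 sb1.
case: s1 fr1 o1 c1 q1 r1 sb1 => w1 M1 ou1 ck1 /= fr1 o1 c1 q1 r1 sb1.
have lb1 x : x < n -> lev b1 x < V.
  move=> xn; rewrite /b1 /try_push; have := lV u un; have := lV x xn.
  by case: ifP => //= _; try case: eqP; lia.
have [r14 _ _ _] := r1.1 v vn_.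
wseq; wasgn; first by rewrite fr1 //= hv; lia.
wseq; wasgn; first by rewrite !fr1 //= ho hv r14; have := lb1 v vn_; rewrite -/b1; lia.
wseq; wasgn; first by rewrite fr1 //= hu; lia.
rewrite !fr1 //= ho hu hv r14 -/b1.
set b2 := try_push i v (lev b1 v + 1) u b1.
have sz1 : size (que b1) <= 1 by rewrite /b1 /try_push; case: ifP.
wseq; apply: (@relax_wp V n (i * n) i nV iV b1 v (lev b1 v + 1) u) => //=.
- by rewrite fr1.
- by rewrite fr1.
- by have := lb1 v vn_; lia.
- by lia.
- by apply: leq_ltn_trans sz1 _; lia.
move=> s2 fr2 o2 c2 q2 r2 sb2; rewrite -/b2 in q2 r2.
have lb2 x : x < n -> lev b2 x < V.
  move=> xn; rewrite /b2 /try_push; have := lb1 x xn; have := lb1 v vn_; have := lb1 u un.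
  by case: ifP => //= h; try case: eqP; lia.
have sz2 : size (que b2) <= 1.
  rewrite /b2 /b1 /try_push; case: (ltnP (lvl M i u + 1)) => h /=.
    by rewrite eqxx (negbTE uv); case: ifP => //; lia.
  by case: ifP.
have q2n x : x \in que b2 -> x < n.
  rewrite /b2 /try_push; case: ifP => _ /=; rewrite /b1 /try_push; case: ifP => _ //=;
    rewrite ?inE; by [move=> /eqP -> | move=> /orP[] /eqP ->].
have sb12 := same_but_trans sb1 sb2.
apply: (@propagate_wp V n (i * n) i nV iV E' bounded_rcons _ b2) => //.
- by rewrite size_rcons; lia.
- by rewrite fr2 //= fr1.
- by rewrite fr2 //= fr1.
- by rewrite fr2 //= fr1.
- exact: adj_ok_same sb12 (co_adj co).
move=> s3 b3 fr3 o3 c3 r3 sb3 g3 st3 dn3.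
have [L1 L2 L3 L4 L5] := local_update Eb un vn_ uv sc quiet st3 g3 dn3.
have sb : same_but n (i * n) M (mem s3) := same_but_trans sb12 sb3.
have [g3u g3n _] := g3.
apply: (H s3 (que b3)) => //.
- move=> z; rewrite !inE !negb_or => /and5P[h1 h2 h3 h4 /andP[h5 h6]].
  rewrite fr3 ?inE ?negb_or ?h1 ?h2 ?h3 ?h4 ?h5 ?h6 // fr2 //= (negbTE h3) (negbTE h4) (negbTE h6).
  by rewrite fr1 //= (negbTE h1) (negbTE h2) (negbTE h3) (negbTE h4) (negbTE h6).
- by rewrite o3 o2 /= o1.
- by move: c1 c2 c3 => /=; lia.
- have d8 : aget (mem s3) 8 = aget M 8 by case: sb => ->.
  split; [|by rewrite d8|by []].
  rewrite d8; apply: scale_ext (bounded_rcons) sn _ L1 => x xn.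
  by have [e4 e5 _ _] := r3.1 x xn.
- exact: same_but_frame.
- by move=> x xq; have [e4 _ _ _] := r3.1 x (g3n x xq); rewrite /lvl e4; exact: L2.
- by move=> x xn xq; have [e4 _ _ _] := r3.1 x xn; rewrite /lvl e4; have [] := L3 x xq.
- move=> x xn; have [e4 e5 e6 e7] := r3.1 x xn.
  have [xq|xq] := boolP (x \in que b3).
    have [h1 h2] := L4 x xq; have [h3 _] := L2 x xq.
    apply: Or32; rewrite /lvl e6 e7 e4 h1 h2; split => //.
    by apply: leq_trans h3 (sc_cap sc xn).
  have [h1 h2 h3] := L3 x xq.
  by apply: Or31; rewrite /lvl e6 e7 e4 h1 h2 h3; split => //; left.
Qed.


Definition level_sum (M : nat -> nat) : nat := \sum_(x < n) lvl M i x.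

(** This is what caps of twice the width are for: a node at distance less than the width stays below
    the cap even when the debt is added. *)
Lemma debt_le D : 2 * b * D <= a * width i -> D <= width i.
Proof.
move=> h; have bp : 0 < b := leq_trans a_gt0 ab.
have : 2 * b * D <= b * width i by apply: leq_trans h _; rewrite leq_mul2r ab orbT.
by rewrite [2 * b]mulnC -mulnA leq_pmul2l //; apply: leq_trans; rewrite leq_pmull.
Qed.

(** Here r is 1 when the scale is rebuilt and 0 otherwise. In the last inequality a rebuild is worth
    q n X; it is paid, with factor 8 X0, by n X for each pending edge it clears and by q times the
    fall of the level sum. *)
Lemma lazy_wp st G F (Q : hst -> Prop) : 0 < i ->
  var st vu = u -> var st vv = v -> var st vo = i * n -> var st vi = i ->
  var st vX = width i ->
  core (mem st) E' -> scale_ok E (mem st) i G F ->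
  (conn E s u <-> conn E s v) ->
  (forall st' G' F' r,
     (forall z, z \notin [:: vqh; vqt; vx; vl; ve; vy; vd] -> var st' z = var st z) ->
     out st' = out st -> r <= 1 ->
     clk st' <= clk st + 500 + 2000 * (r * (size E' + 1)) ->
     scale_ok E' (mem st') i G' F' -> scale_frame i (mem st) (mem st') ->
     (forall x, x < n -> lvl (mem st') i x <= lvl (mem st) i x) ->
     (forall x, x < n -> best_step i (mem st) (mem st') x) ->
     r * (q * n * width i) +
       8 * X0 * (n * width i * size F' + q * level_sum (mem st')) <=
       8 * X0 * (n * width i * (size F + 1) + q * level_sum (mem st)) ->
     Q st') ->
  wp V lazy_c Q st.
Proof.
case: st => w M ou ck /= i0 hu hv ho hi hX co [sc debt zF] cuv H.
set D' := aget M 8 i + exc (lvl M i) (u, v).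
have DX := debt_le debt.
have lu := sc_cap sc un; have lv := sc_cap sc vn_.
have D'V : D' <= V.
  rewrite /D' /exc /=; move: DX lu lv capV; rewrite /cap; lia.
wseq; wasgn; first by rewrite hu hv ho hi.
rewrite hu hv ho hi.
have -> : aget M 8 i + (aget M 4 (i * n + u) - aget M 4 (i * n + v) - 1 +
    (aget M 4 (i * n + v) - aget M 4 (i * n + u) - 1)) = D' by [].
set M1 := aset M 8 i D'.
have M1a c : c < 10 -> c != 8 -> aget M1 c = aget M c.
  by move=> hc c8; rewrite /M1 aget_set_other.
have l1 : lvl M1 i = lvl M i by rewrite /lvl M1a.
have p1 : prn M1 i = prn M i by rewrite /prn M1a.
have d1 : aget M1 8 i = D' by rewrite /M1 aget_set // !eqxx.
have fr1 : scale_frame i M M1.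
  split => [c hc|j /negbTE ne|c j hc _].
  - by rewrite M1a //; move: hc; do 4?[case: c => [|c] //].
  - by rewrite /M1 aget_set // ne andbF.
  - by rewrite M1a //; move: hc; rewrite !inE; move=> /orP[] /eqP ->.
have bs1 x : best_step i M M1 x.
  by apply: Or31; rewrite !M1a // l1; split => //; left.
have GE : {subset G <= E} by move=> z h; rewrite (sc_mem sc) mem_cat h.
(* If both ends lie outside the component of s, they sit at the cap and the excess is 0. The edge
   then joins [G], as [sc_conn] admits into [F] only edges within the component. *)
have [cu|ncu] := EM (conn G s u); last first.
  have ncv : ~ conn G s v.
    move=> /(conn_sub GE)/(cuv.2) h; apply: ncu; exact: (scale_conn_sub sc h).
  have un_lvl x : x < n -> ~ conn G s x -> lvl M i x = cap i.
    move=> xn nx; apply/eqP; rewrite eqn_leq (sc_cap sc xn) leqNgt; apply/negP => lt.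
    by apply: nx; apply: (scale_conn_sub sc); apply: (scale_reached Eb sc xn lt).
  have D'E : D' = aget M 8 i by rewrite /D' /exc /= !un_lvl // subnn !addn0.
  have sc' : scale n s (cap i) E' (lvl M i) (prn M i) D' (rcons G (u, v)) F.
    by rewrite D'E; apply: (local_noop sc (a := u) (c := v)); rewrite ?eqxx ?un_lvl //; lia.
  apply: wp_if => /=; rewrite hX (co_a co) (co_b co).
    by move=> h; exfalso; move: h; case: ltnP => //; rewrite D'E; lia.
  move=> _; wstore; first by [].
  rewrite hi; apply: (H _ (rcons G (u, v)) F 0) => //=.
  - move=> z; rewrite !inE !negb_or => /and5P[_ _ _ _ /and3P[_ _ h]].
    by rewrite (negbTE h).
  - lia.
  - by split => //; rewrite -/M1 ?l1 ?p1 ?d1 // D'E.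
  - by move=> x xn; rewrite -/M1 l1.
  - rewrite -/M1 /level_sum l1 mul0n add0n leq_mul2l leq_add2r leq_mul2l; lia.
have cv : conn G s v.
  by apply: (scale_conn_sub sc); apply/cuv; exact: conn_sub GE cu.
have sc' : scale n s (cap i) E' (lvl M i) (prn M i) D' G (rcons F (u, v)).
  by apply: (pending_edge sc (a := u) (c := v)); rewrite ?eqxx.
apply: wp_if => /=; rewrite hX (co_a co) (co_b co); last first.
  move=> h; have le : 2 * b * D' <= a * width i by move: h; case: ltnP.
  wstore; first by [].
  rewrite hi; apply: (H _ G (rcons F (u, v)) 0) => //=.
  - move=> z; rewrite !inE !negb_or => /and5P[_ _ _ _ /and3P[_ _ h']].
    by rewrite (negbTE h').
  - lia.
  - split => //; rewrite -/M1 ?l1 ?p1 ?d1 //.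
    by move=> i00; rewrite i00 in i0.
  - by move=> x xn; rewrite -/M1 l1.
  - by rewrite -/M1 /level_sum l1 mul0n add0n size_rcons addn1.
move=> h; have lt : a * width i < 2 * b * D' by move: h; case: ltnP.
wseq; wstore; first by [].
rewrite hi; set M0 := aset M 8 i 0.
have M0a c : c < 10 -> c != 8 -> aget M0 c = aget M c.
  by move=> hc c8; rewrite /M0 aget_set_other.
apply: (@rebuild_wp V n (i * n) i s (width i) E' bounded_rcons sn nV iV _ _) => //=.
- by rewrite size_rcons; lia.
- by move: capV; rewrite /cap; lia.
- by have [e5 e6] := co_edges co; split => *; rewrite M0a ?e5 ?e6.
- by move=> x xn; have [ls hls] := co_adj co xn; exists ls; rewrite !M0a.
- by rewrite M0a // (co_s co).
- move=> x xn xs; rewrite M0a //; have [ge|ltx] := leqP (cap i) (lvl M i x).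
    by right; apply/eqP; rewrite eqn_leq (sc_cap sc xn) ge.
  by left; have [t1 _] := sc_tree sc' xn xs ltx; exact: dg_gt0 t1.
move=> st' b' fr' o' c' r' sb' gb' s' dn'.
have s'' : steps E' i (fresh_bfs i s (width i) (prn M i) (aget M 6) (aget M 7)) b'.
  by move: s'; rewrite !M0a.
have sc0 : scale n s (cap i) E' (lvl M1 i) (prn M1 i) (aget M1 8 i) G (rcons F (u, v)).
  by rewrite l1 p1 d1.
have M01 : M0 = aset M1 8 i 0.
  apply: funext => j; rewrite /M0 /M1 /aset /=; by case: eqP.
have co1 : core M1 E'.
  case: co => ? ? ? ? ? ? ? [e5 e6] ad; split; rewrite ?M1a //.
    by split => *; rewrite M1a ?e5 ?e6.
  by move=> x xn; have [ls hls] := ad x xn; exists ls; rewrite !M1a.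
have [R1 R2 R3 R4] : [/\ scale_ok E' (mem st') i E' [::], scale_frame i M1 (mem st'),
      forall x, x < n -> lvl (mem st') i x <= lvl M1 i x &
      forall x, x < n -> best_step i M1 (mem st') x].
  have st'' : steps E' i (fresh_bfs i s (width i) (prn M1 i) (aget M1 6) (aget M1 7)) b'.
    by rewrite p1 !M1a.
  apply: (rebuild_ok a b bounded_rcons sn X0_gt0 _ r' _ gb' st'' dn'); last by rewrite -M01.
  exact: (rebuilt_le bounded_rcons bounded_rcons (fun z h => h) sc0 (rebuild_scale bounded_rcons st'' dn')).
rewrite l1 in R3.
apply: (H st' E' [::] 1) => //.
- move=> z; rewrite !inE !negb_or => /and5P[h1 h2 h3 h4 /and3P[h5 h6 h7]].
  by rewrite fr' ?inE ?negb_or ?h1 ?h2 ?h3 ?h4 ?h5 ?h6 //= (negbTE h7).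
- by move: c'; rewrite mul1n; lia.
- case: fr1 => f1 f2 f3; case: R2 => g1 g2 g3; split => [c hc|j ne|c j hc hj].
  + by rewrite g1 ?f1.
  + by rewrite g2 ?f2.
  + by rewrite g3 ?f3.
- by move=> x xn; have := R4 x xn; rewrite /estimate_step l1 !M1a.
have Dp : 0 < \sum_(e <- rcons F (u, v)) exc (lvl M i) e.
  by rewrite -(sc_debt sc'); move: lt; case: (D') => //; rewrite muln0.
have [e eF he] := max_exc Dp; rewrite -(sc_debt sc') in he.
have [sc2 _ _] := R1.
have d20 : aget (mem st') 8 i = 0 by rewrite (sc_debt sc2) big_nil.
rewrite d20 in sc2; have pd := rebuild_drop bounded_rcons sc' sc2 eF.
rewrite mul1n /= muln0 add0n.
have -> : size F + 1 = size (rcons F (u, v)) by rewrite size_rcons addn1.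
apply: rebuild_amortized lt he pd => //; last by lia.
by rewrite leq_pmulr // expn_gt0.
Qed.

Variable f : nat -> nat.
Hypothesis dg_f : forall x, dg E' x <= f x.

(** A potential that pays for the searches attaching a component. Later [f] is the degree in the
    final graph, so that the weights stay fixed while edges arrive. *)
Definition unreached_weight (M : nat -> nat) : nat :=
  \sum_(x < n) f x * (lvl M i x == cap i).

(** The Even-Shiloach potential: each scan of a node is paid by the fall of its level. *)
Definition level_weight (M : nat -> nat) : nat := \sum_(x < n) f x * lvl M i x.

Lemma sum_uniq_le (r : seq nat) (g : nat -> nat) : uniq r ->
  (forall x, x \in r -> x < n) ->
  \sum_(x <- r) g x <= \sum_(x < n) (val x \in r) * g x.
Proof.
move=> ur hr; rewrite -(big_mkord xpredT (fun x => (x \in r) * g x)).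
rewrite big_seq_cond /index_iota subn0.
rewrite (eq_bigr (fun x => (x \in r) * g x)); last by move=> x /andP[->]; rewrite mul1n.
rewrite -big_seq_cond; apply: uniq_sub_le_big => //.
- by move=> ? ?; rewrite leq_addr.
- exact: iota_uniq.
- by move=> x /hr; rewrite mem_iota.
Qed.

(** The cost is split by its source: [us] for scans of newly attached nodes, [ws] for scans in the
    exact tree, [r] for a rebuild. Each is charged to a potential of its own. *)
Lemma update_wp st G F sm (Q : hst -> Prop) :
  var st vu = u -> var st vv = v -> var st vn = n -> var st vi = i ->
  var st vX = width i -> var st vsame = sm ->
  (sm = 0 <-> ~ (conn E s u <-> conn E s v)) ->
  core (mem st) E' -> scale_ok E (mem st) i G F ->
  (forall st' G' F' r us ws,
     (forall z, z \notin [:: vo; vqh; vqt; vx; vl; ve; vy; vd] -> var st' z = var st z) ->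
     out st' = out st -> r <= 1 -> (0 < i -> ws = 0) ->
     clk st' <= clk st + 1000 + 2000 * (us + ws + r * (size E' + 1)) ->
     scale_ok E' (mem st') i G' F' -> scale_frame i (mem st) (mem st') ->
     (forall x, x < n -> lvl (mem st') i x <= lvl (mem st) i x) ->
     (forall x, x < n -> best_step i (mem st) (mem st') x) ->
     unreached_weight (mem st') + us <= unreached_weight (mem st) ->
     level_weight (mem st') + ws <= level_weight (mem st) ->
     r * (q * n * width i) +
       8 * X0 * (n * width i * size F' + q * level_sum (mem st')) <=
       8 * X0 * (n * width i * (size F + 1) + q * level_sum (mem st)) ->
     Q st') ->
  wp V update_c Q st.
Proof.
case: st => w M ou ck /= hu hv hn hi hX hs hsm co so H.
have mono_U M' : (forall x, x < n -> lvl M' i x <= lvl M i x) ->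
    (forall x, x < n -> lvl M i x <= cap i) ->
    unreached_weight M' <= unreached_weight M.
  move=> le lc; apply: leq_sum => x _; rewrite leq_mul2l; apply/orP; right.
  have := le x (ltn_ord x); have := lc x (ltn_ord x).
  by case: eqP => [->|//] h1 h2; rewrite eqn_leq h1 h2.
have mono_W M' : (forall x, x < n -> lvl M' i x <= lvl M i x) ->
    level_weight M' <= level_weight M.
  by move=> le; apply: leq_sum => x _; rewrite leq_mul2l le ?orbT.
have mono_P M' : (forall x, x < n -> lvl M' i x <= lvl M i x) ->
    level_sum M' <= level_sum M.
  by move=> le; apply: leq_sum => x _; exact: le.
have [sc debt zF] := so.
have lc x : x < n -> lvl M i x <= cap i := @sc_cap _ _ _ _ _ _ _ _ _ sc x.
have GE : {subset G <= E} by move=> z h; rewrite (sc_mem sc) mem_cat h.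
have cG x : conn G s x <-> conn E s x.
  by split=> h; [exact: conn_sub GE h | exact: (scale_conn_sub sc h)].
wseq; wasgn; first by rewrite hi hn.
rewrite hi hn; apply: wp_if => /=; rewrite hi hs => hc; last first.
  have {}hc : 0 < i * sm by move: hc; case: ltnP => //; lia.
  have i0 : 0 < i by move: hc; case: (i).
  have cuv : conn E s u <-> conn E s v.
    by apply: contrapT => h; move/hsm: h => h; rewrite h muln0 in hc.
  apply: (@lazy_wp _ G F) => //= st' G' F' r fr o' r1 c' so' sf le bs am.
  apply: (H st' G' F' r 0 0) => //.
  - move=> z; rewrite !inE !negb_or => /and5P[h1 h2 h3 h4 /and4P[h5 h6 h7 h8]].
    by rewrite fr ?inE ?negb_or ?h2 ?h3 ?h4 ?h5 ?h6 ?h7 ?h8 //= (negbTE h1).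
  - by move: c'; rewrite /tick /= !add0n; lia.
  - by rewrite addn0; exact: mono_U.
  - by rewrite addn0; exact: mono_W.
have qt : F = [::] \/ ~ (conn G s u <-> conn G s v).
  have [i0|ip] := posnP i; [by left; exact: zF | right].
  have sm0 : sm = 0 by move: hc; case: ltnP => //; nia.
  by move/hsm: sm0 => h h'; apply: h; split=> /cG/h'/cG.
apply: (@local_wp _ G F) => //= st' r fr o' c' ur rn so' sf dr eqr att bs.
have le x : x < n -> lvl (mem st') i x <= lvl M i x.
  move=> xn; have [xr|xr] := boolP (x \in r); first by have [/ltnW] := dr x xr.
  by rewrite eqr.
set fs := \sum_(x < n) (val x \in r) * f x.
have cs : \sum_(x <- r) (dg E' x + 1) <= 2 * fs.
  have h1 : \sum_(x <- r) (dg E' x + 1) <= \sum_(x <- r) 2 * f x.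
    rewrite big_seq [X in _ <= X]big_seq; apply: leq_sum => x xr.
    by have [_] := dr x xr; have := dg_f x; lia.
  apply: leq_trans h1 _; rewrite -big_distrr /= leq_mul2l /=.
  exact: sum_uniq_le.
have WW : level_weight (mem st') + fs <= level_weight M.
  rewrite /level_weight /fs -big_split /=; apply: leq_sum => x _.
  have [xr|xr] := boolP (val x \in r); last by rewrite addn0 leq_mul2l le ?orbT.
  have [h _] := dr x xr; rewrite mul1n -mulnSr leq_mul2l; by apply/orP; right.
have frv z : z \notin [:: vo; vqh; vqt; vx; vl; ve; vy; vd] -> var st' z = w z.
  rewrite !inE !negb_or => /and5P[h1 h2 h3 h4 /and4P[h5 h6 h7 h8]].
  by rewrite fr ?inE ?negb_or ?h2 ?h3 ?h4 ?h5 ?h6 ?h7 //= (negbTE h1).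
have am : 0 * (q * n * width i) +
       8 * X0 * (n * width i * size F + q * level_sum (mem st')) <=
       8 * X0 * (n * width i * (size F + 1) + q * level_sum M).
  rewrite mul0n add0n leq_mul2l; apply/orP; right; apply: leq_add.
    by rewrite leq_mul2l leq_addr orbT.
  by rewrite leq_mul2l mono_P ?orbT.
have [i0|ip] := posnP i.
  apply: (H st' (rcons G (u, v)) F 0 0 fs) => //.
  - by rewrite i0.
  - by move: c'; rewrite /tick /=; lia.
  - by rewrite addn0; exact: mono_U.
have sm0 : sm = 0 by move: hc; case: ltnP => //; nia.
apply: (H st' (rcons G (u, v)) F 0 fs 0) => //.
- by move: c'; rewrite /tick /=; lia.
- rewrite /unreached_weight /fs -big_split /=; apply: leq_sum => x _.
  have [xr|xr] := boolP (val x \in r); last by rewrite addn0 eqr.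
  have [h _] := dr x xr; rewrite mul1n att //.
    rewrite eqxx muln1; have -> : (lvl (mem st') i x == cap i) = false.
      by apply/eqP => e; have := lc x (ltn_ord x); lia.
    by rewrite muln0.
  by move/hsm: sm0 => h1 h2; apply: h1; split=> /cG/h2/cG.
- by rewrite addn0; exact: mono_W.
Qed.

End Scale.
End Update.

(** Whether the edge attaches a component is read off the estimates before any scale changes: by
    [best_conn], an estimate below [no_estimate] characterises connection to s. *)
Definition insert_c : prog :=
  PAsgn vn (EArr 0 (EConst 0)) ;;
  PAsgn vsame (EBin OEq (EArr 6 (EVar vu) $< EArr 1 (EConst 2))
                        (EArr 6 (EVar vv) $< EArr 1 (EConst 2))) ;;
  add_edge_c ;;
  PAsgn vi (EConst 0) ;;
  PAsgn vX (EArr 1 (EConst 1)) ;;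
  PWhile (EVar vi $< EArr 1 (EConst 0))
    (update_c ;;
     PAsgn vi (EVar vi $+ EConst 1) ;;
     PAsgn vX (EVar vX $+ EVar vX)).

(** * Quality of the estimates and amortised cost of an insertion *)

Section Insert.
Variables (V n s a b q X0 S : nat).
Local Notation width := (scale_width X0).
Local Notation cap := (scale_cap X0).
Local Notation lvl := (level_at n).
Local Notation core := (core_ok n s a b X0 S).
Local Notation scale_ok := (scale_state n s a b X0).
Local Notation scale_frame := (scale_frame_rel n).
Local Notation best_ok := (estimates_ok n X0 S).
Local Notation inf := (no_estimate X0 S).
Local Notation potential := (level_sum n).

Hypotheses (sn : s < n) (nV : n < V) (S_gt0 : 0 < S) (SV : S <= V) (SnV : S * n <= V).
Hypothesis capV : forall i, i < S -> cap i + cap i < V.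
Hypotheses (a_gt0 : 0 < a) (ab : a <= b) (X0_gt0 : 0 < X0).
Hypothesis X0_ge : q * q * n * (b * b) <= X0 * X0 * X0 * X0 * (a * a).
Hypothesis n_width : n <= width S.-1.

Definition scales_ok (E : seq (nat * nat)) (M : nat -> nat) (fs : nat -> nat) :=
  forall i, i < S -> exists G F, scale_ok E M i G F /\ size F = fs i.

Definition inv (E : seq (nat * nat)) (M : nat -> nat) (fs : nat -> nat) : Prop :=
  [/\ core M E, scales_ok E M fs & best_ok S M].

Lemma cap_le_inf i : i < S -> cap i <= inf.
Proof.
move=> iS; rewrite /no_estimate /scale_cap /scale_width.
have h : 2 ^ i <= 2 ^ S.-1 by rewrite leq_exp2l //; lia.
by rewrite leq_add // leq_mul2l h orbT.
Qed.

Section Estimates.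
Variables (E : seq (nat * nat)) (M fs : nat -> nat).
Hypotheses (Eb : bounded n E) (iv : inv E M fs).

(** Take the least scale wider than the length d of the path. For i > 0 minimality gives d >= X / 2,
    so the debt (a / b) X / 2 is at most (a / b) d; at scale 0 there is no debt. *)
Lemma path_scale v p : v < n -> path (nb E) v p -> last v p = s -> uniq (v :: p) ->
  exists i, [/\ i < S, lvl M i v < cap i & b * lvl M i v <= (a + b) * size p].
Proof.
move=> hv hp hl up; have [_ sok _] := iv.
have pn : size p < n.
  have : size (v :: p) <= size (iota 0 n).
    apply: uniq_leq_size => // z; rewrite mem_iota inE => /orP[/eqP -> //|].
    elim: (p) (v) hp => //= y r IH x /andP[xy hr]; rewrite inE => /orP[/eqP ->|].
      by case: (Eb xy).
    exact: IH hr.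
  by rewrite size_iota.
have ex : exists i, size p < width i by exists S.-1; exact: leq_trans pn n_width.
case: (ex_minnP ex) => i hi mini.
have iS : i < S by have := mini S.-1 (leq_trans pn n_width); lia.
have [G [F [[sc debt zF] _]]] := sok i iS; exists i; split => //.
- have h := scale_path sc hp hl; apply: leq_ltn_trans h _.
  by have := debt_le a_gt0 ab debt; rewrite /scale_cap; lia.
have h := scale_path sc hp hl.
case: i hi mini iS sc debt zF h => [|i] hi mini iS sc debt zF h.
  move: h; rewrite (sc_debt sc) zF // big_nil addn0 => h.
  by apply: leq_mul => //; lia.
have wi : width i <= size p by rewrite leqNgt; apply/negP => /mini; rewrite ltnn.
have w2 : width i.+1 = 2 * width i by rewrite /scale_width expnS mulnCA.
have h2 : b * aget M 8 i.+1 <= a * width i.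
  by move: debt; rewrite w2 mulnCA -mulnA leq_pmul2l.
have h3 : b * lvl M i.+1 v <= b * (size p + aget M 8 i.+1) by rewrite leq_mul2l h orbT.
have h4 : a * width i <= a * size p by rewrite leq_mul2l wi orbT.
by apply: leq_trans h3 _; rewrite mulnDr mulnDl addnC leq_add2r; lia.
Qed.

Lemma best_le v p : v < n -> path (nb E) v p -> last v p = s ->
  aget M 6 v < inf /\ b * aget M 6 v <= (a + b) * size p.
Proof.
move=> hv hp hl; move: hl; have [p' hp' up sub] := shortenP hp => hl.
have [i [iS lt le]] := path_scale hv hp' hl up.
have [_ _ bo] := iv; have [b1 _] := bo v hv; have b1i := b1 i iS lt.
split; first by apply: leq_ltn_trans b1i (leq_trans lt (cap_le_inf iS)).
have h : b * aget M 6 v <= b * lvl M i v by rewrite leq_mul2l b1i orbT.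
apply: leq_trans h (leq_trans le _); rewrite leq_mul2l; apply/orP; right.
by apply: uniq_leq_size => //; case/andP: up.
Qed.

Lemma best_path v : v < n -> aget M 6 v < inf ->
  let i := aget M 7 v in let p := traject (parent_at n M i) (parent_at n M i v) (aget M 6 v) in
  [/\ i < S, path (nb E) v p, last v p = s & uniq (v :: p)] /\
  forall z, z \in p -> z < n.
Proof.
move=> hv lt; have [_ sok bo] := iv; have [_ b2] := bo v hv.
case: b2 => [e|[h1 h2 h3]]; first by rewrite e ltnn in lt.
have [G [F [[sc _ _] _]]] := sok _ h1.
have ltc : aget M 6 v < cap (aget M 7 v) by rewrite h2.
have [t1 t2 t3 t4] := scale_traject Eb sc hv (esym h2) ltc.
by split=> // z /t4[].
Qed.

Lemma best_conn v : v < n -> (conn E s v <-> aget M 6 v < inf).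
Proof.
move=> hv; split=> [[p hp hl]|lt]; first by have [] := best_le hv hp hl.
by have [[_ h1 h2 _] _] := best_path hv lt; eexists; eassumption.
Qed.

End Estimates.

Lemma core_frame E i M M' : core M E -> scale_frame i M M' -> core M' E.
Proof.
move=> [? ? ? ? ? ? ? [e5 e6] ad] [fr _ _]; split; rewrite ?fr //.
  by split => *; rewrite fr ?e5 ?e6.
by move=> x xn; have [ls hls] := ad x xn; exists ls; rewrite !fr.
Qed.

Lemma scale_ok_frame E i j M M' G F : bounded n E -> scale_frame i M M' -> j != i ->
  scale_ok E M j G F -> scale_ok E M' j G F.
Proof.
move=> Eb fr ne [sc debt zF]; have d8 : aget M' 8 j = aget M 8 j.
  by case: fr => _ -> .
split; rewrite ?d8 //; apply: scale_ext Eb sn _ sc => x xn.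
exact: frame_lvl fr ne xn.
Qed.

Section Step.
Variables (E : seq (nat * nat)) (u v : nat).
Let E' := rcons E (u, v).
Hypotheses (Eb : bounded n E) (un : u < n) (vn_ : v < n) (uv : u != v).
Hypothesis slotV : 8 + 2 * size E < V.
Variable f : nat -> nat.
Hypothesis dg_f : forall x, dg E' x <= f x.

Definition weight (M : nat -> nat) (j : nat) : nat :=
  unreached_weight n X0 j f M + (j == 0) * level_weight n j f M.

Lemma same_lvl_weight M M' j : (forall x, x < n -> lvl M' j x = lvl M j x) ->
  weight M' j = weight M j /\ potential j M' = potential j M.
Proof.
move=> h; rewrite /weight /unreached_weight /level_weight /level_sum.
have e1 : \sum_(x < n) f x * (lvl M' j x == cap j) = \sum_(x < n) f x * (lvl M j x == cap j).
  by apply: eq_bigr => x _; rewrite h.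
have e2 : \sum_(x < n) f x * lvl M' j x = \sum_(x < n) f x * lvl M j x.
  by apply: eq_bigr => x _; rewrite h.
by rewrite e1 e2; split => //; apply: eq_bigr => x _; rewrite h.
Qed.

(* [r i] counts the rebuilds of scale i and [fs i] its pending edges. *)
Definition amortized (M M' : nat -> nat) (fs fs' r : nat -> nat) (i : nat) : Prop :=
  r i * (q * n * width i) +
    8 * X0 * (n * width i * fs' i + q * potential i M') <=
    8 * X0 * (n * width i * (fs i + 1) + q * potential i M).

(** The sums range over the scales still to be processed. The facts about scales j < i let the
    caller keep what it knows about a scale already updated. *)
Lemma scales_wp k i st sm fs (Q : hst -> Prop) : i + k = S ->
  var st vu = u -> var st vv = v -> var st vn = n -> var st vi = i ->
  var st vX = width i -> var st vsame = sm ->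
  (sm = 0 <-> ~ (conn E s u <-> conn E s v)) ->
  core (mem st) E' -> best_ok S (mem st) ->
  (forall j, i <= j < S -> exists G F, scale_ok E (mem st) j G F /\ size F = fs j) ->
  (forall st' fs' r, out st' = out st ->
     clk st' + 2000 * \sum_(i <= j < S) weight (mem st') j <=
       clk st + 2000 * \sum_(i <= j < S) weight (mem st) j + 1100 * (k + 1) +
       2000 * (size E' + 1) * \sum_(i <= j < S) r j ->
     core (mem st') E' -> best_ok S (mem st') ->
     (forall j, i <= j < S -> (exists G F, scale_ok E' (mem st') j G F /\ size F = fs' j)
        /\ amortized (mem st) (mem st') fs fs' r j) ->
     (forall j G F, j < i -> scale_ok E' (mem st) j G F -> scale_ok E' (mem st') j G F) ->
     (forall j x, j < i -> x < n -> lvl (mem st') j x = lvl (mem st) j x) ->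
     Q st') ->
  wp V (PWhile (EVar vi $< EArr 1 (EConst 0))
    (update_c ;; PAsgn vi (EVar vi $+ EConst 1) ;; PAsgn vX (EVar vX $+ EVar vX))) Q st.
Proof.
elim: k i st fs Q => [|k IH] i st fs Q ik hu hv hn hi hX hs hsm co bo sok H;
  apply: wp_while => /=; rewrite hi (co_S co).
- move=> _; apply: (H _ fs (fun _ => 0)) => //=.
  + have iS : S <= i by lia.
    by rewrite !big_geq; lia.
  + by move=> j; lia.
- by move=> h; exfalso; move: h; case: ltnP => //; lia.
- by move=> h; exfalso; move: h; case: ltnP => //; lia.
move=> _; have iS : i < S by lia.
have [|G [F [so szF]]] := sok i; first by rewrite leqnn iS.
have ii : i <= V by lia.
have inV : i * n <= V by apply: leq_trans SnV; rewrite leq_mul2r ltnW ?orbT.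
have cV := capV iS.
wseq; apply: (@update_wp V n s a b q X0 S E u v Eb sn un vn_ uv nV slotV a_gt0 ab X0_gt0 X0_ge
  i ii inV cV f dg_f _ G F sm) => //.
move=> s1 G' F' r us ws fr1 o1 r1 w0 c1 so1 sf1 le1 bs1 U1 W1 am1.
have co1 : core (mem s1) E'.
  exact: (core_frame co sf1).
have bo1 : best_ok S (mem s1).
  by apply: (@best_update n X0 S S S i _ _ bo _ sf1 le1 bs1); left.
case: s1 fr1 o1 c1 so1 sf1 le1 bs1 U1 W1 am1 co1 bo1 =>
  w1 M1 ou1 ck1 /= fr1 o1 c1 so1 sf1 le1 bs1 U1 W1 am1 co1 bo1.
wseq; wasgn; first by rewrite fr1 //= hi; lia.
wasgn; first by rewrite fr1 //= hX; move: cV; rewrite /scale_cap; lia.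
rewrite !fr1 //= hi hX.
have oth j x : j != i -> x < n -> lvl M1 j x = lvl (mem st) j x.
  by move=> ne xn; have [] := frame_lvl sf1 ne xn.
apply: (IH i.+1 _ fs) => //=; rewrite ?fr1 //; try lia.
- by rewrite addnn -mul2n /scale_width expnS mulnCA.
- move=> j hj; have [|G2 [F2 [so2 sz2]]] := sok j; first by lia.
  exists G2, F2; split => //; apply: scale_ok_frame Eb sf1 _ so2; lia.
move=> s2 fs2 r2 o2 c2 co2 bo2 ok2 keep2 same2.
have sm2 x : x < n -> lvl (mem s2) i x = lvl M1 i x by exact: same2.
have [we2 po2] := same_lvl_weight sm2.
have bw : weight M1 i + us + ws <= weight (mem st) i.
  rewrite /weight; have [i0|ip] := posnP i; first by rewrite !mul1n; lia.
  by rewrite w0 //; lia.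
have os : \sum_(i.+1 <= j < S) weight M1 j = \sum_(i.+1 <= j < S) weight (mem st) j.
  apply: eq_big_nat => j hj.
  by have [] : weight M1 j = weight (mem st) j /\ potential j M1 = potential j (mem st)
    by apply: same_lvl_weight => x xn; apply: oth => //; lia.
apply: (H s2 (fun j => if j == i then size F' else fs2 j) (fun j => if j == i then r else r2 j)) => //.
- by rewrite o2.
- rewrite ![\sum_(i <= j < S) _]big_ltn // eqxx we2.
  have -> : \sum_(i.+1 <= j < S) (if j == i then r else r2 j) = \sum_(i.+1 <= j < S) r2 j.
    by apply: eq_big_nat => j hj; case: eqP => // ?; lia.
  rewrite os in c2.
  have -> : 2000 * (size E' + 1) * (r + \sum_(i.+1 <= j < S) r2 j) =
      2000 * (r * (size E' + 1)) + 2000 * (size E' + 1) * \sum_(i.+1 <= j < S) r2 j.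
    by rewrite mulnDr [r * _]mulnC mulnA.
  move: c1 c2 bw; rewrite /tick /=.
  set T1 := \sum_(_ <= _ < _) weight (mem s2) _.
  set T2 := \sum_(_ <= _ < _) weight (mem st) _.
  set T3 := _ * \sum_(_ <= _ < _) r2 _; set P := r * _.
  move: T1 T2 T3 P (weight M1 i) (weight (mem st) i) (clk s2) (clk st); clear; lia.
- move=> j hj; have [->|ne] := eqVneq j i.
    split; first by exists G', F'; split => //; exact: keep2.
    by rewrite /amortized eqxx po2 -szF; exact: am1.
  have [|h1 h2] := ok2 j; first by lia.
  split => //; move: h2; rewrite /amortized (negbTE ne).
  have [_ ->] // : weight M1 j = weight (mem st) j /\ potential j M1 = potential j (mem st).
  by apply: same_lvl_weight => x xn; apply: oth.
- move=> j G2 F2 ji so2; apply: keep2; first by lia.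
  by apply: scale_ok_frame (bounded_rcons Eb un vn_) sf1 _ so2; lia.
- move=> j x ji xn; rewrite same2 ?oth //; lia.
Qed.

Lemma insert_wp st fs (Q : hst -> Prop) :
  var st vu = u -> var st vv = v -> inv E (mem st) fs ->
  (forall st' fs' r, out st' = out st ->
     clk st' + 2000 * \sum_(0 <= j < S) weight (mem st') j <=
       clk st + 2000 * \sum_(0 <= j < S) weight (mem st) j + 1500 * (S + 1) +
       2000 * (size E' + 1) * \sum_(0 <= j < S) r j ->
     inv E' (mem st') fs' ->
     (forall j, j < S -> amortized (mem st) (mem st') fs fs' r j) ->
     Q st') ->
  wp V insert_c Q st.
Proof.
case: st => w M ou ck /= hu hv iv H; have [co sok bo] := iv.
wseq; wasgn; first by rewrite (co_n co); lia.
wseq; wasgn; first by case: (_ == _) => //=; lia.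
rewrite hu hv (co_n co) (co_inf co).
set sm := ((_ == _) : nat).
have hsm : sm = 0 <-> ~ (conn E s u <-> conn E s v).
  rewrite !(best_conn Eb iv) // /sm.
  by case: (aget M 6 u < inf); case: (aget M 6 v < inf) => /=; split => //;
    try (move=> h; exfalso; apply: h; split); try (by move=> _ [h1 h2]; have := h1 isT);
    try (by move=> _ [h1 h2]; have := h2 isT).
wseq; apply: (@add_edge_wp V n E u v un vn_ uv (ltnW slotV) nV) => //=.
- exact: co_edges co.
- exact: co_adj co.
move=> s1 fr1 o1 c1 ed1 ad1 a1 j1.
case: s1 fr1 o1 c1 ed1 ad1 a1 j1 => w1 M1 ou1 ck1 /= fr1 o1 c1 ed1 ad1 a1 j1.
have co1 : core M1 E'.
  by case: co => *; split=> //; (by rewrite j1) || (by rewrite a1).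
have lv1 j : lvl M1 j = lvl M j by rewrite /level_at a1.
wseq; wasgn; first by [].
wseq; wasgn.
  by rewrite (co_X co1); have := capV S_gt0; rewrite /scale_cap /scale_width expn0; lia.
rewrite (co_X co1).
apply: (@scales_wp S 0 _ sm fs) => //=; try by rewrite fr1.
- by rewrite /scale_width expn0 muln1.
- by move: bo; rewrite /estimates_ok /level_at !a1.
- move=> j hj; have [G [F [[sc debt zF] sz]]] := sok j hj; exists G, F; split => //.
  by split; rewrite ?a1 // lv1 /parent_at a1.
move=> s2 fs2 r2 o2 c2 co2 bo2 ok2 _ _; apply: (H s2 fs2 r2) => //.
- by rewrite o2 o1.
- have -> : \sum_(0 <= j < S) weight M j = \sum_(0 <= j < S) weight M1 j.
    apply: eq_big_nat => j _.
    by have [] : weight M j = weight M1 j /\ potential j M = potential j M1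
      by apply: same_lvl_weight => x xn; rewrite lv1.
  by move: c1 c2; lia.
- split => // j jS; by have [] := ok2 j jS.
- move=> j jS; have [_] := ok2 j jS; rewrite /amortized.
  by have [_ ->] : weight M1 j = weight M j /\ potential j M1 = potential j M
      by apply: same_lvl_weight => x xn; rewrite lv1.
Qed.

End Step.
End Insert.

(** * Preprocessing *)

(** Spreads the consecutive input words into array 0, of stride 10. Running downwards from the last
    word, a write at 10 i hits no word that is still to be read. *)
Definition relocate_c : prog :=
  PAsgn vi (EConst 6 $+ EConst 2 $* ERaw (EConst 5)) ;;
  PWhile (EVar vi)
    (PAsgn vi (EVar vi $- EConst 1) ;; PStore 0 (EVar vi) (ERaw (EVar vi))).

(** Linear search for the least X0 >= 1 with X0^4 a^2 >= q^2 n b^2; preprocessing has a polynomial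
    time budget, which allows it. *)
Definition root_c : prog :=
  PAsgn vX (EConst 1) ;;
  PWhile (EVar vX $* EVar vX $* EVar vX $* EVar vX $*
            (EArr 0 (EConst 3) $* EArr 0 (EConst 3)) $<
          EArr 0 (EConst 2) $* EArr 0 (EConst 2) $* EArr 0 (EConst 0) $*
            (EArr 0 (EConst 4) $* EArr 0 (EConst 4)))
    (PAsgn vX (EVar vX $+ EConst 1)) ;;
  PStore 1 (EConst 1) (EVar vX).

(** Widths are doubled until they reach n, which exceeds the length of every simple path. *)
Definition scales_c : prog :=
  PAsgn vi (EConst 1) ;;
  PWhile (EVar vX $< EArr 0 (EConst 0))
    (PAsgn vX (EVar vX $+ EVar vX) ;; PAsgn vi (EVar vi $+ EConst 1)) ;;
  PStore 1 (EConst 0) (EVar vi) ;;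
  PStore 1 (EConst 2) (EVar vX $+ EVar vX).

Definition nodes_c : prog :=
  PAsgn vy (EConst 0) ;;
  PWhile (EVar vy $< EArr 0 (EConst 0))
    (PStore 2 (EVar vy) (EConst 0) ;;
     PStore 6 (EVar vy) (EArr 1 (EConst 2)) ;;
     PAsgn vy (EVar vy $+ EConst 1)).

Definition edges_c : prog :=
  PAsgn vd (EArr 0 (EConst 5)) ;;
  PStore 0 (EConst 5) (EConst 0) ;;
  PAsgn vo (EConst 0) ;;
  PWhile (EVar vo $< EVar vd)
    (PAsgn vu (EArr 0 (EConst 6 $+ EConst 2 $* EVar vo)) ;;
     PAsgn vv (EArr 0 (EConst 7 $+ EConst 2 $* EVar vo)) ;;
     add_edge_c ;;
     PAsgn vo (EVar vo $+ EConst 1)).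

Definition build_c : prog :=
  PAsgn vn (EArr 0 (EConst 0)) ;;
  PAsgn vi (EConst 0) ;;
  PAsgn vX (EArr 1 (EConst 1)) ;;
  PWhile (EVar vi $< EArr 1 (EConst 0))
    (PAsgn vo (EVar vi $* EVar vn) ;;
     PStore 8 (EVar vi) (EConst 0) ;;
     PAsgn vy (EConst 0) ;;
     PWhile (EVar vy $< EVar vn)
       (PStore 4 (EVar vo $+ EVar vy) (EVar vX $+ EVar vX) ;;
        PAsgn vy (EVar vy $+ EConst 1)) ;;
     rebuild_c ;;
     PAsgn vi (EVar vi $+ EConst 1) ;;
     PAsgn vX (EVar vX $+ EVar vX)).

Definition preprocess_c : prog :=
  relocate_c ;; root_c ;; scales_c ;; nodes_c ;; edges_c ;; build_c.

Section Preprocess.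
Variables (V n s a b q : nat) (E : seq (nat * nat)).
Hypotheses (Eb : bounded n E) (loopless : all (fun e => e.1 != e.2) E).
Hypotheses (sn : s < n) (a_gt0 : 0 < a) (ab : a <= b).
Hypothesis V_ge : 20 * (q * n * b + 1) + (n + 20) * (n + 20) + q + a + b +
  2 * size E <= V.

Lemma relocate_wp st (Q : hst -> Prop) :
  mem st 5 = size E -> (forall j, j < 6 + 2 * size E -> mem st j <= V) ->
  (forall st', out st' = out st -> clk st' <= clk st + 300 * (size E + 1) ->
     (forall j, j < 6 + 2 * size E -> aget (mem st') 0 j = mem st j) -> Q st') ->
  wp V relocate_c Q st.
Proof.
set N := 6 + 2 * size E; case: st => w M ou ck /= h5 hM H.
wseq; wasgn; first by rewrite h5; lia.
rewrite h5; apply: (@wp_for V (fun k s' => [/\ var s' vi = N - k, out s' = ou,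
   clk s' <= ck + 20 + 20 * k, forall j, j < N - k -> mem s' j = M j &
   forall j, N - k <= j < N -> aget (mem s') 0 j = M j]) N _ _ _ _ _ _ 0) => //=.
- by move=> k s' km [-> _ _ _ _]; lia.
- move=> k [w1 M1 ou1 ck1] /= km [h1 h2 h3 h4 h5'].
  wseq; wasgn; first by rewrite h1; lia.
  wstore; first by rewrite h1 h4; [apply: hM | ]; lia.
  rewrite h1; split => //; try lia.
  + move=> j hj; rewrite /aset /=; case: eqP => e; last by rewrite h4; lia.
    by exfalso; lia.
  + move=> j hj; rewrite aget_set //=; case: eqP => [->|ne]; first by rewrite h4; lia.
    by rewrite h5' //; lia.
- move=> s' [_ h2 h3 _ h4]; apply: H => //=; first by lia.
  by move=> j hj; rewrite h4 //; lia.
- by split => //=; lia.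
Qed.

Lemma root_wp st (Q : hst -> Prop) :
  aget (mem st) 0 0 = n -> aget (mem st) 0 2 = q -> aget (mem st) 0 3 = a ->
  aget (mem st) 0 4 = b ->
  (forall st' X0, out st' = out st -> clk st' <= clk st + 200 * (q * n * b + 1) ->
     aget (mem st') 0 = aget (mem st) 0 -> aget (mem st') 1 1 = X0 -> var st' vX = X0 ->
     0 < X0 -> X0 <= q * n * b + 1 ->
     q * q * n * (b * b) <= X0 * X0 * X0 * X0 * (a * a) ->
     X0 = 1 \/ X0.-1 * X0.-1 * X0.-1 * X0.-1 * (a * a) < q * q * n * (b * b) ->
     Q st') ->
  wp V root_c Q st.
Proof.
case: st => w M ou ck /= hn hq ha hb H.
wseq; wasgn; first by lia.
wseq.
have key k X w1 ck1 : k + X = q * n * b + 1 -> 0 < X -> w1 vX = X ->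
    X = 1 \/ X.-1 * X.-1 * X.-1 * X.-1 * (a * a) < q * q * n * (b * b) ->
    ck1 + 100 * k <= ck + 100 * (q * n * b + 1) ->
  wp V (PWhile (EVar vX $* EVar vX $* EVar vX $* EVar vX $*
            (EArr 0 (EConst 3) $* EArr 0 (EConst 3)) $<
          EArr 0 (EConst 2) $* EArr 0 (EConst 2) $* EArr 0 (EConst 0) $*
            (EArr 0 (EConst 4) $* EArr 0 (EConst 4)))
    (PAsgn vX (EVar vX $+ EConst 1))) (wp V (PStore 1 (EConst 1) (EVar vX)) Q) (Hst w1 M ou ck1).
  elim: k X w1 ck1 => [|k IH] X w1 ck1 kX X0 hX old cc;
    apply: wp_while => /=; rewrite hX hn hq ha hb.
  - move=> h; wstore; first by rewrite hX; lia.
    rewrite hX; apply: (H _ X) => //=; try lia.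
    by rewrite aget_set_other.
  - move=> h; exfalso; have : X * X * X * X * (a * a) < q * q * n * (b * b).
      by move: h; case: ltnP.
    rewrite ltnNge => /negP; apply.
    (* The search ends by X = q n b + 1: since X^2 >= (q n b)^2 >= q^2 n b^2, the test fails
       there. *)
    have h1 : q * n * b <= X by lia.
    have h2 : (q * n * b) * (q * n * b) <= X * X by apply: leq_mul.
    have h3 : q * q * n * (b * b) <= (q * n * b) * (q * n * b) by nia.
    apply: leq_trans h3 (leq_trans h2 _); have aa : 0 < a * a by rewrite muln_gt0 a_gt0.
    by rewrite -!mulnA leq_mul2l; apply/orP; right; rewrite !leq_pmulr ?muln_gt0 ?X0 ?a_gt0.
  - move=> h; wstore; first by rewrite hX; lia.
    rewrite hX; apply: (H _ X) => //=; try lia.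
    by rewrite aget_set_other.
  - move=> h; wasgn; first by rewrite hX; lia.
    rewrite hX; apply: (IH (X + 1)) => //=; try lia.
by apply: (key (q * n * b) 1) => //=; (by left) || lia.
Qed.

Lemma scales_count_wp st X0 (Q : hst -> Prop) :
  aget (mem st) 0 0 = n -> aget (mem st) 1 1 = X0 -> var st vX = X0 ->
  0 < X0 -> X0 <= q * n * b + 1 ->
  (forall st' S, out st' = out st -> clk st' <= clk st + 100 * (n + 1) ->
     aget (mem st') 0 = aget (mem st) 0 -> aget (mem st') 1 0 = S ->
     aget (mem st') 1 1 = X0 -> aget (mem st') 1 2 = no_estimate X0 S ->
     0 < S -> n <= scale_width X0 S.-1 -> S = 1 \/ scale_width X0 S.-2 < n ->
     scale_width X0 S.-1 <= X0 + 2 * n -> Q st') ->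
  wp V scales_c Q st.
Proof.
case: st => w M ou ck /= hn hx hX X0p X0le H.
wseq; wasgn; first by lia.
wseq.
have wS j : scale_width X0 j.+1 = scale_width X0 j + scale_width X0 j.
  by rewrite /scale_width expnS mulnCA mul2n addnn.
have jw j : j < scale_width X0 j.
  by apply: leq_trans (ltn_expl j (ltnSn 1)) _; rewrite leq_pmull.
have fin S w1 ck1 : w1 vi = S.+1 -> w1 vX = scale_width X0 S -> n <= scale_width X0 S ->
    S = 0 \/ scale_width X0 S.-1 < n -> ck1 <= ck + 30 + 50 * n ->
    wp V (PStore 1 (EConst 0) (EVar vi) ;; PStore 1 (EConst 2) (EVar vX $+ EVar vX)) Q
      (Hst w1 M ou ck1).
  move=> h1 h2 h3 h4 h5.
  have wle : scale_width X0 S <= X0 + 2 * n.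
    case: h4 => [->|h4]; first by rewrite /scale_width expn0; lia.
    by case: (S) h4 => [|j] /=; [rewrite /scale_width expn0; lia | rewrite wS; lia].
  have Sn : S <= n.
    case: (S) h4 => [|j] /= [//|h4]; first by lia.
    by have := jw j; lia.
  wseq; wstore; first by rewrite h1; lia.
  wstore; first by rewrite h2; lia.
  rewrite h1 h2; apply: (H _ S.+1) => //=; rewrite ?aget_set //=; try lia.
  by rewrite !aget_set_other.
have key k S w1 ck1 : n <= k + S -> w1 vi = S.+1 -> w1 vX = scale_width X0 S ->
    S = 0 \/ scale_width X0 S.-1 < n -> ck1 + 50 * (n - S) <= ck + 10 + 50 * n ->
  wp V (PWhile (EVar vX $< EArr 0 (EConst 0))
    (PAsgn vX (EVar vX $+ EVar vX) ;; PAsgn vi (EVar vi $+ EConst 1)))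
   (wp V (PStore 1 (EConst 0) (EVar vi) ;; PStore 1 (EConst 2) (EVar vX $+ EVar vX)) Q)
   (Hst w1 M ou ck1).
  elim: k S w1 ck1 => [|k IH] S w1 ck1 kS h1 h2 h3 h4;
    apply: wp_while => /=; rewrite h2 hn => hc.
  - have ge : n <= scale_width X0 S by move: hc; case: ltnP.
    by apply: (fin S) => //=; move: h4; clear; lia.
  - by exfalso; move: hc; have := jw S; case: ltnP => //; lia.
  - have ge : n <= scale_width X0 S by move: hc; case: ltnP.
    by apply: (fin S) => //=; move: h4; clear; lia.
  - have lt : scale_width X0 S < n by move: hc; case: ltnP.
    have Sn := jw S.
    wseq; wasgn; first by rewrite h2; lia.
    wasgn; first by rewrite h1; lia.
    rewrite h1 h2 addn1; apply: IH => //=; first by lia.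
    by right.
    by move: h4 lt Sn; clear; lia.
apply: (key n 0) => //=; first by lia.
- by rewrite hX /scale_width expn0 muln1.
- by left.
- by move: (n); clear; lia.
Qed.

Lemma nodes_wp st X (Q : hst -> Prop) :
  aget (mem st) 0 0 = n -> aget (mem st) 1 2 = X -> X <= V ->
  (forall st', out st' = out st -> clk st' <= clk st + 100 * (n + 1) ->
     aget (mem st') 0 = aget (mem st) 0 -> aget (mem st') 1 = aget (mem st) 1 ->
     (forall x, x < n -> aget (mem st') 2 x = 0 /\ aget (mem st') 6 x = X) -> Q st') ->
  wp V nodes_c Q st.
Proof.
case: st => w M ou ck /= hn hX XV H.
wseq; wasgn; first by [].
apply: (@wp_for V (fun k s' => [/\ var s' vy = k, out s' = ou,
   clk s' <= ck + 10 + 80 * k,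
   aget (mem s') 0 = aget M 0 /\ aget (mem s') 1 = aget M 1 &
   forall x, x < k -> aget (mem s') 2 x = 0 /\ aget (mem s') 6 x = X]) n _ _ _ _ _ _ 0) => //=.
- by move=> k s' km [-> _ _ [-> _] _]; rewrite hn; lia.
- move=> k [w1 M1 ou1 ck1] /= km [h1 h2 h3 [h4 h4'] h5].
  wseq; wstore; first by [].
  wseq; wstore; first by rewrite aget_set //= h4' hX.
  rewrite aget_set //= h4' hX h1; wasgn; first by rewrite h1; lia.
  rewrite h1; split; rewrite ?addn1 //; first by lia.
    by rewrite !aget_set_other.
  move=> x; rewrite ltnS leq_eqVlt !aget_set //= => /orP[/eqP ->|xk]; first by rewrite eqxx.
  by have [-> ->] := h5 x xk; case: eqP.
- move=> s' [h1 h2 h3 [h4 h4'] h5]; apply: H => //=; lia.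
- by split => //; lia.
Qed.

Lemma nth_slots j (e0 : nat * nat) : j < size E ->
  nth 0 (slots E) (2 * j) = (nth e0 E j).1 /\
  nth 0 (slots E) (2 * j + 1) = (nth e0 E j).2.
Proof.
rewrite /slots; elim: (E) j => // e r IH [|j] h; first by [].
have -> : 2 * j.+1 = (2 * j).+2 by lia.
by rewrite !addSn; apply: IH.
Qed.

Lemma edges_wp st (Q : hst -> Prop) :
  edges_ok (mem st) E -> (forall x, x < n -> aget (mem st) 2 x = 0) ->
  (forall st', out st' = out st -> clk st' <= clk st + 400 * (size E + 1) ->
     edges_ok (mem st') E -> adj_ok n (mem st') E ->
     (forall c, c \in [:: 1; 6] -> aget (mem st') c = aget (mem st) c) ->
     (forall j, j < 5 -> aget (mem st') 0 j = aget (mem st) 0 j) -> Q st') ->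
  wp V edges_c Q st.
Proof.
case: st => w M ou ck /= [e5 e6] h2 H.
wseq; wasgn; first by rewrite e5; lia.
wseq; wstore; first by []. wseq; wasgn; first by [].
rewrite e5; apply: (@wp_for V (fun k s' => [/\ var s' vo = k /\ var s' vd = size E,
   out s' = ou, clk s' <= ck + 50 + 300 * k,
   edges_ok (mem s') (take k E) /\ adj_ok n (mem s') (take k E) &
   [/\ forall c, c \in [:: 1; 6] -> aget (mem s') c = aget M c,
      forall j, j < 5 -> aget (mem s') 0 j = aget M 0 j &
      forall t, 2 * k <= t < 2 * size E -> aget (mem s') 0 (6 + t) = nth 0 (slots E) t]])
  (size E) _ _ _ _ _ _ 0) => //=.
- by move=> k s' km [[-> ->] _ _ _ _]; lia.
- move=> k [w1 M1 ou1 ck1] /= km [[h1 hd] h3 h4 [ed ad] [a1 a2 a3]].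
  case E_k : (nth (0, 0) E k) => [u v].
  have [nu nv] := nth_slots (0, 0) km; rewrite E_k /= in nu nv.
  have eE : (u, v) \in E by rewrite -E_k mem_nth.
  have [un vn_] : u < n /\ v < n by apply: Eb; rewrite /nb eE.
  have uv : u != v by move/allP: loopless => /(_ _ eE).
  have hu : aget M1 0 (6 + 2 * k) = u by rewrite a3 //; lia.
  have hv : aget M1 0 (7 + 2 * k) = v by rewrite -[7]/(6 + 1) -addnA [1 + _]addnC a3 //; lia.
  have szk : size (take k E) = k by rewrite size_takel // ltnW.
  wseq; wasgn; first by rewrite h1 hu; lia.
  wseq; wasgn; first by rewrite h1 hv; lia.
  rewrite h1 hu hv.
  wseq; apply: (@add_edge_wp V n (take k E) u v un vn_ uv _ _) => //=.
  + by rewrite szk; lia.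
  + by lia.
  move=> [w2 M2 ou2 ck2] /= fr2 o2 c2 ed2 ad2 b1 b2.
  have tk : rcons (take k E) (u, v) = take k.+1 E by rewrite (take_nth (0, 0)) // E_k.
  rewrite tk in ed2 ad2; rewrite szk in b2.
  wasgn; first by rewrite fr2 //= h1; lia.
  rewrite fr2 //= h1; split.
  + by rewrite fr2 //= addn1.
  + by rewrite o2.
  + by lia.
  + by [].
  + split => [c hc|j j5|t ht].
    * by rewrite b1 ?a1 //; move: hc; rewrite !inE; by move=> /orP[] /eqP ->.
    * by rewrite b2 ?a2 // !inE; lia.
    * by rewrite b2 ?a3 // ?inE; lia.
- move=> s' [_ h3 h4 [ed ad] [a1 a2 _]]; rewrite take_size in ed ad.
  by apply: H => //=; lia.
- split => //; rewrite ?take0 //; first by lia.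
  + split; first by split => //; rewrite aget_set.
    move=> x xn; exists [::]; split => //=.
    * by rewrite aget_set //= h2.
    * by rewrite /dg big_nil.
  + split => [c hc|j j5|t ht].
    * by rewrite aget_set_other //; move: hc; rewrite !inE; by move=> /orP[] /eqP ->.
    * by rewrite aget_set //=; case: eqP => //; lia.
    * by rewrite aget_set //= e6 //; lia.
Qed.

Section Build.
Variables (X0 S : nat).
Hypotheses (X0_gt0 : 0 < X0) (X0_le : X0 <= q * n * b + 1) (S_gt0 : 0 < S) (S_le : S <= n + 1).
Hypothesis width_le : scale_width X0 S.-1 <= X0 + 2 * n.

Lemma width_bound i : i < S -> 4 * scale_width X0 i + 2 <= V.
Proof.
move=> iS; have h : scale_width X0 i <= scale_width X0 S.-1.
  by rewrite /scale_width leq_mul2l leq_exp2l //; apply/orP; right; lia.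
by lia.
Qed.

(** Filling a block with the cap before the search puts the new scale into the state where it
    contributes no estimate, so [best_update] extends the invariant from k to k + 1 scales. *)
Lemma build_wp st (Q : hst -> Prop) :
  core_ok n s a b X0 S (mem st) E -> (forall x, x < n -> aget (mem st) 6 x = no_estimate X0 S) ->
  (forall st', out st' = out st ->
     clk st' <= clk st + 100 + S * (100 * n + 2000 * (size E + 1) + 500) ->
     inv n s a b X0 S E (mem st') (fun _ => 0) -> Q st') ->
  wp V build_c Q st.
Proof.
case: st => w M ou ck /= co h6 H.
have nV : n < V by lia.
wseq; wasgn; first by rewrite (co_n co); lia.
wseq; wasgn; first by [].
wseq; wasgn; first by rewrite (co_X co); lia.
rewrite (co_n co) (co_X co).
set T := 100 * n + 2000 * (size E + 1) + 500.
apply: (@wp_for V (fun k s' => [/\ [/\ var s' vn = n, var s' vi = k & var s' vX = scale_width X0 k],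
   out s' = ou, clk s' <= ck + 50 + k * T, core_ok n s a b X0 S (mem s') E &
   estimates_ok n X0 S k (mem s') /\ forall i, i < k ->
     exists G F, scale_state n s a b X0 E (mem s') i G F /\ size F = 0]) S _ _ _ _ _ _ 0) => //=.
- by move=> k s' km [[_ -> _] _ _ c _]; rewrite (co_S c); lia.
- move=> i [w1 M1 ou1 ck1] /= iS [[hn hi hX] h2 h3 co1 [bo1 ok1]].
  have wb := width_bound iS.
  have inV : i * n <= V.
    have : i * n <= n * n by rewrite leq_mul2r; apply/orP; right; lia.
    by lia.
  wseq; wasgn; first by rewrite hi hn.
  wseq; wstore; first by []. rewrite hi hn.
  wseq; wasgn; first by [].
  wseq; apply: (@wp_for V (fun k s' => [/\
      [/\ var s' vn = n, var s' vi = i, var s' vX = scale_width X0 i & var s' vo = i * n] /\ var s' vy = k,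
     out s' = ou, clk s' <= ck1 + 60 + 80 * k,
     forall x, x < k -> level_at n (mem s') i x = scale_cap X0 i &
     [/\ forall c, c \in [:: 0; 1; 2; 3; 5; 6; 7] -> aget (mem s') c = aget M1 c,
        forall j, aget (mem s') 8 j = if j == i then 0 else aget M1 8 j &
        forall j, ~~ (i * n <= j < i * n + n) -> aget (mem s') 4 j = aget M1 4 j]]) n _ _ _ _ _ _ 0) => //=.
  + by move=> k s' km [[[-> _ _ _] ->] _ _ _ _]; lia.
  + move=> k [w2 M2 ou2 ck2] /= kn [[[g1 g2 g3 g4] g5] o2 c2 l2 [a2 d2 f2]].
    wseq; wstore; first by rewrite g3; lia.
    wasgn; first by rewrite g5; lia.
    rewrite g3 g4 g5; split => //; try lia.
    * by rewrite addn1.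
    * move=> x; rewrite ltnS leq_eqVlt /level_at aget_set //= eqn_add2l => /orP[/eqP ->|xk].
        by rewrite eqxx.
      by case: eqP => // _; exact: l2.
    * split => [c hc|j|j hj].
      - by rewrite aget_set_other ?a2 //; move: hc; rewrite !inE; do ?[case/orP]; move=> /eqP ->.
      - by rewrite aget_set //= d2.
      - rewrite aget_set //=; case: eqP => [jj|_]; last exact: f2.
        by exfalso; move: hj; rewrite jj; lia.
  + move=> [w2 M2 ou2 ck2] /= [[[g1 g2 g3 g4] g5] o2 c2 l2 [a2 d2 f2]].
    wseq; apply: (@rebuild_wp V n (i * n) i s (scale_width X0 i) E) => //=; try lia.
    * by have [e5 e6] := co_edges co1; split => *; rewrite a2 ?e5 ?e6.
    * by move=> x xn; have [ls hls] := co_adj co1 xn; exists ls; rewrite !a2.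
    * by rewrite a2 // (co_s co1).
    * by move=> x xn _; right; exact: l2.
    move=> [w3 M3 ou3 ck3] b' /= fr3 o3 c3 r3 sb3 gb3 st3 dn3.
    have sb3' : same_but n (i * n) (aset M2 8 i 0) M3.
      have -> // : aset M2 8 i 0 = M2.
      apply: funext => j; rewrite /aset /=; case: eqP => // ->.
      by have := d2 i; rewrite eqxx /aget.
    have le3 x : x < n -> lev b' x <= level_at n M2 i x.
      move=> xn; rewrite l2 //; apply: leq_trans (steps_mono x st3) _.
      by rewrite /=; case: ifP.
    have [R1 R2 R3 R4] := rebuild_ok a b Eb sn X0_gt0 le3 r3 sb3' gb3 st3 dn3.
    have fr12 : scale_frame_rel n i M1 M2.
      split => [c hc|j /negbTE ne|c j hc hj].
      - by rewrite a2 //; move: hc; do 4?[case: c => [|c] //].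
      - by rewrite d2 ne.
      - by move: hc; rewrite !inE => /orP[/eqP ->|/eqP ->]; [exact: f2 | rewrite a2].
    have co2 : core_ok n s a b X0 S M3 E := core_frame (core_frame co1 fr12) R2.
    wseq; wasgn; first by rewrite fr3 //= g2; lia.
    wasgn; first by rewrite fr3 //= g3; lia.
    rewrite !fr3 //= g2 g3; split.
    * rewrite ?fr3 //= ?g1 addn1; split => //.
      by rewrite /scale_width expnS mulnCA mul2n addnn.
    * by rewrite o3 o2.
    * move: c2 c3 h3; rewrite /T; set P := i * _; rewrite mulSn -/P; lia.
    * by [].
    * split.
        have bo2 : estimates_ok n X0 S i M2.
          move=> x xn; rewrite !a2 //; have [p1 p2] := bo1 x xn.
          have lv12 j : j < i -> level_at n M2 j x = level_at n M1 j x.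
            by move=> ji; have [|-> _] := frame_lvl fr12 (_ : j != i) xn => //; lia.
          split => [j ji|]; first by rewrite lv12 //; exact: p1.
          by case: p2 => [->|[q1 q2 q3]]; [left | right; rewrite lv12].
        apply: (best_update bo2 _ R2 R3 R4); right; split => //.
      move=> j; rewrite ltnS leq_eqVlt => /orP[/eqP ->|ji].
        by exists E, [::]; split.
      have [G [F [so sz]]] := ok1 j ji; exists G, F; split => //.
      have ne : j != i by lia.
      by apply: (scale_ok_frame sn Eb R2 ne); apply: (scale_ok_frame sn Eb fr12 ne).
  + split => //; try lia.
    split => [c hc|j|j hj].
    * by rewrite aget_set_other //; move: hc; rewrite !inE; do ?[case/orP]; move=> /eqP ->.
    * by rewrite aget_set //=.
    * by rewrite aget_set.
- move=> s' [_ h2 h3 c1 [bo ok]]; apply: H => //=.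
  by move: h3; rewrite /T; lia.
- split => //; first by rewrite /scale_width expn0 muln1.
  + lia.
  + by split => // x xn; rewrite h6 //; split => //; left.
Qed.

End Build.
Lemma preprocess_wp st (Q : hst -> Prop) :
  (forall j, j < 6 + 2 * size E -> mem st j <= V) ->
  mem st 0 = n -> mem st 1 = s -> mem st 2 = q -> mem st 3 = a -> mem st 4 = b ->
  mem st 5 = size E ->
  (forall j, j < 2 * size E -> mem st (6 + j) = nth 0 (slots E) j) ->
  (forall st' X0 S, out st' = out st -> clk st' <= clk st + 4500 * (V * V) ->
     0 < X0 -> X0 <= q * n * b + 1 ->
     q * q * n * (b * b) <= X0 * X0 * X0 * X0 * (a * a) ->
     X0 = 1 \/ X0.-1 * X0.-1 * X0.-1 * X0.-1 * (a * a) < q * q * n * (b * b) ->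
     0 < S -> n <= scale_width X0 S.-1 -> S = 1 \/ scale_width X0 S.-2 < n ->
     scale_width X0 S.-1 <= X0 + 2 * n -> S <= n + 1 ->
     inv n s a b X0 S E (mem st') (fun _ => 0) -> Q st') ->
  wp V preprocess_c Q st.
Proof.
move=> hV m0 m1 m2 m3 m4 m5 m6 H.
wseq; apply: relocate_wp => // s1 o1 c1 r1.
wseq; apply: root_wp; rewrite ?r1 // => s2 X0 o2 c2 e2 x2 v2 X1 X2 X3 X4.
wseq; apply: (@scales_count_wp _ X0); rewrite ?e2 ?r1 // => s3 S o3 c3 e3 S3 x3 i3 S0 S1 S2 wS.
have Sn : S <= n + 1.
  case: S2 => [->|h]; first by rewrite addn1.
  have : S.-2 < scale_width X0 S.-2.
    by apply: leq_trans (ltn_expl S.-2 (ltnSn 1)) _; rewrite leq_pmull.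
  by lia.
have infV : no_estimate X0 S <= V.
  by rewrite /no_estimate /scale_cap; lia.
wseq; apply: (@nodes_wp _ (no_estimate X0 S)); rewrite ?e3 ?e2 ?r1 // => s4 o4 c4 e4 a4 i4.
have e40 : aget (mem s4) 0 = aget (mem s1) 0 by rewrite e4 ?e3 ?e2.
have edges4 : edges_ok (mem s4) E.
  by split => [|j hj]; rewrite e40 r1 ?m6 //; lia.
wseq; apply: edges_wp => //; first by move=> x /i4[].
move=> s5 o5 c5 ed5 ad5 a5 z5.
have co5 : core_ok n s a b X0 S (mem s5) E.
  by split; rewrite ?z5 ?e40 ?r1 ?a5 ?a4 //.
apply: (@build_wp X0 S) => //; first by move=> x xn; rewrite a5 //; have [_] := i4 x xn.
move=> s6 o6 c6 iv; apply: (H s6 X0 S) => //.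
- by rewrite o6 o5 o4 o3 o2 o1.
- have big : 20 * (q * n * b + 1) + 20 * (n + 20) + 2 * size E <= V.
    have : 20 * (n + 20) <= (n + 20) * (n + 20) by rewrite leq_mul2r leq_addl orbT.
    by move: V_ge; move: ((n + 20) * (n + 20)) (q * n * b); clear; lia.
  set B := q * n * b in big *.
  have t1 : S * (100 * n + 2000 * (size E + 1) + 500) <= V * (2600 * V).
    by apply: leq_mul; move: Sn big; clear; lia.
  have t2 : V <= V * V by rewrite leq_pmulr //; move: big; clear; lia.
  have t3 : B + 1 <= V by move: big; clear; lia.
  move: c1 c2 c3 c4 c5 c6 t1; rewrite -/B; set T := S * _.
  have -> : V * (2600 * V) = 2600 * (V * V) by rewrite mulnCA.
  have : size E + 1 <= V by move: big; clear; lia.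
  have : n + 1 <= V by move: big; clear; lia.
  move: t2 t3; move: (V * V) (B + 1) T; clear; lia.
Qed.

End Preprocess.

(** * Queries *)

Definition distance_c : prog :=
  PIf (EArr 6 (EVar vu) $< EArr 1 (EConst 2)) (PEmit (EArr 6 (EVar vu))) PSkip.

Definition path_c : prog :=
  PIf (EArr 6 (EVar vu) $< EArr 1 (EConst 2))
    (PAsgn vo (EArr 7 (EVar vu) $* EArr 0 (EConst 0)) ;;
     PAsgn vy (EArr 6 (EVar vu)) ;;
     PAsgn vx (EVar vu) ;;
     PEmit (EVar vx) ;;
     PWhile (EVar vy)
       (PAsgn vx (EArr 5 (EVar vo $+ EVar vx)) ;;
        PEmit (EVar vx) ;;
        PAsgn vy (EVar vy $- EConst 1)))
    PSkip.

Section Queries.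
Variables (V n s a b X0 S : nat) (E : seq (nat * nat)) (M fs : nat -> nat).
Hypotheses (sn : s < n) (nV : n < V) (SnV : S * n <= V) (infV : no_estimate X0 S <= V).
Hypotheses (Eb : bounded n E) (iv : inv n s a b X0 S E M fs).

Lemma distance_wp st (Q : hst -> Prop) : mem st = M ->
  (forall st', mem st' = M -> clk st' <= clk st + 100 ->
     out st' = out st ++ (if aget M 6 (var st vu) < no_estimate X0 S then [:: aget M 6 (var st vu)] else [::]) ->
     Q st') ->
  wp V distance_c Q st.
Proof.
case: st => w M' ou ck /= -> H; have [co _ _] := iv.
apply: wp_if => /=; rewrite (co_inf co) => h.
  have lt : aget M 6 (w vu) < no_estimate X0 S by move: h; case: ltnP.
  by apply: wp_emit; apply: H => //=; [lia | rewrite lt cats1].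
have ge : (aget M 6 (w vu) < no_estimate X0 S) = false by move: h; case: ltnP.
by apply: wp_skip; apply: H => //=; [lia | rewrite ge cats0].
Qed.

Lemma follow_wp k o x w ou ck (Q : hst -> Prop) :
  let pr := fun v => aget M 5 (o + v) in
  w vo = o -> w vx = x -> w vy = k -> k <= V ->
  (forall z, z \in traject pr (pr x) k -> z <= V) ->
  (forall st', mem st' = M -> clk st' <= ck + 100 * k + 10 ->
     out st' = ou ++ traject pr (pr x) k -> Q st') ->
  wp V (PWhile (EVar vy)
       (PAsgn vx (EArr 5 (EVar vo $+ EVar vx)) ;;
        PEmit (EVar vx) ;;
        PAsgn vy (EVar vy $- EConst 1))) Q (Hst w M ou ck).
Proof.
move=> pr; elim: k x w ou ck => [|k IH] x w ou ck ho hx hy kV hz H;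
  apply: wp_while => /=; rewrite hy //.
  by move=> _; apply: H => //=; [lia | rewrite cats0].
move=> _; have zV : pr x <= V by apply: hz; rewrite trajectS mem_head.
wseq; wasgn; first by rewrite ho hx.
rewrite ho hx; wseq; apply: wp_emit => /=.
wasgn; first by rewrite hy; lia.
rewrite hy; apply: (IH (pr x)) => //=; try lia.
  by move=> z zt; apply: hz; rewrite trajectS inE zt orbT.
move=> st' m' c' o'; apply: H => //; first by lia.
by rewrite o' -cats1 -catA trajectS.
Qed.

Lemma path_wp st (Q : hst -> Prop) : mem st = M -> var st vu < n ->
  let v := var st vu in let i := aget M 7 v in
  (forall st', mem st' = M -> clk st' <= clk st + 200 * ((aget M 6 v < no_estimate X0 S) * aget M 6 v + 1) ->
     out st' = out st ++ (if aget M 6 v < no_estimate X0 S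
       then v :: traject (parent_at n M i) (parent_at n M i v) (aget M 6 v) else [::]) ->
     Q st') ->
  wp V path_c Q st.
Proof.
case: st => w M' ou ck /= -> vn H; have [co _ _] := iv.
set v := w vu in vn H; set i := aget M 7 v in H.
apply: wp_if => /=; rewrite (co_inf co) -/v => h; last first.
  have ge : (aget M 6 v < no_estimate X0 S) = false by move: h; case: ltnP.
  by apply: wp_skip; apply: H => //=; [lia | rewrite ge cats0].
have lt : aget M 6 v < no_estimate X0 S by move: h; case: ltnP.
have [[iS _ _ _] pn] := best_path Eb iv vn lt.
wseq; wasgn.
  by rewrite (co_n co); apply: leq_trans SnV; rewrite leq_mul2r ltnW ?orbT.
rewrite (co_n co) -/v -/i.
wseq; wasgn; first by rewrite -/v; lia.
wseq; wasgn; first by rewrite -/v; lia.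
rewrite -/v; wseq; apply: wp_emit => /=.
apply: (@follow_wp (aget M 6 v) (i * n) v) => //=; first by lia.
  by move=> z zt; have := pn z zt; lia.
move=> st' m' c' o'; apply: H => //; first by rewrite lt mul1n; lia.
by rewrite o' lt cat_rcons.
Qed.

End Queries.

(** * Sessions *)

Section Ordinals.
Variable n : nat.

Definition nat_edges (E : seq ('I_n * 'I_n)) : seq (nat * nat) :=
  [seq (nat_of_ord e.1, nat_of_ord e.2) | e <- E].

Lemma nat_edges_rcons E (u v : 'I_n) :
  nat_edges (rcons E (u, v)) = rcons (nat_edges E) (nat_of_ord u, nat_of_ord v).
Proof. by rewrite /nat_edges map_rcons. Qed.

Lemma size_nat_edges E : size (nat_edges E) = size E.
Proof. exact: size_map. Qed.

Lemma set2_eq (x y u v : 'I_n) : [set x; y] = [set u; v] <->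
  (x = u /\ y = v) \/ (x = v /\ y = u).
Proof.
split=> [h|[[-> ->] //|[-> ->]]]; last by rewrite finset.setUC.
have hx : x \in [set u; v] by rewrite -h !inE eqxx.
have hy : y \in [set u; v] by rewrite -h !inE eqxx orbT.
have hu : u \in [set x; y] by rewrite h !inE eqxx.
have hv : v \in [set x; y] by rewrite h !inE eqxx orbT.
move: hx hy hu hv; rewrite !inE.
move=> /orP[/eqP ?|/eqP ?] /orP[/eqP ?|/eqP ?] /orP[/eqP ?|/eqP ?] /orP[/eqP ?|/eqP ?];
  subst; by [left | right].
Qed.

Lemma adj_nb (E : seq ('I_n * 'I_n)) x y : adj E x y = nb (nat_edges E) x y.
Proof.
have mem u v : ((nat_of_ord u, nat_of_ord v) \in nat_edges E) = ((u, v) \in E).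
  have inj : injective (fun e : 'I_n * 'I_n => (nat_of_ord e.1, nat_of_ord e.2)).
    by move=> [p1 p2] [q1 q2] /= [/val_inj -> /val_inj ->].
  exact: (mem_map inj E (u, v)).
rewrite /adj /nb !mem; apply/mapP/orP => [[[u v] uvE]|].
  by move=> /set2_eq[[-> ->]|[-> ->]]; [left | right].
by move=> [h|h]; [exists (x, y) | exists (y, x)] => //=; rewrite finset.setUC.
Qed.

Lemma nat_edges_bounded E : bounded n (nat_edges E).
Proof.
by move=> x y /orP[|] /mapP[[u v] _ [-> ->]]; split; apply: ltn_ord.
Qed.

Lemma path_nat E (x : 'I_n) p : path (adj E) x p ->
  path (nb (nat_edges E)) x (map (@nat_of_ord n) p).
Proof. by elim: p x => //= y p IH x /andP[]; rewrite adj_nb => -> /IH ->. Qed.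

Lemma path_ord E (x : 'I_n) p : path (nb (nat_edges E)) x p ->
  exists p', map (@nat_of_ord n) p' = p /\ path (adj E) x p'.
Proof.
elim: p x => [|y p IH] x /=; first by exists [::].
move=> /andP[xy hp]; have [_ yn] := nat_edges_bounded xy.
have [p' [h1 h2]] := IH (Ordinal yn) hp.
by exists (Ordinal yn :: p'); rewrite /= h1 h2 adj_nb xy.
Qed.

Lemma connect_conn E (x s : 'I_n) :
  connect (adj E) x s <-> conn (nat_edges E) s x.
Proof.
split=> [/connectP[p hp ->]|[p /path_ord[p' [<- hp']]]].
  by exists (map (@nat_of_ord n) p); [exact: path_nat | rewrite last_map].
by rewrite last_map => /val_inj h; apply/connectP; exists p'.
Qed.

Lemma simple_loopless (E : seq ('I_n * 'I_n)) : simple_graph E ->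
  all (fun e => e.1 != e.2) (nat_edges E).
Proof. by move=> /andP[h _]; rewrite /nat_edges all_map. Qed.

Lemma simple_size (E : seq ('I_n * 'I_n)) : simple_graph E -> size E <= n * n.
Proof.
move=> /andP[_ /map_uniq u]; move/card_uniqP: u => <-.
by rewrite -[X in _ <= X * X]card_ord -card_prod max_card.
Qed.

Lemma simple_cat (E1 E2 : seq ('I_n * 'I_n)) : simple_graph (E1 ++ E2) -> simple_graph E1.
Proof.
by rewrite /simple_graph /edges all_cat map_cat cat_uniq => /andP[/andP[-> _] /and3P[->]].
Qed.

Lemma slots_nat_edges (E : seq ('I_n * 'I_n)) : slots (nat_edges E) =
  flatten [seq [:: nat_of_ord e.1; nat_of_ord e.2] | e <- E].
Proof. by rewrite /slots /nat_edges -map_comp. Qed.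

End Ordinals.

Definition bfs_algorithm : algorithm :=
  Algorithm (cprog preprocess_c) (cprog insert_c) (cprog distance_c) (cprog path_c).

Lemma dg_cat E1 E2 x : dg (E1 ++ E2) x = dg E1 x + dg E2 x.
Proof. by rewrite /dg big_cat. Qed.

Section Run.
Variables (V W : nat).
Hypotheses (V_ge : 256 <= V) (W_ge : V ^ 40 <= W).

(** The clock starts at 0, so its final value is the machine time; the bound on memory is handed on
    to the next call. *)
Lemma run c args M (Q : hst -> Prop) : ok_prog c -> (forall j, M j <= V) ->
  all (fun x => x <= V) args -> wp V c Q (Hst (nth 0 args) M [::] 0) ->
  exists t st' s', [/\ exec W (cprog c) (call_state args M) t st', Q s',
    clk s' = t, memory st' = mem s' /\ output st' = out s' &
    forall j, memory st' j <= V].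
Proof.
move=> okc hM hargs [s' [ex q]].
have hs : sim V (Hst (nth 0 args) M [::] 0) (call_state args M).
  split => //; split => // y _ /=; have [lt|ge] := ltnP y (size args).
    by move/all_nthP: hargs; apply.
  by rewrite nth_default.
have [t [st' [ex' [_ h2 h3 [_ h4]] c']]] := compile_correct V_ge W_ge ex okc hs.
by exists t, st', s'; split => //; move=> j; rewrite h2.
Qed.

(* The memory after an insertion as a function of the memory before it, by
   choice on a run of the deterministic machine. *)
Definition insert_mem (M : nat -> nat) (u v : nat) : nat -> nat :=
  match pselect (exists st t,
    exec W (insert_edge bfs_algorithm) (call_state [:: u; v] M) t st) with
  | left h => memory (projT1 (cid h))
  | right _ => M
  end.

Lemma insert_memE M u v t st :
  exec W (insert_edge bfs_algorithm) (call_state [:: u; v] M) t st ->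
  insert_mem M u v = memory st.
Proof.
move=> ex; rewrite /insert_mem; case: pselect => [h|[]]; last by exists st, t.
by case: (cid h) => st' /= [t' ex']; have [_ ->] := exec_deterministic ex ex'.
Qed.

End Run.

Section Session.
Variables (R : realType) (eps C : R) (V W n : nat) (s : 'I_n) (a b q X0 S : nat).
Hypotheses (V_ge : 256 <= V) (W_ge : V ^ 40 <= W).
Hypotheses (nV : n < V) (S_gt0 : 0 < S) (SV : S <= V) (SnV : S * n <= V).
Hypothesis capV : forall i, i < S -> scale_cap X0 i + scale_cap X0 i < V.
Hypotheses (a_gt0 : 0 < a) (ab : a <= b) (X0_gt0 : 0 < X0).
Hypothesis X0_ge : q * q * n * (b * b) <= X0 * X0 * X0 * X0 * (a * a).
Hypothesis n_width : n <= scale_width X0 S.-1.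
Hypothesis nnV : 8 + 2 * (n * n) < V.
Hypothesis eps_ge : (a%:R / b%:R <= eps)%R.
Hypothesis C_ge : (200%:R <= C)%R.

Local Notation A := bfs_algorithm.

Definition state_ok (E : seq ('I_n * 'I_n)) (M : nat -> nat) (fs : nat -> nat) :=
  inv n s a b X0 S (nat_edges E) M fs /\ forall j, M j <= V.

(** Estimates have to depend on the edge list alone and not on the queries in between, so they are
    recovered by replaying the insertions. Queries leave the memory unchanged. *)
Definition estimate (M : nat -> nat) (l : seq ('I_n * 'I_n)) (v : 'I_n) : nat :=
  aget (foldl (fun M (e : 'I_n * 'I_n) => insert_mem W M e.1 e.2) M l) 6 v.

Lemma infV : no_estimate X0 S <= V.
Proof. by have := capV (_ : S.-1 < S); rewrite /no_estimate; lia. Qed.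

Lemma state_connected E M fs (v : 'I_n) : state_ok E M fs ->
  connect (adj E) v s = (aget M 6 v < no_estimate X0 S).
Proof.
move=> [iv _]; apply/idP/idP; rewrite connect_conn.
all: by move/(best_conn (ltn_ord s) nV S_gt0 SV SnV a_gt0 ab X0_gt0 X0_ge n_width
    (nat_edges_bounded (E := E)) iv (ltn_ord v)).
Qed.

(** The estimate is the length of a path of parents in the current graph, hence at least d; the
    upper bound is [best_le] divided by b. *)
Lemma state_approximates E M fs : state_ok E M fs ->
  approximates eps E s (fun v => aget M 6 v).
Proof.
move=> [iv _] v d [[p [hp hl hd]] hmin].
have Eb := nat_edges_bounded (E := E).
have hl' : last (v : nat) (map (@nat_of_ord n) p) = s by rewrite last_map hl.
have [lt le] := best_le (ltn_ord s) nV S_gt0 SV SnV a_gt0 ab X0_gt0 X0_ge n_width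
  Eb iv (ltn_ord v) (path_nat hp) hl'.
rewrite size_map hd in le; split.
  have [[_ h1 h2 _] _] := best_path Eb iv (ltn_ord v) lt.
  have [p' [e1 e2]] := path_ord h1.
  have := hmin p' e2; rewrite -(size_map (@nat_of_ord n)) e1 size_traject; apply.
  by apply: val_inj => /=; rewrite -h2 -e1 last_map.
have bp : (0 < b%:R :> R)%R by rewrite ltr0n (leq_trans a_gt0 ab).
rewrite -(ler_pM2l bp); apply: (@Order.POrderTheory.le_trans _ _ ((a + b)%:R * d%:R))%R.
  by rewrite -!natrM ler_nat.
rewrite mulrA ler_wpM2r // mulrDr mulr1 natrD addrC lerD2l.
by rewrite mulrC -ler_pdivrMr.
Qed.

(** Weights refer to the final graph [Ef] throughout, so the potentials telescope along the session;
    [r j] counts all rebuilds of scale j. *)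
Lemma session_from ops : forall (E : seq ('I_n * 'I_n)) M fs,
  simple_graph (E ++ inserted ops) -> state_ok E M fs ->
  let Ef := nat_edges (E ++ inserted ops) in
  exists (evs : seq (event n)) (r : nat -> nat),
  [/\ session W A M ops evs,
      update_time evs <= 2000 * \sum_(0 <= j < S) weight n X0 (dg Ef) M j +
        1500 * (S + 1) * size (inserted ops) +
        2000 * (size Ef + 1) * \sum_(0 <= j < S) r j,
      forall j, j < S -> r j * (q * n * scale_width X0 j) <=
        8 * X0 * (n * scale_width X0 j * (fs j + size (inserted ops)) + q * level_sum n j M),
      forall pre post, ops = pre ++ post ->
        approximates eps (E ++ inserted pre) s (estimate M (inserted pre)) &
      forall pre post e, evs = pre ++ e :: post ->
        let ins := inserted (map (@ev_op n) pre) in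
        answered C (E ++ ins) s (estimate M ins) e].
Proof.
elim: ops => [|o ops IH] E M fs hsimple hst Ef.
  exists [::], (fun _ => 0); split.
  - exact: SessionNil.
  - by rewrite /update_time big_nil.
  - by move=> j _; rewrite mul0n.
  - move=> [|o pre] post // _; rewrite cats0; exact: state_approximates hst.
  - by move=> [|e' pre] post e.
have [iv hM] := hst.
have Eb := nat_edges_bounded (E := E).
have approx0 : approximates eps (E ++ inserted (Nil (op n))) s (estimate M (inserted (Nil (op n)))).
  by rewrite cats0; exact: state_approximates hst.
case: o hsimple @Ef => [u v|v|v] hsimple Ef.
- have Eg : E ++ inserted (Insert u v :: ops) = rcons E (u, v) ++ inserted ops.
    by rewrite /= cat_rcons.
  rewrite Eg in hsimple; have hs1 := simple_cat hsimple.
  have uv : nat_of_ord u != v.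
    by have /andP[/allP/(_ (u, v))] := hs1; rewrite mem_rcons mem_head => /(_ isT).
  have szE : size E <= n * n.
    by have := simple_size hs1; rewrite size_rcons; lia.
  (* Degrees only grow, so those of the final graph bound the cost of scans in every intermediate
     one. *)
  have dgf x : dg (rcons (nat_edges E) (nat_of_ord u, nat_of_ord v)) x <= dg Ef x.
    by rewrite /Ef Eg /nat_edges map_cat dg_cat map_rcons leq_addr.
  have [||t [st [s1 [ex [fs1 [r1 [c1 iv1 am1]]] ck [m1 o1] hM1]]]] :=
    run V_ge W_ge (isT : ok_prog insert_c) hM (args := [:: nat_of_ord u; nat_of_ord v])
    (Q := fun s' => exists fs' r, [/\
       clk s' + 2000 * \sum_(0 <= j < S) weight n X0 (dg Ef) (mem s') j <=
         2000 * \sum_(0 <= j < S) weight n X0 (dg Ef) M j + 1500 * (S + 1) +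
         2000 * (size (rcons (nat_edges E) (nat_of_ord u, nat_of_ord v)) + 1) * \sum_(0 <= j < S) r j,
       inv n s a b X0 S (rcons (nat_edges E) (nat_of_ord u, nat_of_ord v)) (mem s') fs' &
       forall j, j < S -> amortized n q X0 M (mem s') fs fs' r j]).
  + by rewrite /= !(ltnW (ltn_trans (ltn_ord _) nV)).
  + apply: (insert_wp (ltn_ord s) nV S_gt0 SV SnV capV a_gt0 ab X0_gt0 X0_ge n_width
      Eb (ltn_ord u) (ltn_ord v) uv _ dgf (fs := fs)) => //.
      by rewrite size_nat_edges; lia.
    by move=> st' fs' r _ c' iv' am'; exists fs', r; split.
  have hst1 : state_ok (rcons E (u, v)) (memory st) fs1.
    by split => //; rewrite nat_edges_rcons m1.
  have [evs [r2 [S2 U2 R2 A2 Q2]]] := IH _ _ _ hsimple hst1.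
  have insE : insert_mem W M u v = memory st := insert_memE ex.
  exists (Event (Insert u v) t (output st) :: evs), (fun j => r1 j + r2 j); split.
  + exact: (@SessionCons W A n M (Insert u v) ops t st evs ex S2).
  + rewrite /update_time big_cons /=; move: U2; rewrite /update_time -Eg -/Ef => U2.
    move: c1; rewrite ck -m1 => c1.
    have szle : size (rcons (nat_edges E) (nat_of_ord u, nat_of_ord v)) <= size Ef.
      by rewrite /Ef Eg !size_nat_edges size_rcons size_nat_edges size_cat size_rcons leq_addr.
    have -> : \sum_(0 <= j < S) (r1 j + r2 j) = \sum_(0 <= j < S) r1 j + \sum_(0 <= j < S) r2 j.
      by rewrite big_split.
    rewrite (mulnDr (2000 * (size Ef + 1))).
    have : 2000 * (size (rcons (nat_edges E) (nat_of_ord u, nat_of_ord v)) + 1) *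
        \sum_(0 <= j < S) r1 j <= 2000 * (size Ef + 1) * \sum_(0 <= j < S) r1 j.
      by rewrite leq_mul2r leq_mul2l leq_add2r szle !orbT.
    move: c1 U2; rewrite mulnS.
    set T1 := \sum_(e <- evs | _) _; set T2 := \sum_(0 <= j < S) weight _ _ _ _ _.
    set T3 := \sum_(0 <= j < S) weight _ _ _ _ _; set T4 := _ * \sum_(0 <= j < S) r1 _.
    set T5 := _ * \sum_(0 <= j < S) r1 _; set T6 := _ * \sum_(0 <= j < S) r2 _.
    set T7 := _ * size (inserted ops).
    move: T1 T2 T3 T4 T5 T6 T7; clear; lia.
  + move=> j jS; have := am1 j jS; have := R2 j jS; rewrite /amortized -m1 /=.
    set N := n * scale_width X0 j; set k := size (inserted ops).
    set P1 := q * level_sum n j (memory st); set P := q * level_sum n j M.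
    have -> : N * (fs1 j + k) + P1 = N * fs1 j + P1 + N * k by rewrite mulnDr addnAC.
    have -> : N * (fs j + k.+1) + P = N * (fs j + 1) + P + N * k.
      by rewrite -addn1 [k + 1]addnC addnA mulnDr addnAC.
    rewrite 2!(mulnDr (8 * X0) _ (N * k)) mulnDl.
    move: (8 * X0 * (N * k)) (8 * X0 * (N * fs1 j + P1)) (8 * X0 * (N * (fs j + 1) + P)).
    by move: (r1 j * _) (r2 j * _); clear; lia.
  + move=> [|o pre] post; first by move=> _; exact: approx0.
    move=> [<- ops_eq]; have := A2 pre post ops_eq.
    by rewrite /= cat_rcons /estimate /= insE.
  + move=> [|e' pre] post e /=; first by move=> [<- _].
    move=> [<- evs_eq]; have := Q2 pre post e evs_eq.
    by rewrite /= cat_rcons /estimate /= insE.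
- have [||t [st [s1 [ex [c1 m1' out1] ck [m1 o1] hM1]]]] :=
    run V_ge W_ge (isT : ok_prog distance_c) hM (args := [:: nat_of_ord v])
    (Q := fun s' => [/\ clk s' <= 100, mem s' = M & out s' =
       if aget M 6 v < no_estimate X0 S then [:: aget M 6 v] else [::]]).
  + by rewrite /= (ltnW (ltn_trans (ltn_ord _) nV)).
  + by apply: (distance_wp (ltn_ord s) nV SnV infV iv).
  have mM : memory st = M by rewrite m1.
  have [evs [r [S2 U2 R2 A2 Q2]]] := IH _ _ _ hsimple hst.
  exists (Event (DistQuery v) t (output st) :: evs), r; split => //.
  + by apply: (@SessionCons W A n M (DistQuery v) ops t st evs ex); rewrite mM.
  + by rewrite /update_time big_cons.
  + move=> [|o pre] post; first by move=> _; exact: approx0.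
    by move=> [<- ops_eq]; exact: A2 ops_eq.
  + move=> [|e' pre] post e /=; last by move=> [<- evs_eq]; exact: Q2 evs_eq.
    move=> [<- _]; rewrite cats0 /answered /=; split.
      by rewrite o1 out1 (state_connected v hst) /estimate.
    by apply: Order.POrderTheory.le_trans C_ge; rewrite ler_nat -ck; lia.
- have [||t [st [s1 [ex [c1 m1' out1] ck [m1 o1] hM1]]]] :=
    run V_ge W_ge (isT : ok_prog path_c) hM (args := [:: nat_of_ord v])
    (Q := fun s' => [/\ clk s' <= 200 * ((aget M 6 v < no_estimate X0 S) * aget M 6 v + 1), mem s' = M & out s' =
       if aget M 6 v < no_estimate X0 S then (v : nat) :: traject (parent_at n M (aget M 7 v))
         (parent_at n M (aget M 7 v) v) (aget M 6 v) else [::]]).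
  + by rewrite /= (ltnW (ltn_trans (ltn_ord _) nV)).
  + by apply: (path_wp (ltn_ord s) nV SnV infV Eb iv) => //=; exact: ltn_ord.
  have mM : memory st = M by rewrite m1.
  have [evs [r [S2 U2 R2 A2 Q2]]] := IH _ _ _ hsimple hst.
  exists (Event (PathQuery v) t (output st) :: evs), r; split => //.
  + by apply: (@SessionCons W A n M (PathQuery v) ops t st evs ex); rewrite mM.
  + by rewrite /update_time big_cons.
  + move=> [|o pre] post; first by move=> _; exact: approx0.
    by move=> [<- ops_eq]; exact: A2 ops_eq.
  + move=> [|e' pre] post e /=; last by move=> [<- evs_eq]; exact: Q2 evs_eq.
    move=> [<- _]; rewrite cats0 /answered /= (state_connected v hst).
    case: ifP => lt.
      rewrite lt in c1 out1; have [[_ h1 h2 h3] _] := best_path Eb iv (ltn_ord v) lt.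
      have [p [e1 e2]] := path_ord h1.
      have sz : size p = aget M 6 v by rewrite -(size_map (@nat_of_ord n)) e1 size_traject.
      exists p; split => //.
      * split => //; first by apply: val_inj => /=; rewrite -h2 -e1 last_map.
        by rewrite -(map_inj_uniq (@ord_inj n)) /= e1.
      * by rewrite o1 out1 /= e1.
      * apply: (@Order.POrderTheory.le_trans _ _ (200%:R * (size p).+1%:R))%R.
          by rewrite -natrM ler_nat -ck sz; lia.
        by rewrite ler_wpM2r.
    rewrite lt in c1 out1; split; first by rewrite o1 out1.
    by apply: Order.POrderTheory.le_trans C_ge; rewrite ler_nat -ck; lia.
Qed.

End Session.

(** * The total update time *)

Lemma session_ops W A n M (ops : seq (op n)) evs :
  session W A M ops evs -> map (@ev_op n) evs = ops.
Proof. by elim=> //= M' o ops' t st evs' _ _ ->. Qed.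

(** Without insertions the claimed bound can be 0, for instance when n = 1 and the logarithm
    vanishes; that case is settled by this equality. *)
Lemma update_time0 n (evs : seq (event n)) :
  inserted (map (@ev_op n) evs) = [::] -> update_time evs = 0.
Proof.
rewrite /update_time; elim: evs => [|[[u v|v|v] t out] evs IH] //=; first by rewrite big_nil.
all: by rewrite big_cons.
Qed.

Section Total.
Variables (n s a b q X0 S : nat) (E0 Ef : seq (nat * nat)) (M fs : nat -> nat).
Hypotheses (sn : s < n) (X0_gt0 : 0 < X0) (S_gt0 : 0 < S) (q_gt0 : 0 < q).
Hypothesis iv : inv n s a b X0 S E0 M fs.

Lemma lvl_le_cap j x : j < S -> x < n -> level_at n M j x <= scale_cap X0 j.
Proof.
move=> jS xn; have [_ sok _] := iv; have [G [F [[sc _ _] _]]] := sok j jS.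
exact: (sc_cap sc xn).
Qed.

Lemma potential_le j : j < S -> level_sum n j M <= n * scale_cap X0 j.
Proof.
move=> jS; rewrite /level_sum -[X in _ <= X * _]card_ord -sum_nat_const.
by apply: leq_sum => x _; exact: lvl_le_cap.
Qed.

(** The degrees add up to at most 2 m, and the levels of scale 0 are at most 2 X0. *)
Lemma weight_le j : j < S ->
  weight n X0 (dg Ef) M j <= 2 * size Ef + 4 * X0 * size Ef.
Proof.
move=> jS; have sumE : \sum_(x < n) dg Ef x <= 2 * size Ef.
  rewrite -(big_mkord xpredT (dg Ef)); apply: sum_dg_le; exact: iota_uniq.
rewrite /weight; apply: leq_add.
  apply: leq_trans sumE; apply: leq_sum => x _.
  by rewrite -[X in _ <= X]muln1 leq_mul2l leq_b1 orbT.
case: eqP => [->|_] //; rewrite mul1n.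
have c0 : scale_cap X0 0 = 2 * X0 by rewrite /scale_cap /scale_width expn0; lia.
apply: (@leq_trans (\sum_(x < n) dg Ef x * (2 * X0))).
  by apply: leq_sum => x _; rewrite leq_mul2l -c0 lvl_le_cap ?orbT.
rewrite -big_distrl /=; apply: leq_trans (leq_mul sumE (leqnn _)) _; lia.
Qed.

(** 24 = 8 (1 + 2): the insertions supply at most q n X, and q times the initial level sum at most
    twice as much. *)
Lemma rebuilds_le j k r : j < S -> fs j = 0 -> k <= q ->
  r * (q * n * scale_width X0 j) <=
    8 * X0 * (n * scale_width X0 j * (fs j + k) + q * level_sum n j M) ->
  r <= 24 * X0.
Proof.
move=> jS -> kq h; have w0 : 0 < scale_width X0 j by rewrite muln_gt0 X0_gt0 expn_gt0.
have B0 : 0 < q * n * scale_width X0 j by rewrite muln_gt0 w0 andbT muln_gt0 q_gt0 (leq_ltn_trans _ sn).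
rewrite -(leq_pmul2r B0); apply: leq_trans h _.
have -> : 24 * X0 * (q * n * scale_width X0 j) = 8 * X0 * (n * scale_width X0 j * q + q * (n * scale_cap X0 j)).
  by rewrite /scale_cap; nia.
rewrite leq_mul2l; apply/orP; right; apply: leq_add.
  by rewrite add0n leq_mul2l kq orbT.
by rewrite leq_mul2l potential_le ?orbT.
Qed.

(** The constant is 12000 for the weights, 3000 for the fixed cost per insertion and scale, and
    96000 for the rebuilds. The fixed cost is absorbed because k <= m. *)
Lemma total_le T k (r : nat -> nat) : (forall j, fs j = 0) -> 0 < k -> k <= q -> k <= size Ef ->
  T <= 2000 * \sum_(0 <= j < S) weight n X0 (dg Ef) M j + 1500 * (S + 1) * k +
    2000 * (size Ef + 1) * \sum_(0 <= j < S) r j ->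
  (forall j, j < S -> r j * (q * n * scale_width X0 j) <=
    8 * X0 * (n * scale_width X0 j * (fs j + k) + q * level_sum n j M)) ->
  T <= 111 * 1000 * (size Ef * (X0 * S)).
Proof.
move=> fs0 k0 kq kE hT hr.
have w : \sum_(0 <= j < S) weight n X0 (dg Ef) M j <= S * (6 * X0 * size Ef).
  rewrite big_mkord -[X in _ <= X * _]card_ord -sum_nat_const.
  apply: leq_sum => j _; apply: leq_trans (weight_le (ltn_ord j)) _; nia.
have rs : \sum_(0 <= j < S) r j <= S * (24 * X0).
  rewrite big_mkord -[X in _ <= X * _]card_ord -sum_nat_const.
  by apply: leq_sum => j _; exact: (rebuilds_le (ltn_ord j) (fs0 j) kq (hr j (ltn_ord j))).
set m := size Ef in kE hT w *; apply: leq_trans hT _.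
have h1 : 2000 * \sum_(0 <= j < S) weight n X0 (dg Ef) M j <= 2000 * (S * (6 * X0 * m)).
  by rewrite leq_mul2l w.
have h2 : 1500 * (S + 1) * k <= 1500 * (S + S) * (m * X0).
  apply: leq_mul; first by rewrite leq_mul2l leq_add2l.
  by apply: leq_trans kE _; rewrite leq_pmulr.
have h3 : 2000 * (m + 1) * \sum_(0 <= j < S) r j <= 2000 * (m + m) * (S * (24 * X0)).
  by apply: leq_mul => //; rewrite leq_mul2l leq_add2l; lia.
apply: leq_trans (leq_add (leq_add h1 h2) h3) _.
have -> : S * (6 * X0 * m) = 6 * (m * (X0 * S)) by nia.
have -> : 1500 * (S + S) * (m * X0) = 3000 * (m * (X0 * S)) by nia.
have -> : 2000 * (m + m) * (S * (24 * X0)) = 96 * 1000 * (m * (X0 * S)) by nia.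
by move: (m * (X0 * S)); clear; lia.
Qed.

End Total.

(** * From X0 and the number of scales to the real bound *)

Section RealBound.
Local Open Scope ring_scope.
Variables (R : realType) (eps : R) (n q a b X0 S : nat).
Hypotheses (eps01 : 0 < eps <= 1) (epsE : eps <= 2 * (a%:R / b%:R)).
Hypotheses (n_gt1 : (1 < n)%N) (q_gt0 : (0 < q)%N) (a_gt0 : (0 < a)%N) (b_gt0 : (0 < b)%N).
Hypothesis X0_min : X0 = 1%N \/
  (X0.-1 * X0.-1 * X0.-1 * X0.-1 * (a * a) < q * q * n * (b * b))%N.
Hypotheses (X0_gt0 : (0 < X0)%N) (S_gt0 : (0 < S)%N).
Hypothesis S_min : S = 1%N \/ (scale_width X0 S.-2 < n)%N.

Let y : R := n%:R `^ (4^-1) * Num.sqrt q%:R / Num.sqrt eps.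

(** This absorbs the rounding of X0 to an integer. *)
Lemma y_ge1 : 1 <= y.
Proof.
have [e0 e1] := andP eps01.
have s0 : 0 < Num.sqrt eps by rewrite sqrtr_gt0.
rewrite /y ler_pdivlMr // mul1r.
have h1 : Num.sqrt eps <= 1 by rewrite -sqrtr1 ler_wsqrtr.
have h2 : 1 <= Num.sqrt (q%:R : R) by rewrite -[X in X <= _]sqrtr1 ler_wsqrtr // ler1n.
have h3 : 1 <= n%:R `^ (4^-1) :> R.
  have : (1 : R) `^ (4^-1) <= n%:R `^ (4^-1).
    by apply: ge0_ler_powR; rewrite ?invr_ge0 ?nnegrE // ler1n ltnW.
  by rewrite powR1.
apply: le_trans h1 _; rewrite -[X in X <= _]mulr1.
by apply: ler_pM.
Qed.

Lemma y_pow4 : y ^+ 4 = n%:R * q%:R ^+ 2 / eps ^+ 2.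
Proof.
have [e0 e1] := andP eps01.
have hn : (n%:R `^ (4^-1) : R) ^+ 4 = n%:R.
  by rewrite -powR_mulrn ?powR_ge0 // -powRrM mulVf ?pnatr_eq0 // powRr1.
have sq x : 0 <= x -> Num.sqrt x ^+ 4 = x ^+ 2 :> R.
  by move=> x0; rewrite (exprM _ 2 2) sqr_sqrtr.
by rewrite /y !exprMn exprVn hn !sq // ltW.
Qed.

(** Since b / a <= 2 / eps, minimality of X0 bounds (X0 - 1)^4 by 4 y^4, so X0 - 1 <= 2 y; rounding
    costs at most another y. *)
Lemma root_le : X0%:R <= 3 * y.
Proof.
have y1 := y_ge1; have [e0 e1] := andP eps01.
case: X0_min => [->|lt]; first by lra.
have h : X0.-1%:R <= 2 * y.
  rewrite -(@ler_pXn2r _ 4) ?nnegrE //; last by lra.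
  have a0 : 0 < (a * a)%:R :> R by rewrite ltr0n muln_gt0 a_gt0.
  rewrite -(ler_pM2r a0) exprMn y_pow4.
  have -> : X0.-1%:R ^+ 4 * (a * a)%:R = (X0.-1 * X0.-1 * X0.-1 * X0.-1 * (a * a))%:R :> R.
    by rewrite !natrM; ring.
  apply: (@le_trans _ _ (q * q * n * (b * b))%:R); first by rewrite ler_nat ltnW.
  have hb : b%:R * eps <= 2 * a%:R.
    have b0 : 0 < b%:R :> R by rewrite ltr0n.
    by move: epsE; rewrite mulrA ler_pdivlMr // mulrC.
  have hb2 : (b%:R * eps) ^+ 2 <= (2 * a%:R) ^+ 2.
    by rewrite ler_pXn2r ?nnegrE // ?mulr_ge0 // ltW.
  have -> : 2 ^+ 4 * (n%:R * q%:R ^+ 2 / eps ^+ 2) * (a * a)%:R =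
     4 * (n%:R * q%:R ^+ 2) * (2 * a%:R) ^+ 2 / eps ^+ 2 :> R.
    by rewrite natrM; field; rewrite gt_eqF.
  rewrite ler_pdivlMr ?exprn_gt0 //.
  have -> : (q * q * n * (b * b))%:R * eps ^+ 2 = (n%:R * q%:R ^+ 2) * (b%:R * eps) ^+ 2 :> R.
    by rewrite !natrM; ring.
  have nq : 0 <= n%:R * q%:R ^+ 2 :> R by rewrite mulr_ge0 ?exprn_ge0.
  apply: (@le_trans _ _ (n%:R * q%:R ^+ 2 * (2 * a%:R) ^+ 2)); first by rewrite ler_wpM2l.
  rewrite ler_wpM2r ?sqr_ge0 //; lra.
have -> : X0%:R = X0.-1%:R + 1 :> R by rewrite natr1 prednK.
lra.
Qed.

(** The last width but one is below n and at least 2^(S - 2), so S is at most log_2 n + 2, which is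
    at most 3 log_2 n for n >= 2. *)
Lemma scales_le : S%:R * ln 2 <= 3 * ln n%:R :> R.
Proof.
have l2 : 0 < ln 2 :> R by rewrite ln_gt0 // ltr1n.
have ln2n : ln 2 <= ln n%:R :> R.
  by rewrite ler_ln ?posrE ?ltr0n ?(ltnW n_gt1) // ler_nat.
case: S_min => [->|lt]; first by rewrite mul1r; lra.
have [S2|] := leqP 2 S; last first.
  case: (S) S_gt0 => [|[|k]] // _ _; rewrite mul1r; lra.
have h : S.-2%:R * ln 2 <= ln n%:R :> R.
  rewrite mulrC mulr_natr -lnXn // ler_ln ?posrE ?exprn_gt0 ?ltr0n ?(ltnW n_gt1) //.
  rewrite -natrX ler_nat; apply: leq_trans (ltnW lt); by rewrite /scale_width leq_pmull.
have -> : S%:R = S.-2%:R + 2 :> R by rewrite -natrD; congr _%:R; lia.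
rewrite mulrDl; lra.
Qed.

Lemma root_scales_le : (X0 * S)%:R <=
  9 / ln 2 * (n%:R `^ (4^-1) * Num.sqrt q%:R * ln n%:R / Num.sqrt eps).
Proof.
have l2 : 0 < ln 2 :> R by rewrite ln_gt0 // ltr1n.
have -> : 9 / ln 2 * (n%:R `^ (4^-1) * Num.sqrt q%:R * ln n%:R / Num.sqrt eps) =
    (3 * y) * (3 * ln n%:R / ln 2) :> R.
  by rewrite /y; ring.
rewrite natrM; apply: ler_pM => //; first exact: root_le.
by rewrite ler_pdivlMr // scales_le.
Qed.

End RealBound.

(** * Input format, word size and conclusion *)

Lemma input_slots n (s : 'I_n) q a b (E : seq ('I_n * 'I_n)) j :
  input s q a b E (6 + j) = nth 0 (slots (nat_edges E)) j.
Proof. by rewrite slots_nat_edges. Qed.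

Lemma input_le n (s : 'I_n) q a b (E : seq ('I_n * 'I_n)) V :
  n <= V -> q <= V -> a <= V -> b <= V -> size E <= V ->
  forall j, input s q a b E j <= V.
Proof.
move=> hn hq ha hb hE; have hs : s <= V := leq_trans (ltnW (ltn_ord s)) hn.
move=> k; have [|ge] := ltnP k 6; first by case: k => [|[|[|[|[|[|k]]]]]].
rewrite -(subnKC ge) input_slots; move: (k - 6) => j.
have [lt|ge'] := ltnP j (size (slots (nat_edges E))).
  apply: leq_trans hn; apply: ltnW; apply: (slots_bounded (nat_edges_bounded (E := E))).
  exact: mem_nth.
by rewrite nth_default.
Qed.

(** All terms are at most cubic in Z = n + q + a + b + 2, and Z >= 5 gives Z^8 >= 125 Z^3, which
    absorbs the constants. *)
Lemma word_bound n q a b m : 0 < n -> 0 < a -> 0 < b -> m <= n * n ->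
  let V := (n + q + a + b + 2) ^ 8 in
  [/\ 256 <= V, 20 * (q * n * b + 1) + (n + 20) * (n + 20) + q + a + b + 2 * m <= V &
      8 + 2 * (n * n) < V].
Proof.
move=> n0 a0 b0 hm; set Z := n + q + a + b + 2.
have Z5 : 5 <= Z by rewrite /Z; lia.
have Z2 : 5 * Z <= Z ^ 2 by rewrite -mulnn leq_mul2r Z5 orbT.
have Z3 : 5 * Z ^ 2 <= Z ^ 3 by rewrite [Z ^ 3]expnS leq_mul2r Z5 orbT.
have Z6 : 125 * Z ^ 3 <= Z ^ 8.
  rewrite (_ : 8 = 5 + 3) // expnD leq_mul2r; apply/orP; right.
  by apply: leq_trans (_ : 5 ^ 3 <= _) _ => //; apply: (leq_trans (_ : _ <= 5 ^ 5)) => //; rewrite leq_exp2r.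
have nn : n * n <= Z ^ 2 by rewrite -mulnn; apply: leq_mul; rewrite /Z; lia.
have qnb : q * n * b <= Z ^ 3.
  by rewrite !expnS expn0 muln1 mulnA; apply: leq_mul; [apply: leq_mul|]; rewrite /Z; lia.
have n20 : (n + 20) * (n + 20) <= 25 * Z ^ 2.
  have h : n + 20 <= 5 * Z by rewrite /Z; lia.
  by rewrite -mulnn (_ : 25 = 5 * 5) // mulnACA leq_mul.
have hq : q + a + b <= Z by rewrite /Z; lia.
move: (Z ^ 2) (Z ^ 3) (Z ^ 8) ((n + 20) * (n + 20)) (q * n * b) (n * n) hm nn qnb n20 Z2 Z3 Z6 Z5 hq.
by clear; move=> *; split; lia.
Qed.

Local Open Scope ring_scope.

(* The real eps is presented to the machine as a fraction a / b of words that
   approximates it from below within a factor 2 (a / b = eps is allowed).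
   The machine words are polynomially bounded in the input, with exponent c. *)
Theorem theorem2 (R : realType) :
  exists (A : algorithm) (c : nat) (C : R),
  forall (n : nat) (s : 'I_n) (q : nat) (eps : R) (a b : nat)
         (E0 : seq ('I_n * 'I_n)),
  0 < eps <= 1 ->
  a%:R / b%:R <= eps <= 2 * (a%:R / b%:R) ->
  simple_graph E0 ->
  let W := ((n + q + a + b + 2) ^ c)%N in
  exists (t0 : nat) (st0 : state),
    exec W (preprocess A) (call_state [::] (input s q a b E0)) t0 st0 /\
    (t0 <= W)%N /\
    forall ops : seq (op n),
      simple_graph (E0 ++ inserted ops) ->
      (size (inserted ops) <= q)%N ->
      exists evs : seq (event n),
        session W A (memory st0) ops evs /\
        (let m := size (E0 ++ inserted ops) in
         (update_time evs)%:R <=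
           C * (m%:R * n%:R `^ (4^-1) * Num.sqrt q%:R * ln n%:R
                / Num.sqrt eps)) /\
        exists est : seq ('I_n * 'I_n) -> 'I_n -> nat,
          (forall pre post : seq (op n), ops = pre ++ post ->
             approximates eps (E0 ++ inserted pre) s
               (est (E0 ++ inserted pre))) /\
          (forall (pre post : seq (event n)) (e : event n),
             evs = pre ++ e :: post ->
             let E := E0 ++ inserted (map (@ev_op n) pre) in
             answered C E s (est E) e).
Proof.
have l2 : 0 < ln 2 :> R by rewrite ln_gt0 // ltr1n.
have [N NE] : exists N, N = (111 * 1000)%N by exists (111 * 1000)%N.
pose K : R := N%:R * (9 / ln 2).
have K0 : 0 <= K by rewrite /K mulr_ge0 // divr_ge0 // ltW.
(* 320 = 8 * 40: [V] is an eighth power, and intermediate results are bounded by [V ^ 40]. The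
   summand 200 pays for queries, [K] for updates. *)
exists bfs_algorithm, 320%N, (K + 200%:R).
move=> n s q eps a b E0 eps01 epsE simple0 W.
have [e0 e1] := andP eps01; have [ae ea] := andP epsE.
have n0 : (0 < n)%N by exact: leq_ltn_trans (ltn_ord s).
have [a0 b0] : (0 < a)%N /\ (0 < b)%N.
  by split; rewrite lt0n; apply/eqP => z; move: ea; rewrite z ?mul0r ?invr0 ?mulr0; lra.
have ab : (a <= b)%N.
  have bp : 0 < b%:R :> R by rewrite ltr0n.
  by rewrite -(ler_nat R) -[X in _ <= X]mul1r -ler_pdivrMr //; lra.
have szE := simple_size simple0.
set V := ((n + q + a + b + 2) ^ 8)%N.
have [V256 Vbig nnV] := word_bound q n0 a0 b0 szE; rewrite -/V in V256 Vbig nnV.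
have W_ge : (V ^ 40 <= W)%N by rewrite /V -expnM.
clearbody V W.
have Eb := nat_edges_bounded (E := E0).
have hin j : (input s q a b E0 j <= V)%N by apply: input_le => //; move: Vbig; clear; lia.
have Vbig' : (20 * (q * n * b + 1) + (n + 20) * (n + 20) + q + a + b +
    2 * size (nat_edges E0) <= V)%N by rewrite size_nat_edges.
have [||t0 [st0 [s1 [ex [X0 [S [ck X1 [X2 X3] [X4 S0 S1 S2] [wS Sn iv]]]] ckE [m1 _] hM]]]] :=
  run V256 W_ge (isT : ok_prog preprocess_c) hin (args := [::])
  (Q := fun s' => exists X0 S, [/\ (clk s' <= 4500 * (V * V))%N, (0 < X0)%N,
     (X0 <= q * n * b + 1)%N /\ (q * q * n * (b * b) <= X0 * X0 * X0 * X0 * (a * a))%N,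
     [/\ X0 = 1%N \/ (X0.-1 * X0.-1 * X0.-1 * X0.-1 * (a * a) < q * q * n * (b * b))%N,
       (0 < S)%N, (n <= scale_width X0 S.-1)%N & S = 1%N \/ (scale_width X0 S.-2 < n)%N] &
     [/\ (scale_width X0 S.-1 <= X0 + 2 * n)%N, (S <= n + 1)%N &
       inv n s a b X0 S (nat_edges E0) (mem s') (fun _ => 0%N)]]) => //.
  apply: (preprocess_wp Eb (simple_loopless simple0) (ltn_ord s) a0 ab Vbig') => //=.
  - by rewrite /input /= size_nat_edges.
  - by move=> j _; exact: input_slots.
  by move=> s' X0 S _ *; exists X0, S; split.
exists t0, st0; split => //; split.
  rewrite -ckE; apply: leq_trans ck (leq_trans _ W_ge).
  apply: (@leq_trans (V ^ 4)); last by rewrite leq_exp2l //; exact: leq_trans V256.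
  rewrite (_ : V ^ 4 = V ^ 2 * (V * V))%N ?leq_mul2r; last by rewrite !expnS expn0; lia.
  by apply/orP; right; rewrite -mulnn; apply: leq_trans (leq_mul V256 V256).
move=> ops hsimple hsize.
have nV : (n < V)%N by move: Vbig; clear; lia.
have capV i : (i < S)%N -> (scale_cap X0 i + scale_cap X0 i < V)%N.
  move=> iS; have := width_bound (simple_loopless simple0) (ltn_ord s) a0 ab Vbig' X1 X2 S0 Sn wS iS.
  by rewrite /scale_cap; lia.
have SV : (S <= V)%N by move: Vbig Sn; clear; lia.
have SnV : (S * n <= V)%N.
  apply: (@leq_trans ((n + 1) * n)); first by rewrite leq_mul2r Sn orbT.
  by move: Vbig; clear; lia.
have C200 : 200%:R <= K + 200%:R by rewrite lerDr.
have hst : state_ok V s a b X0 S E0 (memory st0) (fun _ => 0%N) by split; rewrite // m1.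
have [evs [r [S' U' R' A' Q']]] := session_from V256 W_ge nV S0 SV SnV capV a0 ab X1 X3 S1
  nnV ae C200 hsimple hst.
exists evs; split => //; split; last first.
  (* Dropping the initial edges leaves the insertions to be replayed from the preprocessed
     memory. *)
  exists (fun E v => estimate W (memory st0) (drop (size E0) E) v); split.
  - by move=> pre post /A'; rewrite drop_size_cat.
  - by move=> pre post e /Q' /=; rewrite drop_size_cat.
set rate := n%:R `^ (4^-1) * Num.sqrt q%:R * ln n%:R / Num.sqrt eps.
have mE : (size (E0 ++ inserted ops))%:R * n%:R `^ (4^-1) * Num.sqrt q%:R * ln n%:R
    / Num.sqrt eps = (size (E0 ++ inserted ops))%:R * rate.
  by rewrite /rate !mulrA.
rewrite /= mE; have rate0 : 0 <= rate.
  by rewrite /rate divr_ge0 ?sqrtr_ge0 // !mulr_ge0 ?powR_ge0 ?sqrtr_ge0 // ln_ge0 // ler1n.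
have [ins0|ins1] := posnP (size (inserted ops)).
  rewrite update_time0; last by rewrite (session_ops S'); exact: size0nil.
  by rewrite mulr_ge0 ?(mulr_ge0 _ rate0) ?addr_ge0 ?ler0n.
have q0 : (0 < q)%N := leq_trans ins1 hsize.
have n1 : (1 < n)%N.
  have := simple_loopless hsimple; case E: (E0 ++ inserted ops) => [|[u v] E'].
    move/(congr1 size)/eqP: E; rewrite size_cat addn_eq0 => /andP[_ /eqP z].
    by rewrite z in ins1.
  move=> /= /andP[uv _]; move: uv (ltn_ord u) (ltn_ord v).
  by move: (nat_of_ord u) (nat_of_ord v); clear; lia.
have kE : (size (inserted ops) <= size (nat_edges (E0 ++ inserted ops)))%N.
  by rewrite size_nat_edges size_cat leq_addl.
rewrite -m1 in iv.
have T := total_le (ltn_ord s) X1 S0 q0 iv (fun _ => erefl) ins1 hsize kE U' R'.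
rewrite size_nat_edges -NE in T.
set m := size (E0 ++ inserted ops) in T *.
have RS := root_scales_le eps01 ea n1 q0 a0 b0 X4 X1 S0 S2.
apply: (@le_trans _ _ (N * (m * (X0 * S)))%N%:R); first by rewrite ler_nat.
apply: (@le_trans _ _ (K * (m%:R * rate))); last first.
  by rewrite ler_wpM2r ?lerDl // mulr_ge0.
rewrite natrM [X in _ * X]natrM /K -mulrA ler_wpM2l // mulrCA ler_wpM2l //.
Qed.
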